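(* Under the standing hypotheses (H1)–(H6) below, suppose $\tau$ is in the limit-circle case at both endpoints and $S$ is a self-adjoint restriction of $T_{\max}$. Then for each $z\in\rho(S)$ the resolvent $R_z=(S-z)^{-1}$ is an integral operator $$R_zf(x)=\int_a^b G_z(x,y)f(y)\,d\varrho(y),\qquad f\in L^2((a,b);\varrho),$$ with a kernel $G_z$ square integrable with respect to $\varrho\otimes\varrho$. Moreover, for any two linearly independent solutions $u_1,u_2$ of $(\tau-z)u=0$ there are coefficients $m^\pm_{ij}(z)\in\mathbb{C}$, $i,j\in\{1,2\}$, such that $$G_z(x,y)=\begin{cases}\sum_{i,j=1}^2 m^+_{ij}(z)u_i(x)u_j(y), & y<x,\\ \sum_{i,j=1}^2 m^-_{ij}(z)u_i(x)u_j(y), & y\ge x.\end{cases}$$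
   Context: Let $-\infty\le a<b\le\infty$ and $\varrho,\varsigma,\chi$ locally finite Borel measures on $(a,b)$ with: (H1) $\varrho$ positive; (H2) $\chi$ real-valued; (H3) $\varsigma$ real-valued with $\operatorname{supp}\varsigma=(a,b)$; (H4) $\varsigma(\{x\})\chi(\{x\})=\varsigma(\{x\})\varrho(\{x\})=0$ for all $x$; (H5) for every gap $(\alpha,\beta)$ of $\operatorname{supp}\varrho$ (open interval in the complement with $\alpha,\beta\in\operatorname{supp}\varrho$) and every $f\in\mathfrak{D}_\tau$ with $f(\alpha-)=f(\beta+)=0$ one has $f=0$ on $(\alpha,\beta)$; (H6) $\operatorname{supp}\varrho$ has more than one point. Notation: $\int_c^x h\,d\mu=\int_{[c,x)}h\,d\mu$ ($x>c$), $0$ ($x=c$), $-\int_{[x,c)}h\,d\mu$ ($x<c$); $AC_{loc}((a,b);\mu)$: functions $f(x)=f(c)+\int_c^x h\,d\mu$, $h=\frac{df}{d\mu}\in L^1_{loc}$. $\mathfrak{D}_\tau$: $f\in AC_{loc}((a,b);\varsigma)$ for which there is $F\in AC_{loc}((a,b);\varrho)$ with $F=-\frac{df}{d\varsigma}+\int_c^{\cdot}f\,d\chi$ $|\varsigma|$-a.e.; $\tau f:=\frac{dF}{d\varrho}$; solutions of $(\tau-z)u=0$ are $u\in\mathfrak{D}_\tau$ with $\tau u=zu$. In $L^2((a,b);\varrho)$: $T_{\max}=\{(f,\tau f): f\in\mathfrak{D}_\tau,\ f,\tau f\in L^2\}$ (a linear relation). $\tau$ is l.c. at an endpoint if for all $z$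 all solutions of $\tau u=zu$ are square-integrable w.r.t. $\varrho$ near it. A self-adjoint restriction of $T_{\max}$ is a linear relation $S\subseteq T_{\max}$ with $S=S^\ast$. For a linear relation $S$, $(S-z)^{-1}=\{(g-zf,f):(f,g)\in S\}$, and the resolvent set $\rho(S)$ is the set of $z\in\mathbb{C}$ for which $(S-z)^{-1}$ is an everywhere defined (single-valued) operator on $L^2((a,b);\varrho)$. *)

(* Defs.v *)
From HB Require Import structures.
From mathcomp Require Import all_boot all_order all_algebra.
From mathcomp Require Import all_classical all_reals all_analysis.
From mathcomp Require Export complex.
Set Implicit Arguments.
Unset Strict Implicit.
Unset Printing Implicit Defensive.
Import Order.TTheory GRing.Theory Num.Theory.
Import numFieldNormedType.Exports.
Local Open Scope classical_set_scope.
Local Open Scope ring_scope.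

Definition Itv (R : realType) (a b : \bar R) : set R :=
  [set x | (a < x%:E)%E /\ (x%:E < b)%E].

Definition cre (R : realType) (T : Type) (f : T -> R[i]) : T -> R :=
  fun x => complex.Re (f x).
Definition cim (R : realType) (T : Type) (f : T -> R[i]) : T -> R :=
  fun x => complex.Im (f x).
Definition cconj (R : realType) (z : R[i]) : R[i] :=
  Complex (complex.Re z) (- complex.Im z).
Definition csq (R : realType) (T : Type) (f : T -> R[i]) : T -> R :=
  fun x => complex.Re (f x) ^+ 2 + complex.Im (f x) ^+ 2.

Definition cintegrable d (T : measurableType d) (R : realType)
  (mu : {measure set T -> \bar R}) (D : set T) (f : T -> R[i]) : Prop :=
  mu.-integrable D (EFin \o cre f) /\ mu.-integrable D (EFin \o cim f).

Definition cInt d (T : measurableType d) (R : realType)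
  (mu : {measure set T -> \bar R}) (D : set T) (f : T -> R[i]) : R[i] :=
  Complex (\int[mu]_(x in D) cre f x) (\int[mu]_(x in D) cim f x).

Definition sqint d (T : measurableType d) (R : realType)
  (mu : {measure set T -> \bar R}) (D : set T) (f : T -> R[i]) : Prop :=
  measurable_fun D (cre f) /\ measurable_fun D (cim f) /\
  (\int[mu]_(x in D) (csq f x)%:E < +oo)%E.

Definition ae_eqc d (T : measurableType d) (R : realType)
  (mu : {measure set T -> \bar R}) (D : set T) (f g : T -> R[i]) : Prop :=
  mu.-negligible (D `&` [set x | f x <> g x]).

Definition locfin (R : realType) (a b : \bar R)
  (mu : {measure set R -> \bar R}) : Prop :=
  forall al be : R, (a < al%:E)%E -> al <= be -> (be%:E < b)%E ->
    (mu [set t | (al <= t <= be)%R] < +oo)%E.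

(* A real-valued locally finite Borel measure on (a,b) is given by its
   Jordan decomposition mu = mup - mum (mup, mum mutually singular on (a,b)). *)
Definition msingular (R : realType) (a b : \bar R)
  (mup mum : {measure set R -> \bar R}) : Prop :=
  exists P : set R, measurable P /\
    mup (Itv a b `&` ~` P) = 0%E /\ mum (Itv a b `&` P) = 0%E.

Definition signed_locfin (R : realType) (a b : \bar R)
  (mup mum : {measure set R -> \bar R}) : Prop :=
  [/\ locfin a b mup, locfin a b mum & msingular a b mup mum].

Definition spt (R : realType) (mup mum : {measure set R -> \bar R}) (x : R) : R :=
  fine (mup [set x]) - fine (mum [set x]).

Definition supp (R : realType) (a b : \bar R)
  (mu : {measure set R -> \bar R}) (x : R) : Prop :=
  Itv a b x /\ forall e : R, 0 < e ->
    mu (Itv a b `&` [set t | (x - e < t < x + e)%R]) <> 0%E.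

(* support of the signed measure mup - mum, i.e. of |mu| = mup + mum *)
Definition ssupp (R : realType) (a b : \bar R)
  (mup mum : {measure set R -> \bar R}) (x : R) : Prop :=
  Itv a b x /\ forall e : R, 0 < e ->
    (mup (Itv a b `&` [set t | (x - e < t < x + e)%R]) + mum (Itv a b `&` [set t | (x - e < t < x + e)%R])
       <> 0)%E.

Definition locint (R : realType) (a b : \bar R)
  (mu : {measure set R -> \bar R}) (h : R -> R[i]) : Prop :=
  forall al be : R, (a < al%:E)%E -> al <= be -> (be%:E < b)%E ->
    cintegrable mu [set t | (al <= t <= be)%R] h.

Definition cfrom (R : realType) (mu : {measure set R -> \bar R})
  (c x : R) (h : R -> R[i]) : R[i] :=
  if c < x then cInt mu [set t | (c <= t < x)%R] h
  else if x == c then 0 else - cInt mu [set t | (x <= t < c)%R] h.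

Definition sfrom (R : realType) (mup mum : {measure set R -> \bar R})
  (c x : R) (h : R -> R[i]) : R[i] :=
  cfrom mup c x h - cfrom mum c x h.

Definition sAC (R : realType) (a b : \bar R)
  (mup mum : {measure set R -> \bar R}) (f h : R -> R[i]) : Prop :=
  locint a b mup h /\ locint a b mum h /\
  exists2 c, Itv a b c &
    forall x, Itv a b x -> f x = f c + sfrom mup mum c x h.

Definition pAC (R : realType) (a b : \bar R)
  (mu : {measure set R -> \bar R}) (f h : R -> R[i]) : Prop :=
  locint a b mu h /\
  exists2 c, Itv a b c &
    forall x, Itv a b x -> f x = f c + cfrom mu c x h.

(* The differential expression tau: "f in D_tau and tau f = g" where g
   is determined rho-a.e. ; sgp - sgm = varsigma, chp - chm = chi.      *)
Definition is_tau (R : realType) (a b : \bar R)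
  (rho sgp sgm chp chm : {measure set R -> \bar R}) (f g : R -> R[i]) : Prop :=
  exists c : R, exists h F k : R -> R[i],
    [/\ Itv a b c, sAC a b sgp sgm f h, pAC a b rho F k,
        locint a b chp f /\ locint a b chm f &
        [/\ ae_eqc sgp (Itv a b) F (fun x => - h x + sfrom chp chm c x f),
             ae_eqc sgm (Itv a b) F (fun x => - h x + sfrom chp chm c x f) &
             ae_eqc rho (Itv a b) g k]].

Definition Dtau (R : realType) (a b : \bar R)
  (rho sgp sgm chp chm : {measure set R -> \bar R}) (f : R -> R[i]) : Prop :=
  exists g, is_tau a b rho sgp sgm chp chm f g.

Definition is_solution (R : realType) (a b : \bar R)
  (rho sgp sgm chp chm : {measure set R -> \bar R}) (z : R[i])
  (u : R -> R[i]) : Prop :=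
  is_tau a b rho sgp sgm chp chm u (fun x => z * u x).

Definition lc_left (R : realType) (a b : \bar R)
  (rho sgp sgm chp chm : {measure set R -> \bar R}) : Prop :=
  forall (z : R[i]) (u : R -> R[i]), is_solution a b rho sgp sgm chp chm z u ->
    exists2 c : R, Itv a b c & sqint rho (Itv a c%:E) u.

Definition lc_right (R : realType) (a b : \bar R)
  (rho sgp sgm chp chm : {measure set R -> \bar R}) : Prop :=
  forall (z : R[i]) (u : R -> R[i]), is_solution a b rho sgp sgm chp chm z u ->
    exists2 c : R, Itv a b c & sqint rho (Itv c%:E b) u.

Definition gap_condition (R : realType) (a b : \bar R)
  (rho sgp sgm chp chm : {measure set R -> \bar R}) : Prop :=
  forall al be : R, al < be -> supp a b rho al -> supp a b rho be ->
    (forall x, al < x < be -> ~ supp a b rho x) ->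
    forall f : R -> R[i], Dtau a b rho sgp sgm chp chm f ->
      cre f @ al^'- --> 0 -> cim f @ al^'- --> 0 ->
      cre f @ be^'+ --> 0 -> cim f @ be^'+ --> 0 ->
      forall x, al < x < be -> f x = 0.

(* L^2((a,b); rho) and linear relations in it.  An element of L^2 is
   represented by any of its representatives; relations are predicates
   on pairs of representatives.                                          *)
Definition L2 (R : realType) (a b : \bar R) (rho : {measure set R -> \bar R})
  (f : R -> R[i]) : Prop := sqint rho (Itv a b) f.

Definition inner (R : realType) (a b : \bar R) (rho : {measure set R -> \bar R})
  (f g : R -> R[i]) : R[i] :=
  cInt rho (Itv a b) (fun x => f x * cconj (g x)).

Definition Tmax (R : realType) (a b : \bar R)
  (rho sgp sgm chp chm : {measure set R -> \bar R}) (f g : R -> R[i]) : Prop :=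
  [/\ L2 a b rho f, L2 a b rho g &
      exists2 f', ae_eqc rho (Itv a b) f f' & is_tau a b rho sgp sgm chp chm f' g].

Definition adjoint (R : realType) (a b : \bar R) (rho : {measure set R -> \bar R})
  (S : (R -> R[i]) -> (R -> R[i]) -> Prop) (f g : R -> R[i]) : Prop :=
  [/\ L2 a b rho f, L2 a b rho g &
      forall h k, S h k -> inner a b rho g h = inner a b rho f k].

Definition self_adjoint_restriction (R : realType) (a b : \bar R)
  (rho sgp sgm chp chm : {measure set R -> \bar R})
  (S : (R -> R[i]) -> (R -> R[i]) -> Prop) : Prop :=
  (forall f g, S f g -> Tmax a b rho sgp sgm chp chm f g) /\
  (forall f g, S f g <-> adjoint a b rho S f g).

Definition resolvent_set (R : realType) (a b : \bar R)
  (rho : {measure set R -> \bar R})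
  (S : (R -> R[i]) -> (R -> R[i]) -> Prop) (z : R[i]) : Prop :=
  (forall f, L2 a b rho f ->
     exists h g, S h g /\ ae_eqc rho (Itv a b) (fun x => g x - z * h x) f) /\
  (forall h1 g1 h2 g2, S h1 g1 -> S h2 g2 ->
     ae_eqc rho (Itv a b) (fun x => g1 x - z * h1 x) (fun x => g2 x - z * h2 x) ->
     ae_eqc rho (Itv a b) h1 h2).

Definition sqint2 (R : realType) (a b : \bar R)
  (rho : {sigma_finite_measure set R -> \bar R}) (G : R -> R -> R[i]) : Prop :=
  sqint (rho \x rho)%E (Itv a b `*` Itv a b) (fun p => G p.1 p.2).

Definition lin_indep2 (R : realType) (a b : \bar R) (u1 u2 : R -> R[i]) : Prop :=
  forall c1 c2 : R[i], (forall x, Itv a b x -> c1 * u1 x + c2 * u2 x = 0) ->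
    c1 = 0 /\ c2 = 0.

(* Main.v *)
(* With p the quasi-derivative, (tau - z) u = r is the first-order system
   du = p dsigma, dp = u dchi - (z u + r) drho.  Picard iteration solves it to the right
   of any point, and by (H4) the Wronskian u1 p2 - u2 p1 is constant; this gives
   uniqueness, continuation to the left, and a two-dimensional solution space with a
   basis u1, u2 of Wronskian 1.  In the limit-circle case u1 and u2 are in L^2, so that
     K r (x) = u1(x) int_{y < x} u2 r drho - u2(x) int_{y < x} u1 r drho
   is an L^2 solution of (tau - z) f = r, and R_z r - K r is a combination of u1 and u2.
   If r is orthogonal to the conjugates of u1 and u2, antisymmetry of the kernel of K and
   Fubini show that (K r, r + z K r) is in S^* = S, hence R_z r = K r.  So the
   coefficients of R_z r - K r vanish on a subspace of codimension at most two, i.e. they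
   are linear combinations of the two integrals of u_j r drho. *)
Require Import Defs.
From HB Require Import structures.
From mathcomp Require Import all_boot all_order all_algebra.
From mathcomp Require Import all_classical all_reals all_analysis.
From mathcomp Require Import measurable_realfun complex ring lra.
Set Implicit Arguments.
Unset Strict Implicit.
Unset Printing Implicit Defensive.
Import Order.TTheory GRing.Theory Num.Theory.
Import numFieldNormedType.Exports.
Local Open Scope classical_set_scope.
Local Open Scope ring_scope.

(** * Fubini and integration by parts *)

(** The measures may have atoms, and this shapes the whole proof. Integrals run over half-open
    intervals [x, y), so primitives are left-continuous and the product rule d(FG) = G dF + F_+ dG
    contains a right limit F_+. When a solution is continued to the right, the jump at an atom is
    explicit, because densities are evaluated at left values; continuing to the left requires
    inverting that jump. Hence iteration only goes right, and the Wronskian is what opens the way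
    left: its constancy says that the transfer map between two points has determinant 1. (H4) enters
    through the right limits u_+ produced by the product rule: they differ from u only at atoms of
    sigma, and these are null for chi and rho. The signed measures are kept as their Jordan parts,
    so that a primitive carries one density for each of five positive measures, and complex
    functions are handled through real and imaginary parts. In the last step S = S^* is used twice
    over: to place (K r, r + z K r) in S, and to make S linear and insensitive to the choice of
    representatives. *)

Section fubini_section.
Context {R : realType}.
Implicit Types (D : set R) (f g : R -> R) (E : set (R * R)).

Lemma Rintegral_section_restrict (nu : {measure set R -> \bar R}) D E g (t : R) :
  \int[nu]_(s in D `&` [set s | E (t, s)]) g s =
  \int[nu]_s ((g \_ D) s * \1_E (t, s)).
Proof.
rewrite Rintegral_mkcond; apply: eq_Rintegral => s _.
rewrite /patch indicE in_setI; case: (s \in D) => //=; last by rewrite mul0r.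
have -> : (s \in [set s0 | E (t, s0)]) = ((t, s) \in E).
  by apply/idP/idP => /set_mem h; exact/mem_set.
by case: (_ \in E); rewrite ?mulr1 ?mulr0.
Qed.

Lemma integrable_section (nu : {measure set R -> \bar R}) D E g (t : R) :
  measurable D -> measurable E -> nu.-integrable D (EFin \o g) ->
  nu.-integrable setT (fun s => ((g \_ D) s * \1_E (t, s))%:E).
Proof.
move=> mD mE /(integrable_mkcond _ mD) ig.
apply: (@le_integrable _ _ _ nu setT measurableT _ _ _ _ ig) => [|s _].
  apply/measurable_EFinP; apply: measurable_funM.
    have := measurable_int nu ig; rewrite restrict_EFin.
    by move/measurable_EFinP.
  apply: (@measurableT_comp _ _ _ _ _ _ (\1_E : R * R -> R) _ (pair t)).
    exact: measurable_indic.
  exact: pair1_measurable.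
rewrite restrict_EFin /= lee_fin normrM indicE.
by case: (_ \in _); rewrite ?normr1 ?mulr1// normr0 mulr0.
Qed.

(** Tonelli: cutting with the indicator of [E] only lowers the modulus, so the iterated integral is
    at most the product of the two L^1 norms. *)
Lemma integrable_prod_section (mu nu : {sigma_finite_measure set R -> \bar R})
    D E f g : measurable D -> measurable E ->
  mu.-integrable D (EFin \o f) -> nu.-integrable D (EFin \o g) ->
  (mu \x nu)%E.-integrable setT
    (fun p => ((f \_ D) p.1 * ((g \_ D) p.2 * \1_E p))%:E).
Proof.
move=> mD mE /(integrable_mkcond _ mD) + /(integrable_mkcond _ mD).
rewrite !restrict_EFin => jf jg.
have mf : measurable_fun setT (f \_ D) by apply/measurable_EFinP; exact: (measurable_int mu).
have mg : measurable_fun setT (g \_ D) by apply/measurable_EFinP; exact: (measurable_int nu).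
have mh : measurable_fun setT (fun p : R * R => (f \_ D) p.1 * ((g \_ D) p.2 * \1_E p)).
  apply: measurable_funM; first exact: measurableT_comp.
  by apply: measurable_funM => //; exact: measurableT_comp.
apply/integrable12ltyP; first exact/measurable_EFinP.
apply: (@le_lt_trans _ _
  (\int[mu]_x (`|(f \_ D) x|%:E * \int[nu]_y `|(g \_ D) y|%:E))%E); last first.
  have [c c0 ->] : exists2 c : R, 0 <= c & (\int[nu]_y `|(g \_ D) y|%:E)%E = c%:E.
    have := integrable_lty measurableT (integrable_norm jg).
    have h0 : (0 <= \int[nu]_y `|(g \_ D) y|%:E)%E by apply: integral_ge0 => y _; rewrite lee_fin.
    by rewrite -ge0_fin_numE// => /fineK <-; exists (fine (\int[nu]_y `|(g \_ D) y|%:E)); rewrite ?fine_ge0.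
  under eq_integral do rewrite muleC.
  rewrite integralZl//; last exact: integrable_norm.
  rewrite lte_mul_pinfty ?lee_fin//.
  exact: integrable_lty (integrable_norm jf).
apply: ge0_le_integral => //=.
- by move=> x _; apply: integral_ge0 => y _; rewrite lee_fin.
- have := @measurable_fun_fubini_tonelli_F _ _ _ _ _ nu
    (fun p => `|((f \_ D) p.1 * ((g \_ D) p.2 * \1_E p))%:E|)%E.
  by apply => //; apply/measurable_EFinP; exact: measurableT_comp.
- apply: emeasurable_funM => //.
  by apply/measurable_EFinP; apply: measurableT_comp.
- move=> x _; rewrite -ge0_integralZl//.
  + apply: ge0_le_integral => //=.
    * apply/measurable_EFinP; apply: measurableT_comp => //.
      exact: (@measurableT_comp _ _ _ _ _ _ (fun p : R * R => (f \_ D) p.1 * ((g \_ D) p.2 * \1_E p)) _ (pair x)).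
    * apply/measurable_EFinP; apply: measurable_funM => //.
      exact: measurableT_comp.
    * move=> y _; rewrite lee_fin !normrM ler_wpM2l// indicE.
      by case: (_ \in _); rewrite ?normr1 ?mulr1// normr0 mulr0.
  + by apply/measurable_EFinP; exact: measurableT_comp.
Qed.

Lemma measurable_fun_Rintegral_section (nu : {sigma_finite_measure set R -> \bar R})
    D E g : measurable D -> measurable E -> nu.-integrable D (EFin \o g) ->
  measurable_fun setT (fun t => \int[nu]_(s in D `&` [set s | E (t, s)]) g s).
Proof.
move=> mD mE ig.
under eq_fun do rewrite Rintegral_section_restrict.
(* A Dirac mass with the constant 1 serves as a dummy first factor: the section integral becomes the
   inner integral of an integrable function on a product, and the measurability of that inner
   integral in t does not depend on the first measure. *)
have i1 : (\d_(0 : R) : {measure set R -> \bar R}).-integrable setT (EFin \o cst (1 : R)).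
  exact: finite_measure_integrable_cst.
pose E' := (setT `*` D) `&` E.
have mE' : measurable E' by apply: measurableI => //; exact: measurableX.
have ig' : nu.-integrable setT (EFin \o (g \_ D)).
  by move: ig => /(integrable_mkcond _ mD); rewrite restrict_EFin.
have := measurable_fubini_F (integrable_prod_section (mu := \d_(0 : R)) measurableT mE i1 ig').
move=> /(measurableT_comp (@fine_measurable R _ measurableT)).
congr (measurable_fun _ _); apply/funext => t /=.
rewrite /fubini_F /Rintegral; congr fine; apply: eq_integral => s _ /=.
by rewrite !patch_setT/= mul1r.
Qed.

Lemma Fubini_section (mu nu : {sigma_finite_measure set R -> \bar R})
    D E f g : measurable D -> measurable E ->
  mu.-integrable D (EFin \o f) -> nu.-integrable D (EFin \o g) ->
  \int[mu]_(t in D) (f t * \int[nu]_(s in D `&` [set s | E (t, s)]) g s) =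
  \int[nu]_(s in D) (g s * \int[mu]_(t in D `&` [set t | E (t, s)]) f t).
Proof.
move=> mD mE jf jg.
have mE' : measurable ([set p : R * R | E (p.2, p.1)]).
  by rewrite -[X in measurable X]setTI; exact: (@measurable_swap _ _ R R measurableT).
have := Fubini (integrable_prod_section mD mE jf jg).
move/(congr1 fine) => H; transitivity (fine (\int[mu]_x (\int[nu]_y ((f \_ D) x * ((g \_ D) y * \1_E (x, y)))%:E))%E).
  rewrite Rintegral_mkcond /Rintegral; congr fine; apply: eq_integral => t _.
  rewrite patchE; case: ifPn => [tD|/negPf tD]; last first.
    by under eq_integral do rewrite [X in X * _]patchE tD mul0r; rewrite integral0.
  under [RHS]eq_integral do rewrite EFinM.
  rewrite integralZl//; last exact: integrable_section.
  rewrite patchE tD EFinM; congr (_ * _)%E.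
  rewrite -[fine _]/(\int[nu]_(s in D `&` [set s | E (t, s)]) g s).
  rewrite Rintegral_section_restrict /Rintegral fineK//.
  by apply: integrable_fin_num => //; exact: integrable_section.
rewrite {}H.
rewrite [RHS]Rintegral_mkcond /Rintegral; congr fine; apply: eq_integral => s _.
have -> : (fun t => EFin ((f \_ D) t * ((g \_ D) s * \1_E (t, s)))) =
   (fun t => ((g \_ D) s)%:E * ((f \_ D) t * \1_([set p : R * R | E (p.2, p.1)]) (s, t))%:E)%E.
  apply/funext => t; rewrite -EFinM; congr EFin; rewrite mulrCA; congr (_ * (_ * _)).
rewrite [in RHS]patchE; case: ifPn => [sD|/negPf sD]; last first.
  by under eq_integral do rewrite [X in X%:E]patchE sD mul0e; rewrite integral0.
rewrite integralZl//; last exact: integrable_section.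
rewrite [in LHS]patchE sD EFinM; congr (_ * _)%E.
transitivity (\int[mu]_(t in D `&` [set t | E (t, s)]) f t)%:E; last by [].
have /= -> := Rintegral_section_restrict mu D [set p : R * R | E (p.2, p.1)] f s.
rewrite /Rintegral fineK//.
by apply: integrable_fin_num => //; exact: integrable_section.
Qed.

Lemma measurable_lt_rel : measurable [set p : R * R | p.2 < p.1].
Proof.
rewrite -[X in measurable X]setTI.
have := @measurable_fun_ltr _ (R * R)%type R setT snd fst measurable_snd measurable_fst.
by move=> /(_ measurableT [set true] I).
Qed.

Lemma measurable_le_rel : measurable [set p : R * R | p.1 <= p.2].
Proof.
rewrite -[X in measurable X]setTI.
have := @measurable_fun_ler _ (R * R)%type R setT fst snd measurable_fst measurable_snd.
by move=> /(_ measurableT [set true] I).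
Qed.

Lemma measurable_lt_set (t : R) : measurable [set s : R | s < t].
Proof. by rewrite -set_itvNyo; exact: measurable_itv. Qed.

Lemma measurable_le_set (t : R) : measurable [set s : R | s <= t].
Proof. by rewrite -set_itvNyc; exact: measurable_itv. Qed.

Lemma measurable_gt_set (t : R) : measurable [set s : R | t < s].
Proof. by rewrite -set_itvoy; exact: measurable_itv. Qed.

Lemma integrableM_bounded (mu : {measure set R -> \bar R}) D f g (B : R) :
  measurable D -> mu.-integrable D (EFin \o f) -> measurable_fun D g ->
  (forall t, D t -> `|g t| <= B) -> mu.-integrable D (EFin \o (f \* g)).
Proof.
move=> mD jf mg gB.
have jB : mu.-integrable D (fun t => (B%:E * (EFin \o f) t)%E) by exact: integrableZl.
apply: (le_integrable mD _ _ jB).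
  apply/measurable_EFinP; apply: measurable_funM => //.
  by apply/measurable_EFinP; exact: measurable_int jf.
move=> t Dt /=; rewrite lee_fin !normrM mulrC ler_wpM2r//.
by rewrite (le_trans (gB t Dt))// ler_norm.
Qed.

(* The two terms integrate f(t) g(s) over the halves s < t and t <= s of D x D. *)
Lemma Rintegral_by_parts (mu nu : {sigma_finite_measure set R -> \bar R})
    D f g : measurable D ->
  mu.-integrable D (EFin \o f) -> nu.-integrable D (EFin \o g) ->
  \int[mu]_(t in D) (f t * \int[nu]_(s in D `&` [set s | s < t]) g s) +
  \int[nu]_(s in D) (g s * \int[mu]_(t in D `&` [set t | t <= s]) f t) =
  \int[mu]_(t in D) f t * \int[nu]_(s in D) g s.
Proof.
move=> mD jf jg.
rewrite (Fubini_section (E := [set p | p.2 < p.1]) mD measurable_lt_rel jf jg).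
have bnd (E : set (R * R)) s : measurable E -> measurable [set t | E (t, s)] ->
   `|\int[mu]_(t in D `&` [set t | E (t, s)]) f t| <= \int[mu]_(t in D) `|f t|.
  move=> mE mEs.
  have jf' := integrableS mD (measurableI _ _ mD mEs) (@subIsetl _ _ _) jf.
  rewrite (le_trans (le_normr_Rintegral _ jf'))//; first exact: measurableI.
  rewrite /Rintegral fine_le//.
  - apply: integrable_fin_num; first exact: measurableI.
    exact: integrable_norm jf'.
  - by apply: integrable_fin_num => //; exact: integrable_norm jf.
  apply: ge0_subset_integral => //; first exact: measurableI.
  by apply: (measurable_int mu); exact: integrable_norm jf.
have mg1 (E : set (R * R)) : measurable E ->
    measurable_fun D (fun s => \int[mu]_(t in D `&` [set t | E (t, s)]) f t).
  move=> mE.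
  have mE' : measurable [set p : R * R | E (p.2, p.1)].
    by rewrite -[X in measurable X]setTI; exact: (@measurable_swap _ _ R R measurableT).
  exact: measurable_funTS (measurable_fun_Rintegral_section mD mE' jf).
have j1 := integrableM_bounded mD jg (mg1 _ measurable_lt_rel)
  (fun s _ => bnd _ s measurable_lt_rel (measurable_gt_set s)).
have j2 := integrableM_bounded mD jg (mg1 _ measurable_le_rel)
  (fun s _ => bnd _ s measurable_le_rel (measurable_le_set s)).
rewrite -RintegralD//.
rewrite mulrC -RintegralZr//; apply: eq_Rintegral => s /set_mem Ds.
rewrite -mulrDr; congr (_ * _); rewrite -Rintegral_setU.
- congr (Rintegral _ _ _); rewrite -setIUr; apply/seteqP; split => [t []//|t Dt].
  by split => //=; case: (ltP s t) => ?; [left|right].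
- by apply: measurableI => //; exact: measurable_gt_set.
- by apply: measurableI => //; exact: measurable_le_set.
- apply: (integrableS mD _ _ jf); last by rewrite -setIUr; exact: subIsetl.
  by apply: measurableU; apply: measurableI => //; [exact: measurable_gt_set|exact: measurable_le_set].
- by apply/disj_set2P; apply/seteqP; split => // t [[_ /= st] [_ /=]]; rewrite leNgt st.
Qed.

End fubini_section.

(** * Primitives with respect to several measures *)

Section primitive_section.
Context {R : realType}.
Implicit Types (D : set R) (mu : {measure set R -> \bar R}) (f g : R -> R).

Lemma Rintegral_sum (mu : {measure set R -> \bar R}) D (J : Type) (s : seq J)
    (h : J -> R -> R) : measurable D ->
  (forall j, mu.-integrable D (EFin \o h j)) ->
  \int[mu]_(t in D) (\sum_(j <- s) h j t) = \sum_(j <- s) \int[mu]_(t in D) h j t.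
Proof.
move=> mD jh; elim: s => [|j s IH].
  rewrite big_nil; under eq_Rintegral do rewrite big_nil.
  by rewrite Rintegral_cst// mul0r.
rewrite big_cons -IH; under eq_Rintegral do rewrite big_cons.
rewrite RintegralD//.
have := @integrable_sum _ _ _ mu _ mD _ s xpredT (fun j => EFin \o h j) (fun j _ => jh j).
apply: eq_integrable => // t _ /=; by rewrite sumEFin.
Qed.

Lemma integrable_mfrestr mu D f (mD : measurable D) (Doo : (mu D < +oo)%E) :
  mu.-integrable D (EFin \o f) -> (mfrestr mD Doo).-integrable D (EFin \o f).
Proof.
move=> /integrableP[mf fo]; apply/integrableP; split => //.
rewrite (eq_measure_integral mu)// => A mA AD /=.
by rewrite /mfrestr /mrestr setIidl.
Qed.

Lemma Rintegral_mfrestr mu D A f (mD : measurable D) (Doo : (mu D < +oo)%E) :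
  A `<=` D -> \int[mfrestr mD Doo]_(t in A) f t = \int[mu]_(t in A) f t.
Proof.
move=> AD; congr fine; apply: eq_measure_integral => B mB BA /=.
by rewrite /mfrestr /mrestr setIidl//; exact: subset_trans AD.
Qed.

(** The measures of the problem are only finite on compact intervals. Restricting both to [D] makes
    them finite, hence sigma-finite as Fubini requires, and changes none of the integrals. *)
Lemma Rintegral_by_parts_fin (mu nu : {measure set R -> \bar R}) D f g :
  measurable D -> (mu D < +oo)%E -> (nu D < +oo)%E ->
  mu.-integrable D (EFin \o f) -> nu.-integrable D (EFin \o g) ->
  \int[mu]_(t in D) (f t * \int[nu]_(s in D `&` [set s | s < t]) g s) +
  \int[nu]_(s in D) (g s * \int[mu]_(t in D `&` [set t | t <= s]) f t) =
  \int[mu]_(t in D) f t * \int[nu]_(s in D) g s.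
Proof.
move=> mD muD nuD jf jg.
have := Rintegral_by_parts (mu := mfrestr mD muD) (nu := mfrestr mD nuD) mD
  (integrable_mfrestr mD muD jf) (integrable_mfrestr mD nuD jg).
rewrite !Rintegral_mfrestr// => <-; congr (_ + _).
- by apply: eq_Rintegral => t _; rewrite Rintegral_mfrestr//; exact: subIsetl.
- by apply: eq_Rintegral => t _; rewrite Rintegral_mfrestr//; exact: subIsetl.
Qed.

Lemma measurable_Rintegral_section_fin mu D (E : set (R * R)) g :
  measurable D -> measurable E -> (mu D < +oo)%E -> mu.-integrable D (EFin \o g) ->
  measurable_fun setT (fun t => \int[mu]_(s in D `&` [set s | E (t, s)]) g s).
Proof.
move=> mD mE muD jg.
have := measurable_fun_Rintegral_section (nu := mfrestr mD muD) mD mE (integrable_mfrestr mD muD jg).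
congr measurable_fun; apply/funext => t; rewrite Rintegral_mfrestr//; exact: subIsetl.
Qed.

Lemma Rintegral_subset_bound mu D A f : measurable D -> measurable A -> A `<=` D ->
  mu.-integrable D (EFin \o f) ->
  `|\int[mu]_(t in A) f t| <= \int[mu]_(t in D) `|f t|.
Proof.
move=> mD mA AD jf; have jfA := integrableS mD mA AD jf.
rewrite (le_trans (le_normr_Rintegral _ jfA))// /Rintegral fine_le//.
- by apply: integrable_fin_num => //; exact: integrable_norm jfA.
- by apply: integrable_fin_num => //; exact: integrable_norm jf.
by apply: ge0_subset_integral => //; apply: (measurable_int mu); exact: integrable_norm jf.
Qed.

Lemma Rintegral_singleton mu f (t : R) :
  \int[mu]_(s in [set t]) f s = f t * fine (mu [set t]).
Proof.
rewrite -Rintegral_cst//; apply: eq_Rintegral => s /set_mem ->//.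
Qed.

Lemma measurable_cc (x y : R) : measurable [set t : R | x <= t <= y].
Proof. by rewrite -set_itvcc; exact: measurable_itv. Qed.

Lemma measurable_co (x y : R) : measurable [set t : R | x <= t < y].
Proof. by rewrite -set_itvco; exact: measurable_itv. Qed.

Lemma subset_co_cc (x y : R) : [set t : R | x <= t < y] `<=` [set t | x <= t <= y].
Proof. by move=> t /= /andP[-> /ltW]. Qed.

Definition loc_int (I : set R) mu f := forall x y, I x -> I y ->
  mu.-integrable [set t | x <= t <= y] (EFin \o f).

Definition loc_fin (I : set R) mu := forall x y, I x -> I y ->
  (mu [set t | (x <= t <= y)%R] < +oo)%E.

(* F has the density f j with respect to each of the N measures nu j.  Such an F is
   left-continuous, and F t + jump N nu f t is its right limit at t. *)
Definition prim (I : set R) N (nu : nat -> {measure set R -> \bar R})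
    (F : R -> R) (f : nat -> R -> R) :=
  (forall j, loc_int I (nu j) (f j)) /\
  forall x y, I x -> I y -> x <= y ->
    F y - F x = \sum_(j < N) \int[nu j]_(t in [set t | x <= t < y]) f j t.

Definition jump N (nu : nat -> {measure set R -> \bar R}) (f : nat -> R -> R) (t : R) :=
  \sum_(j < N) f j t * fine (nu j [set t]).

Section prim_theory.
Context (I : set R) (N : nat) (nu : nat -> {measure set R -> \bar R}).
Hypothesis I_itv : forall x y t, I x -> I y -> x <= t <= y -> I t.
Hypothesis nu_fin : forall j, loc_fin I (nu j).
Notation prim := (prim I N nu).

Lemma loc_int_co mu f x y : loc_int I mu f -> I x -> I y ->
  mu.-integrable [set t | x <= t < y] (EFin \o f).
Proof.
move=> jf Ix Iy; apply: integrableS (jf x y Ix Iy).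
- exact: measurable_cc.
- exact: measurable_co.
- exact: subset_co_cc.
Qed.

Lemma prim_at F (f : nat -> R -> R) x t : prim F f -> I x -> I t -> x <= t ->
  F t = F x + \sum_(j < N) \int[nu j]_(s in [set s | x <= s < t]) f j s.
Proof. by move=> [_ HF] Ix It xt; rewrite -HF// addrC subrK. Qed.

(** Closing the interval at t adds exactly the atom at t for each measure. In this form the
    integrals over s <= t in integration by parts are recognized as a right limit. *)
Lemma prim_right F (f : nat -> R -> R) x y t : prim F f -> I x -> I y -> x <= t <= y ->
  F t + jump N nu f t =
  F x + \sum_(j < N) \int[nu j]_(s in [set s | x <= s <= y] `&` [set s | s <= t]) f j s.
Proof.
move=> HF Ix Iy /andP[xt ty].
have It : I t by apply: (I_itv Ix Iy); rewrite xt.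
rewrite (prim_at HF Ix It xt) -addrA /jump -big_split/=; congr (_ + _).
apply: eq_bigr => j _; rewrite -Rintegral_singleton.
rewrite (_ : _ `&` _ = [set s | x <= s < t] `|` [set t]); last first.
  apply/seteqP; split => [s /= [/andP[xs _]]|s /= [/andP[xs st]|->]].
  - by rewrite le_eqVlt => /predU1P[->|st]; [right|left; rewrite xs].
  - by rewrite xs (ltW st) (le_trans (ltW st) ty).
  - by rewrite xt ty lexx.
rewrite Rintegral_setU//; first exact: measurable_co.
- have : (nu j).-integrable [set s | x <= s <= t] (EFin \o f j) by exact: HF.1.
  apply: integrableS; [exact: measurable_cc| |].
    by apply: measurableU => //; exact: measurable_co.
  by move=> s /= [/andP[-> /ltW]//|->]; rewrite xt lexx.
- by apply/disj_set2P; apply/seteqP; split => // s [/= /andP[_ st] se]; rewrite se ltxx in st.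
Qed.

Lemma prim_left_itv F (f : nat -> R -> R) x y t : prim F f -> I x -> I y -> x <= t <= y ->
  F t = F x + \sum_(j < N) \int[nu j]_(s in [set s | x <= s <= y] `&` [set s | s < t]) f j s.
Proof.
move=> HF Ix Iy /andP[xt ty].
have It : I t by apply: (I_itv Ix Iy); rewrite xt.
rewrite (prim_at HF Ix It xt); congr (_ + _).
apply: eq_bigr => j _; congr (Rintegral _ _ _); apply/seteqP; split => s /=.
  by move=> /andP[-> st]; rewrite st ltW// (lt_le_trans st).
by move=> [/andP[-> _]].
Qed.

Lemma prim_measurable F (f : nat -> R -> R) x y : prim F f -> I x -> I y ->
  measurable_fun [set t | x <= t <= y] F.
Proof.
move=> HF Ix Iy.
apply: (@eq_measurable_fun _ _ _ _ _ (fun t : R => F x + \sum_(j < N)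
  \int[nu j]_(s in [set s | x <= s <= y] `&` [set s | s < t]) f j s)).
  by move=> t /set_mem/= xty; rewrite -(prim_left_itv HF).
apply: measurable_funD => //; apply: measurable_sum => j.
apply: measurable_funTS.
have jf := HF.1 j _ _ Ix Iy.
exact: (measurable_Rintegral_section_fin (measurable_cc x y) measurable_lt_rel (nu_fin _ Ix Iy) jf).
Qed.

Lemma prim_right_measurable F (f : nat -> R -> R) x y : prim F f -> I x -> I y ->
  measurable_fun [set t | x <= t <= y] (fun t => F t + jump N nu f t).
Proof.
move=> HF Ix Iy.
apply: (@eq_measurable_fun _ _ _ _ _ (fun t : R => F x + \sum_(j < N)
  \int[nu j]_(s in [set s | x <= s <= y] `&` [set s | s <= t]) f j s)).
  by move=> t /set_mem/= xty; rewrite -(prim_right HF).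
apply: measurable_funD => //; apply: measurable_sum => j.
apply: measurable_funTS.
have jf := HF.1 j _ _ Ix Iy.
have mE : measurable [set p : R * R | p.2 <= p.1].
  rewrite -[X in measurable X]setTI.
  exact: (@measurable_swap _ _ R R measurableT _ measurable_le_rel).
exact: (measurable_Rintegral_section_fin (measurable_cc x y) mE (nu_fin _ Ix Iy) jf).
Qed.

Lemma prim_right_bounded F (f : nat -> R -> R) x y t : prim F f -> I x -> I y -> x <= t <= y ->
  `|F t + jump N nu f t| <=
  `|F x| + \sum_(j < N) \int[nu j]_(s in [set s | x <= s <= y]) `|f j s|.
Proof.
move=> HF Ix Iy xty; rewrite (prim_right HF Ix Iy xty).
rewrite (le_trans (ler_normD _ _))// lerD2l (le_trans (ler_norm_sum _ _ _))//.
apply: ler_sum => j _; apply: Rintegral_subset_bound; [exact: measurable_cc| | |exact: HF.1].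
- by apply: measurableI; [exact: measurable_cc|exact: measurable_le_set].
- exact: subIsetl.
Qed.

Lemma prim_bounded F (f : nat -> R -> R) x y t : prim F f -> I x -> I y -> x <= t <= y ->
  `|F t| <=
  `|F x| + \sum_(j < N) \int[nu j]_(s in [set s | x <= s <= y]) `|f j s|.
Proof.
move=> HF Ix Iy xty; rewrite (prim_left_itv HF Ix Iy xty).
rewrite (le_trans (ler_normD _ _))// lerD2l (le_trans (ler_norm_sum _ _ _))//.
apply: ler_sum => j _; apply: Rintegral_subset_bound; [exact: measurable_cc| | |exact: HF.1].
- by apply: measurableI; [exact: measurable_cc|exact: measurable_lt_set].
- exact: subIsetl.
Qed.

Lemma prim_loc_intM F (f : nat -> R -> R) mu g : prim F f -> loc_int I mu g -> loc_int I mu (g \* F).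
Proof.
move=> HF jg x y Ix Iy; apply: integrableM_bounded.
- exact: measurable_cc.
- exact: jg.
- exact: (prim_measurable HF).
- by move=> t xty; exact: (prim_bounded HF Ix Iy xty).
Qed.

Lemma prim_right_loc_intM F (f : nat -> R -> R) mu g : prim F f -> loc_int I mu g ->
  loc_int I mu (g \* (fun t => F t + jump N nu f t)).
Proof.
move=> HF jg x y Ix Iy; apply: integrableM_bounded.
- exact: measurable_cc.
- exact: jg.
- exact: (prim_right_measurable HF).
- by move=> t xty; exact: (prim_right_bounded HF Ix Iy xty).
Qed.

End prim_theory.
End primitive_section.

(** * Algebra of primitives: linear combinations and the product rule *)

Section prim_algebra.
Context {R : realType}.
Implicit Types (D : set R) (mu : {measure set R -> \bar R}).

Lemma integrableD_EFin mu D (f g : R -> R) : measurable D ->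
  mu.-integrable D (EFin \o f) -> mu.-integrable D (EFin \o g) ->
  mu.-integrable D (EFin \o (fun t => f t + g t)).
Proof. by move=> mD jf jg; exact: (integrableD mD jf jg). Qed.

Lemma integrableZ_EFin mu D (f : R -> R) (c : R) : measurable D ->
  mu.-integrable D (EFin \o f) -> mu.-integrable D (EFin \o (fun t => c * f t)).
Proof. by move=> mD jf; exact: (integrableZl mD c jf). Qed.

Lemma Rintegral_affine mu D N (f : R -> R) (c : R) (h : 'I_N -> R -> R) :
  measurable D -> mu.-integrable D (EFin \o f) ->
  (forall k, measurable_fun D (h k)) ->
  (forall k, exists B : R, forall t, D t -> `|h k t| <= B) ->
  \int[mu]_(t in D) (f t * (c + \sum_(k < N) h k t)) =
  (\int[mu]_(t in D) f t) * c + \sum_(k < N) \int[mu]_(t in D) (f t * h k t).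
Proof.
move=> mD jf mh bh.
have jh k : mu.-integrable D (EFin \o (fun t => f t * h k t)).
  by have [B hB] := bh k; exact: (integrableM_bounded mD jf (mh k) hB).
under eq_Rintegral do rewrite mulrDr mulr_sumr.
rewrite RintegralD ?RintegralZr ?Rintegral_sum//.
- rewrite (_ : EFin \o _ = (fun t => (EFin \o f) t * c%:E)%E)//; exact: integrableZr.
- have := @integrable_sum _ _ _ mu _ mD _ (index_enum 'I_N) xpredT (fun k => EFin \o (fun t => f t * h k t)) (fun k _ => jh k).
  by apply: eq_integrable => // t _ /=; rewrite sumEFin.
Qed.

Context (I : set R) (N : nat) (nu : nat -> {measure set R -> \bar R}).
Hypothesis I_itv : forall x y t, I x -> I y -> x <= t <= y -> I t.
Hypothesis nu_fin : forall j, loc_fin I (nu j).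
Notation prim := (prim I N nu).

Lemma prim_ext F F' (f f' : nat -> R -> R) : prim F f ->
  (forall t, I t -> F' t = F t) -> (forall j t, I t -> f' j t = f j t) ->
  prim F' f'.
Proof.
move=> [jf HF] eF ef; split.
  move=> j x y Ix Iy; have := jf j x y Ix Iy.
  apply: eq_integrable; first exact: measurable_cc.
  by move=> t /set_mem/= xty /=; rewrite ef//; exact: I_itv xty.
move=> x y Ix Iy xy; rewrite !eF// HF//; apply: eq_bigr => j _.
apply: eq_Rintegral => t /set_mem/= /andP[xt ty]; rewrite ef//.
by apply: (I_itv Ix Iy); rewrite xt ltW.
Qed.

Lemma prim_lin F G (f g : nat -> R -> R) (c d : R) : prim F f -> prim G g ->
  prim (fun t => c * F t + d * G t) (fun j t => c * f j t + d * g j t).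
Proof.
move=> HF HG.
split.
  move=> j x y Ix Iy.
  have mD := measurable_cc x y.
  by apply: integrableD_EFin => //; apply: integrableZ_EFin => //; [exact: HF.1|exact: HG.1].
move=> x y Ix Iy xy.
transitivity (c * (F y - F x) + d * (G y - G x)); first by rewrite !mulrBr opprD addrACA.
rewrite HF.2// HG.2// !mulr_sumr -big_split/=; apply: eq_bigr => j _.
have mD := measurable_co x y.
have jf := loc_int_co (HF.1 j) Ix Iy; have jg := loc_int_co (HG.1 j) Ix Iy.
by rewrite RintegralD ?RintegralZl//; exact: integrableZ_EFin.
Qed.

Lemma prim_cst (c : R) : prim (fun=> c) (fun _ _ => 0).
Proof.
split => [j x y Ix Iy|x y Ix Iy xy].
  rewrite (_ : EFin \o _ = cst 0%E)//; apply: integrable0; exact: measurable_cc.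
rewrite subrr big1// => j _; rewrite Rintegral_cst ?mul0r//; exact: measurable_co.
Qed.

(** Product rule d(FG) = G dF + F_+ dG. The asymmetry is forced by common atoms: the diagonal of the
    square [x, y) x [x, y) must be counted once, here by the right limit of F. Expanding all
    increments over pairs of measures reduces it to one integration by parts per pair. *)
Lemma prim_mul F G (f g : nat -> R -> R) : prim F f -> prim G g ->
  prim (F \* G) (fun j t => f j t * G t + g j t * (F t + jump N nu f t)).
Proof.
move=> HF HG.
have jfG j := prim_loc_intM I_itv nu_fin HG (HF.1 j).
have jgF j := prim_right_loc_intM I_itv nu_fin HF (HG.1 j).
split.
  move=> j x y Ix Iy.
  by apply: integrableD_EFin; [exact: measurable_cc|exact: jfG|exact: jgF].
move=> x y Ix Iy xy; set D := [set t | x <= t < y].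
have mD : measurable D := measurable_co x y.
have Doo j : (nu j D < +oo)%E.
  apply: le_lt_trans (nu_fin j Ix Iy); apply: le_measure; rewrite ?inE//.
  - exact: measurable_cc.
  - exact: subset_co_cc.
have jf j : (nu j).-integrable D (EFin \o f j) := loc_int_co (HF.1 j) Ix Iy.
have jg j : (nu j).-integrable D (EFin \o g j) := loc_int_co (HG.1 j) Ix Iy.
(* Increments from x to t: [Ga] leaves t out and builds up G t, [Ph] includes t and builds up the
   right limit of F at t. *)
pose Ga k t := \int[nu k]_(s in D `&` [set s | s < t]) g k s.
pose Ph k t := \int[nu k]_(s in D `&` [set s | s <= t]) f k s.
have GE t : D t -> G t = G x + \sum_(k < N) Ga k t.
  move=> /andP[xt ty]; rewrite (@prim_left_itv _ I N nu I_itv _ _ x y t HG)//; last by rewrite xt ltW.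
  congr (_ + _); apply: eq_bigr => k _; congr (Rintegral _ _ _).
  rewrite /D; apply/seteqP; split => s /= [/andP[-> sy] st]; rewrite st; split => //=.
    exact: lt_trans ty.
  exact: ltW.
have FE t : D t -> F t + jump N nu f t = F x + \sum_(k < N) Ph k t.
  move=> /andP[xt ty]; rewrite (@prim_right _ I N nu I_itv _ _ x y t HF)//; last by rewrite xt ltW.
  congr (_ + _); apply: eq_bigr => k _; congr (Rintegral _ _ _).
  rewrite /D; apply/seteqP; split => s /= [/andP[-> sy] st]; rewrite st; split => //=.
    exact: le_lt_trans ty.
  exact: ltW.
have mGa k : measurable_fun D (Ga k).
  exact: measurable_funTS (measurable_Rintegral_section_fin mD measurable_lt_rel (Doo k) (jg k)).
have mE : measurable [set p : R * R | p.2 <= p.1].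
  rewrite -[X in measurable X]setTI.
  exact: (@measurable_swap _ _ R R measurableT _ measurable_le_rel).
have mPh k : measurable_fun D (Ph k).
  exact: measurable_funTS (measurable_Rintegral_section_fin mD mE (Doo k) (jf k)).
have bGa k : exists B : R, forall t, D t -> `|Ga k t| <= B.
  exists (\int[nu k]_(s in D) `|g k s|) => t _; apply: Rintegral_subset_bound => //.
  by apply: measurableI => //; exact: measurable_lt_set.
have bPh k : exists B : R, forall t, D t -> `|Ph k t| <= B.
  exists (\int[nu k]_(s in D) `|f k s|) => t _; apply: Rintegral_subset_bound => //.
  by apply: measurableI => //; exact: measurable_le_set.
transitivity (\sum_(j < N) (((\int[nu j]_(t in D) f j t) * G x + \sum_(k < N) \int[nu j]_(t in D) (f j t * Ga k t)) +
   ((\int[nu j]_(t in D) g j t) * F x + \sum_(k < N) \int[nu j]_(t in D) (g j t * Ph k t)))); last first.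
  apply: eq_bigr => j _.
  rewrite RintegralD//; [|exact: (loc_int_co (jfG j))|exact: (loc_int_co (jgF j))].
  congr (_ + _).
    rewrite -(@Rintegral_affine (nu j) D N (f j) (G x) (fun k => Ga k))//.
    by apply: eq_Rintegral => t /set_mem Dt; rewrite -GE.
  rewrite -(@Rintegral_affine (nu j) D N (g j) (F x) (fun k => Ph k))//.
  by apply: eq_Rintegral => t /set_mem Dt; rewrite -FE.
rewrite !big_split/= -!mulr_suml -HF.2// -HG.2//.
(* Swapping the indices in one double sum pairs the integral of f_j Ga_k against nu_j with that of
   g_k Ph_j against nu_k; integration by parts turns this pair into the (j, k) term of (F y - F x)
   (G y - G x). *)
rewrite [X in _ + (_ + X)]exchange_big/= addrACA -big_split/=.
rewrite (_ : \sum_(j < N) _ = (F y - F x) * (G y - G x)); first ring.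
rewrite HF.2// HG.2// big_distrlr/=; apply: eq_bigr => j _.
by rewrite -big_split/=; apply: eq_bigr => k _; exact: Rintegral_by_parts_fin.
Qed.

End prim_algebra.

(** * Atoms and powers of primitives *)

Section atoms_section.
Context {R : realType}.
Implicit Types (D : set R) (mu nu : {measure set R -> \bar R}).

Lemma seq_set_cons (T : eqType) (x : T) (s : seq T) :
  [set t | t \in x :: s] = [set x] `|` [set t | t \in s].
Proof.
apply/seteqP; split => t /=; rewrite in_cons.
  by move=> /predU1P[->|ts]; [left|right].
by move=> [->|->]; rewrite ?eqxx ?orbT.
Qed.

Lemma measurable_seq (s : seq R) : measurable [set t | t \in s].
Proof.
elim: s => [|x s IH]; first by rewrite (_ : mkset _ = set0)//; apply/seteqP; split.
by rewrite seq_set_cons; exact: measurableU.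
Qed.

Lemma measure_seq_atoms mu (e : R) (s : seq R) : uniq s ->
  (forall t, t \in s -> (e%:E <= mu [set t])%E) ->
  (((size s)%:R * e)%:E <= mu [set t | t \in s])%E.
Proof.
elim: s => [_ _|x s IH /= /andP[xs us] es]; first by rewrite mul0r.
rewrite seq_set_cons.
rewrite measureU//; [|exact: measurable_seq|]; last first.
  by apply/seteqP; split => // t [/= -> xs']; rewrite xs' in xs.
rewrite -natr1 mulrDl mul1r addrC EFinD; apply: leeD.
  by apply: es; rewrite mem_head.
by apply: IH => // t ts; apply: es; rewrite in_cons ts orbT.
Qed.

(** At most mu(D)/e points of [D] can carry mass [e] or more. *)
Lemma finite_big_atoms mu D (e : R) : measurable D -> (mu D < +oo)%E -> 0 < e ->
  finite_set [set t | D t /\ (e%:E <= mu [set t])%E].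
Proof.
move=> mD muD e0; apply: contrapT => infA.
have [n hn] : exists n : nat, fine (mu D) < n%:R * e.
  exists (Num.truncn (fine (mu D) / e)).+1.
  by rewrite -ltr_pdivrMr// truncnS_gt.
have [B BA Bn] := infinite_set_fset n infA.
have := @measure_seq_atoms mu e (finmap.enum_fset B) (finmap.fset_uniq B) (fun t tB => (BA t tB).2).
rewrite leNgt => /negP; apply.
apply: (@le_lt_trans _ _ (mu D)).
  apply: le_measure; rewrite ?inE//; first exact: measurable_seq.
  by move=> t tB; exact: (BA t tB).1.
rewrite -[ltLHS]fineK ?ge0_fin_numE// lte_fin (lt_le_trans hn)//.
by rewrite ler_wpM2r ?ler_nat// ltW.
Qed.

(* The atoms of mu in D are countably many, and each of them is nu-null. *)
Lemma no_common_atoms mu nu D : measurable D -> (mu D < +oo)%E ->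
  (forall t, D t -> mu [set t] = 0%E \/ nu [set t] = 0%E) ->
  nu.-negligible (D `&` [set t | mu [set t] <> 0%E]).
Proof.
move=> mD muD H.
apply: (@negligibleS _ _ _ nu (\bigcup_n [set t | (D t /\ (n.+1%:R^-1%:E <= mu [set t])%E) /\ nu [set t] = 0%E])).
  move=> t [Dt /= mut].
  have mut0 : (0 < mu [set t])%E by rewrite lt0e measure_ge0 andbT; apply/eqP.
  have fint : mu [set t] \is a fin_num.
    rewrite ge0_fin_numE//; apply: le_lt_trans muD; apply: le_measure; rewrite ?inE//.
    by move=> _ ->.
  exists (Num.truncn (fine (mu [set t]))^-1) => //=; split; last by case: (H t Dt).
  split=> //; rewrite -[leRHS]fineK// lee_fin.
  have f0 : 0 < fine (mu [set t]) by rewrite fine_gt0// mut0 -ge0_fin_numE.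
  by rewrite -[leRHS]invrK lef_pV2 ?posrE ?invr_gt0 ?ltr0n// ltW// truncnS_gt.
apply: negligible_bigcup => n.
(* For each n the atoms of mass at least 1/(n+1) form a finite set; those among them that are
   [nu]-null are removed one at a time along an enumeration. *)
have /finite_seqP[s sE] := finite_big_atoms (e := n.+1%:R^-1) mD muD ltac:(by rewrite invr_gt0 ltr0n).
rewrite (_ : [set t | _ /\ _] = [set t | t \in s /\ nu [set t] = 0%E]); last first.
  by apply/seteqP; split => t /= [h1 h2]; split => //; [rewrite -[is_true _]/([set` s] t) -sE|
    rewrite -[is_true _]/([set` s] t) -sE in h1].
elim: s {sE} => [|x s IH].
  by rewrite (_ : [set t | _ /\ _] = set0); [exact: negligible_set0|apply/seteqP; split => // t []].
case: (pselect (nu [set x] = 0%E)) => [x0|x0]; last first.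
  apply: negligibleS IH => t /= [/[swap] t0]; rewrite in_cons => /predU1P[e|->]//.
  by rewrite e in t0.
have hx : nu.-negligible [set x] by apply/negligibleP.
apply: negligibleS (negligibleU hx IH) => t /= [].
by rewrite in_cons => /predU1P[->|ts] t0; [left|right].
Qed.

End atoms_section.

(** * Changing densities almost everywhere, and powers of the mass function *)

Section prim_more.
Context {R : realType}.
Context (I : set R) (N : nat) (nu : nat -> {measure set R -> \bar R}).
Hypothesis I_itv : forall x y t, I x -> I y -> x <= t <= y -> I t.
Hypothesis nu_fin : forall j, loc_fin I (nu j).
Notation prim := (prim I N nu).

Lemma prim_ae F (f f' : nat -> R -> R) : prim F f ->
  (forall j, loc_int I (nu j) (f' j)) ->
  (forall j x y, (j < N)%N -> I x -> I y ->
     (nu j).-negligible ([set t | x <= t <= y] `&` [set t | f j t <> f' j t])) ->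
  prim F f'.
Proof.
move=> HF jf' ff'; split=> // x y Ix Iy xy; rewrite HF.2//; apply: eq_bigr => j _.
congr fine; apply: ae_eq_integral; first exact: measurable_co.
- exact: measurable_int (loc_int_co (HF.1 j) Ix Iy).
- exact: measurable_int (loc_int_co (jf' j) Ix Iy).
apply: negligibleS (ff' j x y (ltn_ord j) Ix Iy).
move=> t /= /not_implyP[/andP[xt ty] ne]; split; first by rewrite /= xt ltW.
by move=> e; apply: ne; rewrite e.
Qed.

Lemma loc_int_cst j (c : R) : loc_int I (nu j) (fun=> c).
Proof.
move=> x y Ix Iy; apply: measurable_bounded_integrable.
- exact: measurable_cc.
- exact: nu_fin.
- exact: measurable_cst.
- by exists `|c|; split; [exact: num_real|move=> M cM t _ /=; exact: ltW].
Qed.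

Lemma prim_loc_int F (f : nat -> R -> R) j : prim F f -> loc_int I (nu j) F.
Proof.
move=> HF x y Ix Iy.
have := prim_loc_intM I_itv nu_fin HF (@loc_int_cst j 1) Ix Iy.
by apply: eq_integrable; [exact: measurable_cc|move=> t _ /=; rewrite mul1r].
Qed.

Lemma prim_of_loc_int (al : R) (f : nat -> R -> R) : I al ->
  (forall t, I t -> al <= t) -> (forall j, loc_int I (nu j) (f j)) ->
  prim (fun t => \sum_(j < N) \int[nu j]_(s in [set s | al <= s < t]) f j s) f.
Proof.
move=> Ial al_min jf; split=> // x y Ix Iy xy.
rewrite -sumrB; apply: eq_bigr => j _; apply/eqP; rewrite subr_eq addrC; apply/eqP.
rewrite -Rintegral_setU.
- congr (Rintegral _ _ _); apply/seteqP; split => t /=.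
    by move=> /andP[at_ ty]; rewrite at_ ty /=; case: (ltP t x) => ?; [left|right].
  by move=> [/andP[-> tx]|/andP[xt ->]]; rewrite ?(lt_le_trans tx xy)// (le_trans (al_min _ Ix) xt).
- exact: measurable_co.
- exact: measurable_co.
- apply: integrableS (jf j _ _ Ial Iy); first exact: measurable_cc.
    by apply: measurableU; exact: measurable_co.
  move=> t /= [/andP[-> tx]|/andP[xt ty]]; first by rewrite (ltW (lt_le_trans tx xy)).
  by rewrite (le_trans (al_min _ Ix) xt) ltW.
- by apply/disj_set2P; apply/seteqP; split => // t [/= /andP[_ tx] /andP[]]; rewrite leNgt tx.
Qed.

Lemma Rintegral_dominated_cvg (mu : {measure set R -> \bar R}) D (f_ : nat -> R -> R) (f : R -> R) (B : R) :
  measurable D -> (mu D < +oo)%E ->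
  (forall n, measurable_fun D (f_ n)) ->
  (forall t, D t -> f_ ^~ t @ \oo --> f t) ->
  (forall n t, D t -> `|f_ n t| <= B) ->
  mu.-integrable D (EFin \o f) /\
  (fun n => \int[mu]_(t in D) f_ n t) @ \oo --> \int[mu]_(t in D) f t.
Proof.
move=> mD muD mf ff fB.
have mfl : measurable_fun D f := measurable_fun_cvg mf ff.
have jB : mu.-integrable D (EFin \o cst B).
  apply: measurable_bounded_integrable => //.
  by exists `|B|; split; [exact: num_real|move=> M cM t _ /=; exact: ltW].
have [||||| jf _ H] := @dominated_convergence _ _ R mu D mD (fun n => EFin \o f_ n) (EFin \o f) (EFin \o cst B).
- by move=> n; apply/measurable_EFinP; exact: mf.
- by apply/measurable_EFinP.
- by apply: aeW => t Dt; apply/fine_cvgP; split; [exact: nearW|exact: ff].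
- exact: jB.
- by apply: aeW => t n Dt /=; rewrite lee_fin; exact: fB.
split=> //; apply: (@fine_cvg _ _ _ _ _ (\int[mu]_(t in D) f t)).
rewrite /Rintegral fineK//; exact: integrable_fin_num.
Qed.

(* The density of M^k dominates k M^(k-1) because the right limit of M is >= M; this
   yields the factorial in the convergence of the Picard iteration. *)
Lemma pow_prim (M : R -> R) (k : nat) : prim M (fun _ _ => 1) ->
  (forall t, I t -> 0 <= M t) ->
  exists2 d : nat -> R -> R, prim (fun t => M t ^+ k) d &
    forall j t, I t -> k%:R * M t ^+ k.-1 <= d j t.
Proof.
move=> HM M0; elim: k => [|k [d Hd kd]].
  exists (fun _ _ => 0); last by move=> j t _; rewrite mul0r.
  exact: (prim_cst I N nu 1).
exists (fun j t => 1 * M t ^+ k + d j t * (M t + jump N nu (fun _ _ => 1) t)).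
  by apply: (prim_ext I_itv (prim_mul I_itv nu_fin HM Hd)) => // t _; rewrite exprS.
move=> j t It; rewrite mul1r -natr1 mulrDl mul1r addrC lerD2l.
have d0 : 0 <= d j t by apply: le_trans (kd j t It); rewrite mulr_ge0// exprn_ge0// M0.
apply: (@le_trans _ _ (d j t * M t)).
  case: k kd {Hd d0} => [|k] kd; first by rewrite mul0r; have := kd j t It; rewrite mul0r => d0; rewrite mulr_ge0// M0.
  by rewrite exprSr mulrA ler_wpM2r// ?M0// kd.
rewrite ler_wpM2l// lerDl; apply: sumr_ge0 => i _; rewrite mul1r fine_ge0//.
Qed.

(** Integrating the density bound of [pow_prim] for the exponent k+1. Without atoms the integral of
    M^k dM over [al, x) would be (M(x)^(k+1) - M(al)^(k+1))/(k+1); atoms only make it smaller. *)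
Lemma pow_bound (M : R -> R) (al : R) (k : nat) (x : R) : prim M (fun _ _ => 1) ->
  (forall t, I t -> 0 <= M t) -> I al -> I x -> al <= x ->
  \sum_(j < N) \int[nu j]_(t in [set t | al <= t < x]) (M t ^+ k) <= M x ^+ k.+1 / k.+1%:R.
Proof.
move=> HM M0 Ial Ix alx; rewrite ler_pdivlMr ?ltr0n// mulrC.
have [d Hd kd] := pow_prim k.+1 HM M0; have [e He _] := pow_prim k HM M0.
apply: (@le_trans _ _ (M x ^+ k.+1 - M al ^+ k.+1)); last by rewrite gerBl exprn_ge0// M0.
rewrite Hd.2// mulr_sumr; apply: ler_sum => j _.
have jk := loc_int_co (prim_loc_int j He) Ial Ix.
rewrite -RintegralZl//; last exact: measurable_co.
apply: le_Rintegral; [exact: measurable_co| |exact: (loc_int_co (Hd.1 j))|].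
  by apply: integrableZ_EFin => //; exact: measurable_co.
move=> t /= /andP[alt tx]; apply: (kd j t); apply: (I_itv Ial Ix).
by rewrite alt ltW.
Qed.

End prim_more.

(** * Picard iteration *)

Section picard_section.
Context {R : realType}.
Context (I : set R) (N : nat) (nu : nat -> {measure set R -> \bar R}).
Hypothesis I_itv : forall x y t, I x -> I y -> x <= t <= y -> I t.
Hypothesis nu_fin : forall j, loc_fin I (nu j).
Context (al : R) (Ial : I al) (al_min : forall t, I t -> al <= t).
Context (K : finType) (A : nat -> K -> K -> R) (y0 : K -> R).
Notation prim := (prim I N nu).

Let rhs (v : K -> R -> R) (i : K) : nat -> R -> R :=
  fun j t => \sum_(i' : K) A j i i' * v i' t.

Let vol (v : K -> R -> R) (i : K) (x : R) : R :=
  \sum_(j < N) \int[nu j]_(t in [set t | al <= t < x]) rhs v i j t.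

(** These are the terms of the Neumann series, not the successive approximations: [y0] enters at k =
    0 only, and the solution is the sum over k. *)
Fixpoint picard_iter (k : nat) : K -> R -> R :=
  if k is k'.+1 then vol (picard_iter k') else fun i _ => y0 i.

Let Y := picard_iter.
(** [B] dominates every row sum of every coefficient matrix, [C0] every initial value, and [M x] is
    the total mass of [al, x), which is a primitive with all densities equal to 1. *)
Let B : R := \sum_(j < N) \sum_(i : K) \sum_(i' : K) `|A j i i'|.
Let C0 : R := \sum_(i : K) `|y0 i|.
Let M (x : R) : R := \sum_(j < N) \int[nu j]_(t in [set t | al <= t < x]) 1.

Let B_row (j : 'I_N) i : \sum_(i' : K) `|A j i i'| <= B.
Proof.
rewrite /B [leRHS](bigD1 j)//= [X in X + _](bigD1 i)//= -addrA lerDl addr_ge0//.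
  by apply: sumr_ge0 => *; exact: sumr_ge0.
by apply: sumr_ge0 => *; apply: sumr_ge0 => *; exact: sumr_ge0.
Qed.

Let B_ge0 : 0 <= B.
Proof. by rewrite !sumr_ge0// => *; rewrite sumr_ge0// => *; rewrite sumr_ge0. Qed.

Let M_prim : prim M (fun _ _ => 1).
Proof. by apply: prim_of_loc_int => // j; exact: loc_int_cst. Qed.

Let M_ge0 t : 0 <= M t.
Proof. by apply: sumr_ge0 => j _; exact: Rintegral_ge0. Qed.

Let M_mono x y : I x -> I y -> x <= y -> M x <= M y.
Proof.
move=> Ix Iy xy; rewrite -subr_ge0 M_prim.2//; apply: sumr_ge0 => j _.
exact: Rintegral_ge0.
Qed.

Let loc_int_rhs v i j : (forall i', loc_int I (nu j) (v i')) ->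
  loc_int I (nu j) (rhs v i j).
Proof.
move=> jv x y Ix Iy; have mD := measurable_cc x y.
have := @integrable_sum _ _ _ (nu j) _ mD _ (index_enum K) xpredT
  (fun i' => EFin \o (fun t => A j i i' * v i' t)) (fun i' _ => integrableZ_EFin _ mD (jv i' x y Ix Iy)).
by apply: eq_integrable => // t _ /=; rewrite sumEFin.
Qed.

Let prim_vol v i : (forall j i', loc_int I (nu j) (v i')) -> prim (vol v i) (rhs v i).
Proof. by move=> jv; apply: prim_of_loc_int => // j; exact: loc_int_rhs. Qed.

Let Y_prim k i : exists f, prim (Y k i) f.
Proof.
elim: k i => [|k IH] i; first by exists (fun _ _ => 0); exact: prim_cst.
exists (rhs (Y k) i); apply: prim_vol => j i'.
by have [f Hf] := IH i'; exact: (prim_loc_int I_itv nu_fin j Hf).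
Qed.

Let rhs_bound v i (j : 'I_N) t (c : R) : (forall i', `|v i' t| <= c) ->
  `|rhs v i j t| <= B * c.
Proof.
move=> vc; rewrite (le_trans (ler_norm_sum _ _ _))//.
apply: (@le_trans _ _ (\sum_i' `|A j i i'| * c)).
  by apply: ler_sum => i' _; rewrite normrM ler_wpM2l.
by rewrite -mulr_suml ler_wpM2r//; exact: le_trans (vc i).
Qed.

(** Induction on k: one more integration contributes a factor [B], and [pow_bound] turns M^k/k! into
    M^(k+1)/(k+1)!. The constant [c] below collects all factors except the power of M and its
    divisor k+1. *)
Let Y_bound k i x : I x -> `|Y k i x| <= C0 * exp_coeff (B * M x) k.
Proof.
elim: k i x => [|k IH] i x Ix.
  rewrite /exp_coeff /= expr0 fact0 divr1 mulr1 /C0 (bigD1 i)//= lerDl.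
  exact: sumr_ge0.
have alx := al_min Ix.
have Dsub t : al <= t < x -> I t by move=> /andP[alt tx]; apply: (I_itv Ial Ix); rewrite alt ltW.
have mD := measurable_co al x.
have jY (j : nat) i' : loc_int I (nu j) (Y k i').
  by have [f Hf] := Y_prim k i'; exact: (prim_loc_int I_itv nu_fin j Hf).
have C0_ge0 : 0 <= C0 by exact: sumr_ge0.
pose c := B * (C0 * (B ^+ k / k`!%:R)).
have c_ge0 : 0 <= c by rewrite !mulr_ge0// ?exprn_ge0// invr_ge0.
rewrite /Y /= /vol (le_trans (ler_norm_sum _ _ _))//.
apply: (@le_trans _ _ (c * (M x ^+ k.+1 / k.+1%:R))); last first.
  rewrite le_eqVlt; apply/orP; left; apply/eqP.
  rewrite /exp_coeff /= /c exprMn factS natrM invfM !exprS.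
  ring.
apply: (@le_trans _ _ (c * \sum_(j < N) \int[nu j]_(t in [set t | al <= t < x]) (M t ^+ k))); last first.
  by rewrite ler_wpM2l//; apply: (pow_bound I_itv nu_fin k M_prim).
rewrite mulr_sumr; apply: ler_sum => j _.
have jr := loc_int_co (loc_int_rhs i (jY j)) Ial Ix.
have [d Hd _] := pow_prim I_itv nu_fin k M_prim (fun t _ => M_ge0 t).
have jM := loc_int_co (prim_loc_int I_itv nu_fin j Hd) Ial Ix.
rewrite (le_trans (le_normr_Rintegral mD jr))// -RintegralZl//.
apply: le_Rintegral => //; [exact: integrable_norm jr|exact: integrableZ_EFin|].
move=> t Dt; rewrite (le_trans (@rhs_bound _ i j t (C0 * exp_coeff (B * M t) k) _))//.
  by move=> i'; apply: IH; exact: Dsub.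
by rewrite /exp_coeff /c /= exprMn le_eqVlt; apply/orP; left; apply/eqP; ring.
Qed.

Let S n i x := series (fun k => Y k i x) n.

Let S_bound n i x : I x -> `|S n i x| <= C0 * expR (B * M x).
Proof.
move=> Ix; rewrite /S /series /= (le_trans (ler_norm_sum _ _ _))//.
apply: (@le_trans _ _ (\sum_(0 <= k < n) C0 * exp_coeff (B * M x) k)).
  by apply: ler_sum => k _; exact: Y_bound.
rewrite -mulr_sumr ler_wpM2l ?sumr_ge0//.
apply: (@nondecreasing_cvgn_le _ (series (exp_coeff (B * M x)))).
  by apply: nondecreasing_series => k _ _; rewrite exp_coeff_ge0// mulr_ge0.
exact: is_cvg_series_exp_coeff.
Qed.

Let S_cvg i x : I x -> cvgn (fun n => S n i x).
Proof.
move=> Ix; apply: (@normed_cvg _ R (fun k => Y k i x)).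
apply: (@series_le_cvg _ _ (C0 *: exp_coeff (B * M x))) => //.
- by move=> n; exact: normr_ge0.
- move=> n; change (0 <= C0 * exp_coeff (B * M x) n).
  by rewrite mulr_ge0 ?sumr_ge0 ?exp_coeff_ge0 ?mulr_ge0.
- by move=> n; exact: Y_bound.
- by apply: is_cvg_seriesZ; exact: is_cvg_series_exp_coeff.
Qed.

Let S_prim n i : exists f, prim (S n i) f.
Proof.
elim: n => [|n [f Hf]].
  exists (fun _ _ => 0); rewrite /S /series /=.
  by apply: (prim_ext I_itv (prim_cst I N nu 0)) => // t _; rewrite big_geq.
have [g Hg] := Y_prim n i.
exists (fun j t => 1 * f j t + 1 * g j t).
apply: (prim_ext I_itv (prim_lin 1 1 Hf Hg)) => // t _.
by rewrite /S /series /= big_nat_recr//= !mul1r.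
Qed.

(** The integral equation with a shift of one between its two sides; the shift disappears in the
    limit. *)
Let S_rec n i x : I x -> S n.+1 i x = y0 i + vol (S n) i x.
Proof.
move=> Ix; elim: n => [|n IH].
  rewrite /S /series /= big_nat1 /Y /= /vol big1 ?addr0// => j _.
  rewrite (_ : Rintegral _ _ _ = \int[nu j]_(t in [set t | al <= t < x]) 0).
    by rewrite Rintegral_cst ?mul0r//; exact: measurable_co.
  by apply: eq_Rintegral => t _; rewrite /rhs big1// => i' _; rewrite big_geq// mulr0.
have SS m i' t : S m.+1 i' t = S m i' t + Y m i' t by rewrite /S /series /= big_nat_recr.
rewrite SS IH -addrA; congr (_ + _); rewrite /Y /= /vol -big_split/=.
apply: eq_bigr => j _; have mD := measurable_co al x.
rewrite -RintegralD//.
- apply: eq_Rintegral => t _; rewrite /rhs -big_split; apply: eq_bigr => i' _.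
  by rewrite SS mulrDr.
- apply: (loc_int_co _ Ial Ix); apply: loc_int_rhs => i'.
  by have [f Hf] := S_prim n i'; exact: (prim_loc_int I_itv nu_fin j Hf).
- apply: (loc_int_co _ Ial Ix); apply: loc_int_rhs => i'.
  by have [f Hf] := Y_prim n i'; exact: (prim_loc_int I_itv nu_fin j Hf).
Qed.

Let y (i : K) (x : R) : R := limn (fun n => S n i x).

Let rhs_cvg i j x : I x -> (fun n => rhs (S n) i j x) @ \oo --> rhs y i j x.
Proof.
move=> Ix; apply: cvg_big => [|i' _]; first exact: add_continuous.
by apply: cvgMl_tmp; exact: S_cvg.
Qed.

(** Dominated convergence with a constant bound: M is monotone, so the exponential bound at the
    right end [b] holds throughout, and the measure of [al, b] is finite. *)
Let rhs_lim D (j : 'I_N) i b : I b -> measurable D -> D `<=` [set t | al <= t <= b] ->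
  (nu j).-integrable D (EFin \o rhs y i j) /\
  (fun n => \int[nu j]_(t in D) rhs (S n) i j t) @ \oo --> \int[nu j]_(t in D) rhs y i j t.
Proof.
move=> Ib mD Db.
have DI t : D t -> I t by move=> /Db; exact: I_itv.
apply: (@Rintegral_dominated_cvg _ (nu j) D (fun n => rhs (S n) i j) (rhs y i j) (B * (C0 * expR (B * M b)))) => //.
- apply: le_lt_trans (nu_fin j Ial Ib); apply: le_measure; rewrite ?inE//.
  exact: measurable_cc.
- move=> n; have := loc_int_rhs i (v := S n) (j := j) _ Ial Ib.
  have jS i' : loc_int I (nu j) (S n i').
    by have [f Hf] := S_prim n i'; exact: (prim_loc_int I_itv nu_fin j Hf).
  move=> /(_ jS) /(measurable_int _)/measurable_EFinP.
  by apply: measurable_funS => //; exact: measurable_cc.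
- by move=> t Dt; apply: rhs_cvg; exact: DI.
- move=> n t Dt; apply: rhs_bound => i'.
  rewrite (le_trans (S_bound _ _ (DI t Dt)))// ler_wpM2l ?sumr_ge0//.
  rewrite ler_expR ler_wpM2l// M_mono//; first exact: DI.
  by have /= /andP[] := Db t Dt.
Qed.

Lemma picard_real : exists y : K -> R -> R, (forall i, y i al = y0 i) /\
  forall i, prim (y i) (fun j t => \sum_(i' : K) A j i i' * y i' t).
Proof.
(* [prim] asks for local integrability at every index j, while [B] controls only the matrices with j
   < N; beyond N the density is therefore set to 0. *)
pose f i j t := if (j < N)%N then rhs y i j t else 0.
have jf i j : loc_int I (nu j) (f i j).
  have [jN|/negbTE jN] := boolP (j < N)%N; rewrite /f /= jN; last exact: loc_int_cst.
  move=> a b Ia Ib.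
  apply: (rhs_lim (Ordinal jN) i Ib (measurable_cc a b) _).1.
  by move=> t /= /andP[at_ ->]; rewrite (le_trans (al_min Ia)).
have yE i x : I x -> y i x = y0 i + \sum_(j < N) \int[nu j]_(t in [set t | al <= t < x]) f i j t.
  move=> Ix; transitivity (limn (fun n => S n.+1 i x)).
    apply/esym/cvg_lim => //.
    by rewrite (@cvg_shiftS _ (fun n => S n i x)); exact: S_cvg.
  apply/cvg_lim => //; under eq_fun do rewrite S_rec//.
    apply: cvgD; first exact: cvg_cst.
    apply: cvg_big => [|j _]; first exact: add_continuous.
    have [_] := rhs_lim j i Ix (measurable_co al x) (@subset_co_cc _ _ _).
    rewrite (_ : \int[nu j]_(t in _) rhs y i j t = \int[nu j]_(t in [set t | al <= t < x]) f i j t)//.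
    by apply: eq_Rintegral => t _; rewrite /f ltn_ord.
have H i : prim (y i) (f i).
  have := prim_lin 1 1 (prim_cst I N nu (y0 i)) (prim_of_loc_int N Ial al_min (jf i)).
  by move/(prim_ext I_itv); apply => [t It|j t It]; rewrite ?mul1r ?add0r// yE.
exists y; split => i.
  rewrite yE// big1 ?addr0// => j _.
  rewrite (_ : [set t | _] = set0) ?Rintegral_set0//.
  by apply/seteqP; split => // t /= /andP[a1 /lt_le_trans/(_ a1)]; rewrite ltxx.
split=> [j|a b Ia Ib ab].
  by apply: loc_int_rhs => i'; exact: (prim_loc_int I_itv nu_fin j (H i')).
rewrite (H i).2//; apply: eq_bigr => j _; apply: eq_Rintegral => t _.
by rewrite /f ltn_ord.
Qed.

End picard_section.

(** * The first-order system *)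

Section complex_primitives.
Context {R : realType}.
Implicit Types (F G : R -> R[i]) (f g : nat -> R -> R[i]).

Lemma cReM (x y : R[i]) :
  complex.Re (x * y) = complex.Re x * complex.Re y - complex.Im x * complex.Im y.
Proof. by case: x y => [? ?] [? ?]. Qed.

Lemma cImM (x y : R[i]) :
  complex.Im (x * y) = complex.Re x * complex.Im y + complex.Im x * complex.Re y.
Proof. by case: x y => [? ?] [? ?]. Qed.

Lemma cReD (x y : R[i]) : complex.Re (x + y) = complex.Re x + complex.Re y.
Proof. by case: x y => [? ?] [? ?]. Qed.

Lemma cImD (x y : R[i]) : complex.Im (x + y) = complex.Im x + complex.Im y.
Proof. by case: x y => [? ?] [? ?]. Qed.

Lemma cReN (x : R[i]) : complex.Re (- x) = - complex.Re x.
Proof. by case: x. Qed.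

Lemma cImN (x : R[i]) : complex.Im (- x) = - complex.Im x.
Proof. by case: x. Qed.

Lemma Re_sum (J : Type) (s : seq J) (h : J -> R[i]) :
  complex.Re (\sum_(j <- s) h j) = \sum_(j <- s) complex.Re (h j).
Proof. by elim: s => [|j s IH]; rewrite ?big_nil// !big_cons cReD IH. Qed.

Lemma Im_sum (J : Type) (s : seq J) (h : J -> R[i]) :
  complex.Im (\sum_(j <- s) h j) = \sum_(j <- s) complex.Im (h j).
Proof. by elim: s => [|j s IH]; rewrite ?big_nil// !big_cons cImD IH. Qed.

Lemma complex_eqP (x y : R[i]) :
  complex.Re x = complex.Re y -> complex.Im x = complex.Im y -> x = y.
Proof. by case: x y => [? ?] [? ?] /= -> ->. Qed.

Definition cprim (I : set R) N (nu : nat -> {measure set R -> \bar R}) F f :=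
  prim I N nu (cre F) (fun j => cre (f j)) /\ prim I N nu (cim F) (fun j => cim (f j)).

Definition cjump N (nu : nat -> {measure set R -> \bar R}) f (t : R) : R[i] :=
  \sum_(j < N) f j t * (fine (nu j [set t]))%:C%C.

Lemma cre_cjump N nu f t :
  complex.Re (cjump N nu f t) = jump N nu (fun j => cre (f j)) t.
Proof.
rewrite /cjump Re_sum; apply: eq_bigr => j _; by rewrite cReM /= mulr0 subr0.
Qed.

Lemma cim_cjump N nu f t :
  complex.Im (cjump N nu f t) = jump N nu (fun j => cim (f j)) t.
Proof.
rewrite /cjump Im_sum; apply: eq_bigr => j _; by rewrite cImM /= mulr0 add0r.
Qed.

Context (I : set R) (N : nat) (nu : nat -> {measure set R -> \bar R}).
Hypothesis I_itv : forall x y t, I x -> I y -> x <= t <= y -> I t.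
Hypothesis nu_fin : forall j, loc_fin I (nu j).
Notation cprimI := (cprim I N nu).

Lemma cprim_ext F F' f f' : cprimI F f ->
  (forall t, I t -> F' t = F t) -> (forall j t, I t -> f' j t = f j t) ->
  cprimI F' f'.
Proof.
move=> [Hr Hi] eF ef; split.
  by apply: (prim_ext I_itv Hr) => [t It|j t It]; rewrite /cre ?eF ?ef.
by apply: (prim_ext I_itv Hi) => [t It|j t It]; rewrite /cim ?eF ?ef.
Qed.

Lemma cprim_lin F G f g (c d : R[i]) : cprimI F f -> cprimI G g ->
  cprimI (fun t => c * F t + d * G t) (fun j t => c * f j t + d * g j t).
Proof.
move=> [Fr Fi] [Gr Gi]; split.
  apply: (prim_ext I_itv (prim_lin 1 1 (prim_lin (complex.Re c) (- complex.Im c) Fr Fi)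
    (prim_lin (complex.Re d) (- complex.Im d) Gr Gi))) => [t _|j t _];
    rewrite /cre /cim cReD !cReM; ring.
apply: (prim_ext I_itv (prim_lin 1 1 (prim_lin (complex.Im c) (complex.Re c) Fr Fi)
    (prim_lin (complex.Im d) (complex.Re d) Gr Gi))) => [t _|j t _];
    rewrite /cre /cim cImD !cImM; ring.
Qed.

Lemma cprim_mul F G f g : cprimI F f -> cprimI G g ->
  cprimI (fun t => F t * G t)
    (fun j t => f j t * G t + g j t * (F t + cjump N nu f t)).
Proof.
move=> [Fr Fi] [Gr Gi]; split.
  apply: (prim_ext I_itv (prim_lin 1 (-1) (prim_mul I_itv nu_fin Fr Gr)
     (prim_mul I_itv nu_fin Fi Gi))) => [t _|j t _].
    by rewrite /cre /cim cReM /=; ring.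
  by rewrite /cre /cim cReD !cReM cReD cImD cre_cjump cim_cjump /cre /cim; ring.
apply: (prim_ext I_itv (prim_lin 1 1 (prim_mul I_itv nu_fin Fr Gi)
     (prim_mul I_itv nu_fin Fi Gr))) => [t _|j t _].
  by rewrite /cre /cim cImM /=; ring.
by rewrite /cre /cim cImD !cImM cReD cImD cre_cjump cim_cjump /cre /cim; ring.
Qed.

Definition cloc_int (mu : {measure set R -> \bar R}) (h : R -> R[i]) :=
  loc_int I mu (cre h) /\ loc_int I mu (cim h).

Lemma cprim_ae F f f' : cprimI F f -> (forall j, cloc_int (nu j) (f' j)) ->
  (forall j x y, (j < N)%N -> I x -> I y ->
     (nu j).-negligible ([set t | x <= t <= y] `&` [set t | f j t <> f' j t])) ->
  cprimI F f'.
Proof.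
move=> [Hr Hi] jf' ff'; split.
  apply: (prim_ae Hr (fun j => (jf' j).1)) => j x y jN Ix Iy.
  apply: negligibleS (ff' j x y jN Ix Iy) => t /= [xty ne]; split => // e.
  by apply: ne; rewrite /cre e.
apply: (prim_ae Hi (fun j => (jf' j).2)) => j x y jN Ix Iy.
apply: negligibleS (ff' j x y jN Ix Iy) => t /= [xty ne]; split => // e.
by apply: ne; rewrite /cim e.
Qed.

Lemma cloc_int_ext mu h h' : cloc_int mu h -> (forall t, I t -> h' t = h t) ->
  cloc_int mu h'.
Proof.
move=> [jr ji] e; split => x y Ix Iy.
  apply: eq_integrable (jr x y Ix Iy); first exact: measurable_cc.
  by move=> t /set_mem xty /=; rewrite /cre e//; exact: I_itv xty.
apply: eq_integrable (ji x y Ix Iy); first exact: measurable_cc.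
by move=> t /set_mem xty /=; rewrite /cim e//; exact: I_itv xty.
Qed.

Lemma cloc_int_prim F f j : cprimI F f -> cloc_int (nu j) F.
Proof. by move=> [Hr Hi]; split; [exact: (prim_loc_int I_itv nu_fin j Hr)|exact: (prim_loc_int I_itv nu_fin j Hi)]. Qed.

Lemma cloc_int0 mu : cloc_int mu (fun=> 0).
Proof.
split => x y Ix Iy; apply: (eq_integrable (measurable_cc x y) (cst 0%E)) => //;
  by apply: integrable0; exact: measurable_cc.
Qed.

Lemma cloc_int_lin mu h k (c d : R[i]) : cloc_int mu h -> cloc_int mu k ->
  cloc_int mu (fun t => c * h t + d * k t).
Proof.
move=> [hr hi] [kr ki]; split => x y Ix Iy; have mD := measurable_cc x y.
  have := integrableD_EFin mD
    (integrableD_EFin mD (integrableZ_EFin (complex.Re c) mD (hr x y Ix Iy))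
      (integrableZ_EFin (- complex.Im c) mD (hi x y Ix Iy)))
    (integrableD_EFin mD (integrableZ_EFin (complex.Re d) mD (kr x y Ix Iy))
      (integrableZ_EFin (- complex.Im d) mD (ki x y Ix Iy))).
  apply: eq_integrable => // t _ /=; rewrite /cre /cim cReD !cReM; congr EFin; ring.
have := integrableD_EFin mD
    (integrableD_EFin mD (integrableZ_EFin (complex.Im c) mD (hr x y Ix Iy))
      (integrableZ_EFin (complex.Re c) mD (hi x y Ix Iy)))
    (integrableD_EFin mD (integrableZ_EFin (complex.Im d) mD (kr x y Ix Iy))
      (integrableZ_EFin (complex.Re d) mD (ki x y Ix Iy))).
apply: eq_integrable => // t _ /=; rewrite /cre /cim cImD !cImM; congr EFin; ring.
Qed.

Lemma cprim_cst_of_null F f : cprimI F f ->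
  (forall j x y, (j < N)%N -> I x -> I y ->
     (nu j).-negligible ([set t | x <= t <= y] `&` [set t | f j t <> 0])) ->
  forall x y, I x -> I y -> F x = F y.
Proof.
move=> HF f0; have [Hr Hi] := cprim_ae HF (fun j => cloc_int0 (nu j)) f0.
suff H x y : I x -> I y -> x <= y -> F x = F y.
  by move=> x y Ix Iy; case: (leP x y) => [|/ltW] xy; [exact: H|rewrite (H y x)].
move=> Ix Iy xy; apply: complex_eqP; apply/esym/eqP; rewrite -subr_eq0; apply/eqP.
  rewrite -!/(cre F _) Hr.2// big1// => j _; rewrite Rintegral_cst ?mul0r//; exact: measurable_co.
rewrite -!/(cim F _) Hi.2// big1// => j _; rewrite Rintegral_cst ?mul0r//; exact: measurable_co.
Qed.

End complex_primitives.

(** * The system for u and its quasi-derivative p: Wronskian and variation of constants *)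

Section sturm_liouville_system.
Context {R : realType} (rho sgp sgm chp chm : {measure set R -> \bar R}).
Implicit Types (u p k : R -> R[i]) (I : set R).

(** Signs of the Jordan parts are carried by the densities, so that all measures are positive. The
    default [rho] keeps the entries beyond 4 locally finite, since finiteness is required at every
    index. *)
Definition nu5 : nat -> {measure set R -> \bar R} :=
  fun j => nth rho [:: sgp; sgm; chp; chm; rho] j.

Definition dens5 (d0 d1 d2 d3 d4 : R -> R[i]) : nat -> R -> R[i] :=
  fun j => nth (fun=> 0) [:: d0; d1; d2; d3; d4] j.

(* du = p d(sgp - sgm) and dp = u d(chp - chm) - k drho.  Here p is minus the function F
   of is_tau, up to the primitive of f with respect to chi, and k plays the role of tau u. *)
Definition sys I u p k :=
  cprim I 5 nu5 u (dens5 p (fun t => - p t) (fun=> 0) (fun=> 0) (fun=> 0)) /\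
  cprim I 5 nu5 p (dens5 (fun=> 0) (fun=> 0) u (fun t => - u t) (fun t => - k t)).

(* The consequence of (H4) for the right limits of u: they differ from u only on a
   set which is null for chi and for rho. *)
Definition null_jumps I := forall j x y, (1 < j < 5)%N -> I x -> I y ->
  (nu5 j).-negligible ([set t | x <= t <= y] `&` [set t | spt sgp sgm t <> 0]).

Context (I : set R).
Hypothesis I_itv : forall x y t, I x -> I y -> x <= t <= y -> I t.
Hypothesis nu_fin : forall j, loc_fin I (nu5 j).
Hypothesis nj : null_jumps I.

Lemma sys_ext u u' p p' k k' : sys I u p k -> (forall t, I t -> u' t = u t) ->
  (forall t, I t -> p' t = p t) -> (forall t, I t -> k' t = k t) -> sys I u' p' k'.
Proof.
move=> [Hu Hp] eu ep ek; split.
  apply: (cprim_ext I_itv Hu) => // j t It.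
  by case: j => [|[|[|[|[|j]]]]]//=; rewrite /dens5 /= ?ep// nth_nil.
apply: (cprim_ext I_itv Hp) => // j t It.
by case: j => [|[|[|[|[|j]]]]]//=; rewrite /dens5 /= ?eu ?ek// nth_nil.
Qed.

Lemma sys_lin u1 p1 k1 u2 p2 k2 (c d : R[i]) : sys I u1 p1 k1 -> sys I u2 p2 k2 ->
  sys I (fun t => c * u1 t + d * u2 t) (fun t => c * p1 t + d * p2 t)
        (fun t => c * k1 t + d * k2 t).
Proof.
move=> [Hu1 Hp1] [Hu2 Hp2]; split.
  apply: (cprim_ext I_itv (cprim_lin I_itv c d Hu1 Hu2)) => // j t It.
  by case: j => [|[|[|[|[|j]]]]]//=; rewrite /dens5 /= ?nth_nil; ring.
apply: (cprim_ext I_itv (cprim_lin I_itv c d Hp1 Hp2)) => // j t It.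
by case: j => [|[|[|[|[|j]]]]]//=; rewrite /dens5 /= ?nth_nil; ring.
Qed.

Lemma cjump_u p t :
  cjump 5 nu5 (dens5 p (fun t => - p t) (fun=> 0) (fun=> 0) (fun=> 0)) t =
  p t * (spt sgp sgm t)%:C%C.
Proof.
rewrite /cjump !big_ord_recl big_ord0 /nu5 /dens5 /= /spt.
by apply: complex_eqP; rewrite ?cReD ?cImD ?cReM ?cImM ?cReN ?cImN /=; ring.
Qed.

Lemma cjump_p u k t :
  cjump 5 nu5 (dens5 (fun=> 0) (fun=> 0) u (fun t => - u t) (fun t => - k t)) t =
  u t * (spt chp chm t)%:C%C - k t * (fine (rho [set t]))%:C%C.
Proof.
rewrite /cjump !big_ord_recl big_ord0 /nu5 /dens5 /= /spt.
by apply: complex_eqP; rewrite ?cReD ?cImD ?cReN ?cImN ?cReM ?cImM ?cReN ?cImN /=; ring.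
Qed.

(** In the product rule the factor u is put first, so that only right limits of u occur. The sigma
    densities p1 p2 - p2 p1 cancel. What is left for chi and rho is a multiple of u1 p2 - u2 p1
    times the sigma-mass of {t}, which is null by [null_jumps]. *)
Lemma wronskian_const u1 p1 u2 p2 (z : R[i]) :
  sys I u1 p1 (fun t => z * u1 t) -> sys I u2 p2 (fun t => z * u2 t) ->
  forall x y, I x -> I y ->
    u1 x * p2 x - u2 x * p1 x = u1 y * p2 y - u2 y * p1 y.
Proof.
move=> [Hu1 Hp1] [Hu2 Hp2] x y Ix Iy.
have H := cprim_lin I_itv 1 (-1) (cprim_mul I_itv nu_fin Hu1 Hp2) (cprim_mul I_itv nu_fin Hu2 Hp1).
have := cprim_cst_of_null H.
move=> /(_ _ x y Ix Iy); rewrite !mul1r !mulN1r; apply.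
move=> j a b j5 Ia Ib.
case: (ltnP 1 j) => j1; last first.
  apply: negligibleS (negligible_set0 _) => t /= [_]; apply.
  by move: j j1 {j5} => [|[|//]] _; rewrite /dens5 /=; ring.
have := nj (j := j) _ Ia Ib; rewrite j1 j5 => /(_ isT).
apply: negligibleS => t [abt ne]; split => //= s0; apply: ne; rewrite !cjump_u s0.
by move: j j1 j5 => [|[|[|[|[|]]]]]//= _ _; rewrite /dens5 /= ?nth_nil; ring.
Qed.

(* The jumps of u1 and u2 are invisible to rho, those of p1 and p2 cancel. *)
Lemma variation_of_constants u1 p1 u2 p2 A1 A2 r (z : R[i]) :
  sys I u1 p1 (fun t => z * u1 t) -> sys I u2 p2 (fun t => z * u2 t) ->
  (forall t, I t -> u1 t * p2 t - u2 t * p1 t = 1) ->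
  cprim I 5 nu5 A1 (dens5 (fun=> 0) (fun=> 0) (fun=> 0) (fun=> 0) (fun t => u1 t * r t)) ->
  cprim I 5 nu5 A2 (dens5 (fun=> 0) (fun=> 0) (fun=> 0) (fun=> 0) (fun t => u2 t * r t)) ->
  cloc_int I rho r ->
  sys I (fun t => u1 t * A2 t - u2 t * A1 t) (fun t => p1 t * A2 t - p2 t * A1 t)
        (fun t => r t + z * (u1 t * A2 t - u2 t * A1 t)).
Proof.
move=> [Hu1 Hp1] [Hu2 Hp2] W1 HA1 HA2 jr.
have HK := cprim_lin I_itv 1 (-1) (cprim_mul I_itv nu_fin Hu1 HA2) (cprim_mul I_itv nu_fin Hu2 HA1).
have HP := cprim_lin I_itv 1 (-1) (cprim_mul I_itv nu_fin Hp1 HA2) (cprim_mul I_itv nu_fin Hp2 HA1).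
have HP' : cprim I 5 nu5 (fun t => p1 t * A2 t - p2 t * A1 t)
   (dens5 (fun=> 0) (fun=> 0) (fun t => u1 t * A2 t - u2 t * A1 t)
      (fun t => - (u1 t * A2 t - u2 t * A1 t)) (fun t => - (r t + z * (u1 t * A2 t - u2 t * A1 t)))).
  apply: (cprim_ext I_itv HP) => [t It|j t It]; first ring.
  rewrite !cjump_p; move: j => [|[|[|[|[|j]]]]]; rewrite /dens5 /= ?nth_nil; try ring.
  (* For [rho] the jump terms have already cancelled, and the coefficient of r is the Wronskian,
     which equals 1. *)
  transitivity (- (r t * (u1 t * p2 t - u2 t * p1 t) + z * (u1 t * A2 t - u2 t * A1 t))).
    by rewrite W1// mulr1.
  ring.
split=> //.
have HK' := cprim_ext I_itv HK (F' := fun t => u1 t * A2 t - u2 t * A1 t) _ (fun _ _ _ => erefl).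
apply: (cprim_ae (HK' _)) => [t It|j|j x y j5 Ix Iy]; first ring.
- move: j => [|[|j]]; [exact: (cloc_int_prim I_itv nu_fin 0 HP')| |].
    apply: (cloc_int_ext I_itv (cloc_int_lin 0 (-1) (cloc_int_prim I_itv nu_fin 1 HP') (cloc_int_prim I_itv nu_fin 1 HP'))) => t _ /=.
    by rewrite /dens5 /=; ring.
  by apply: (cloc_int_ext I_itv (cloc_int0 I _)) => t _; move: j => [|[|[|[|j]]]].
case: (ltnP 1 j) => j1; last first.
  apply: negligibleS (negligible_set0 _) => t /= [_]; apply.
  by move: j j1 {j5} => [|[|//]] _; rewrite /dens5 /=; ring.
have := nj (j := j) _ Ix Iy; rewrite j1 j5 => /(_ isT).
apply: negligibleS => t [abt ne]; split => //= s0; apply: ne; rewrite !cjump_u s0.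
by move: j j1 j5 => [|[|[|[|[|]]]]]//= _ _; rewrite /dens5 /= ?nth_nil; ring.
Qed.

End sturm_liouville_system.

(** * Existence and uniqueness for the initial value problem at an arbitrary point *)

Section initial_value_problem.
Context {R : realType} (rho sgp sgm chp chm : {measure set R -> \bar R}).
Implicit Types (u p k : R -> R[i]) (I J : set R).
Notation nu := (nu5 rho sgp sgm chp chm).
Notation sys := (sys rho sgp sgm chp chm).
Notation null_jumps := (null_jumps rho sgp sgm chp chm).

(** Both conditions in [prim] concern one compact interval at a time, so the set and the functions
    that witness them may vary with the pair of points. This is what makes gluing of solutions
    possible. *)
Lemma prim_local I N (nu : nat -> {measure set R -> \bar R}) (F : R -> R) (f : nat -> R -> R) :
  (forall x y, I x -> I y -> exists J F' f', [/\ J x, J y,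
     (forall t, Num.min x y <= t <= Num.max x y -> F t = F' t /\ forall j, f j t = f' j t)
     & prim J N nu F' f']) -> prim I N nu F f.
Proof.
move=> H; split=> [j x y Ix Iy|x y Ix Iy xy]; have [J [F' [f' [Jx Jy E [jf' HF']]]]] := H x y Ix Iy.
  apply: eq_integrable (jf' j x y Jx Jy); first exact: measurable_cc.
  move=> t /set_mem/= /andP[xt ty]; rewrite (E t _).2//.
  by rewrite ge_min xt/= le_max ty orbT.
rewrite (E x _).1 ?(E y _).1 ?ge_min ?le_max ?lexx ?orbT ?xy ?andbT// HF'//.
apply: eq_bigr => j _; apply: eq_Rintegral => t /set_mem/= /andP[xt ty].
by rewrite (E t _).2// ge_min xt le_max (ltW ty) orbT.
Qed.

Lemma sys_local I u p k :
  (forall x y, I x -> I y -> exists J u' p', [/\ J x, J y,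
     (forall t, Num.min x y <= t <= Num.max x y -> u t = u' t /\ p t = p' t)
     & sys J u' p' k]) -> sys I u p k.
Proof.
move=> H.
split; split; apply: prim_local => x y Ix Iy;
  have [J [u' [p' [Jx Jy E [[? ?] [? ?]]]]]] := H x y Ix Iy.
- exists J, (cre u'), (fun j => cre (dens5 p' (fun t => - p' t) (fun=> 0) (fun=> 0) (fun=> 0) j)).
  split=> // t xty; have [Eu Ep] := E t xty; split; first by rewrite /cre Eu.
  by move=> [|[|[|[|[|j]]]]]; rewrite /cre /dens5 /= ?Ep// nth_nil.
- exists J, (cim u'), (fun j => cim (dens5 p' (fun t => - p' t) (fun=> 0) (fun=> 0) (fun=> 0) j)).
  split=> // t xty; have [Eu Ep] := E t xty; split; first by rewrite /cim Eu.
  by move=> [|[|[|[|[|j]]]]]; rewrite /cim /dens5 /= ?Ep// nth_nil.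
- exists J, (cre p'), (fun j => cre (dens5 (fun=> 0) (fun=> 0) u' (fun t => - u' t) (fun t => - k t) j)).
  split=> // t xty; have [Eu Ep] := E t xty; split; first by rewrite /cre Ep.
  by move=> [|[|[|[|[|j]]]]]; rewrite /cre /dens5 /= ?Eu// nth_nil.
- exists J, (cim p'), (fun j => cim (dens5 (fun=> 0) (fun=> 0) u' (fun t => - u' t) (fun t => - k t) j)).
  split=> // t xty; have [Eu Ep] := E t xty; split; first by rewrite /cim Ep.
  by move=> [|[|[|[|[|j]]]]]; rewrite /cim /dens5 /= ?Eu// nth_nil.
Qed.

Lemma prim_sub I J N (nu : nat -> {measure set R -> \bar R}) F f :
  J `<=` I -> prim I N nu F f -> prim J N nu F f.
Proof.
move=> JI [jf HF]; split=> [j x y Jx Jy|x y Jx Jy xy]; first by apply: jf; exact: JI.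
by apply: HF => //; exact: JI.
Qed.

Lemma sys_sub I J u p k : J `<=` I -> sys I u p k -> sys J u p k.
Proof. by move=> JI [[? ?] [? ?]]; split; split; exact: prim_sub JI _. Qed.

(** Cramer's rule: the coefficients are the Wronskians of (u, p) with the two basis solutions, and
    these are constant. *)
Lemma sys_span I u1 p1 u2 p2 u p (z : R[i]) (c : R) :
  (forall x y t, I x -> I y -> x <= t <= y -> I t) ->
  (forall j, loc_fin I (nu j)) -> null_jumps I -> I c ->
  sys I u1 p1 (fun t => z * u1 t) -> sys I u2 p2 (fun t => z * u2 t) ->
  u1 c * p2 c - u2 c * p1 c = 1 -> sys I u p (fun t => z * u t) ->
  forall t, I t ->
    u t = (u c * p2 c - u2 c * p c) * u1 t + (u1 c * p c - u c * p1 c) * u2 t /\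
    p t = (u c * p2 c - u2 c * p c) * p1 t + (u1 c * p c - u c * p1 c) * p2 t.
Proof.
move=> I_itv nu_fin nj Ic H1 H2 W H t It.
rewrite (wronskian_const I_itv nu_fin nj H H2 Ic It).
rewrite (wronskian_const I_itv nu_fin nj H1 H Ic It).
have W' : u1 t * p2 t - u2 t * p1 t = 1.
  by rewrite (wronskian_const I_itv nu_fin nj H1 H2 It Ic).
split.
  by rewrite -[LHS]mulr1 -W'; ring.
by rewrite -[LHS]mulr1 -W'; ring.
Qed.

(* Real coefficients of the system for (Re u, Im u, Re p, Im p), one matrix for each
   of the five measures. *)
Let entry (z : R[i]) (j i i' : nat) : R :=
  nth 0 (nth [::] (nth [::] [::
    [:: [:: 0; 0; 1]; [:: 0; 0; 0; 1]];
    [:: [:: 0; 0; -1]; [:: 0; 0; 0; -1]];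
    [:: [::]; [::]; [:: 1]; [:: 0; 1]];
    [:: [::]; [::]; [:: -1]; [:: 0; -1]];
    [:: [::]; [::]; [:: - complex.Re z; complex.Im z];
                    [:: - complex.Im z; - complex.Re z]]] j) i) i'.

Lemma ivp_forward I (al : R) (z u0 p0 : R[i]) :
  (forall x y t, I x -> I y -> x <= t <= y -> I t) ->
  (forall j, loc_fin I (nu j)) -> I al -> (forall t, I t -> al <= t) ->
  exists u p, [/\ sys I u p (fun t => z * u t), u al = u0 & p al = p0].
Proof.
move: z => [zr zi] I_itv nu_fin Ial al_min; set z := (zr +i* zi)%C.
have [y [y_al Hy]] := @picard_real R I 5 nu I_itv nu_fin al Ial al_min 'I_4
  (fun j (i i' : 'I_4) => entry z j i i')
  (fun i : 'I_4 => nth 0 [:: complex.Re u0; complex.Im u0; complex.Re p0; complex.Im p0] i).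
have e1 : lift ord0 ord0 = @Ordinal 4 1 isT by apply/val_inj.
have e2 : lift ord0 (lift ord0 ord0) = @Ordinal 4 2 isT by apply/val_inj.
have e3 : lift ord0 (lift ord0 (lift ord0 ord0)) = @Ordinal 4 3 isT by apply/val_inj.
have e0 : ord0 = @Ordinal 4 0 isT by apply/val_inj.
pose y0 := y (@Ordinal 4 0 isT); pose y1 := y (@Ordinal 4 1 isT).
pose y2 := y (@Ordinal 4 2 isT); pose y3 := y (@Ordinal 4 3 isT).
exists (fun t => Complex (y0 t) (y1 t)), (fun t => Complex (y2 t) (y3 t)); split.
- have HS i j t : \sum_(i' < 4) entry z j i i' * y i' t =
     entry z j i 0 * y0 t + entry z j i 1 * y1 t + entry z j i 2 * y2 t + entry z j i 3 * y3 t.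
    by rewrite !big_ord_recl big_ord0 /= e1 e2 e3 e0 addr0 !addrA.
  split; split.
  + apply: (prim_ext I_itv (Hy (@Ordinal 4 0 isT))) => // j t It; rewrite HS.
    by move: j => [|[|[|[|[|j]]]]]; rewrite /cre /dens5 /entry /= ?nth_nil; ring.
  + apply: (prim_ext I_itv (Hy (@Ordinal 4 1 isT))) => // j t It; rewrite HS.
    by move: j => [|[|[|[|[|j]]]]]; rewrite /cim /dens5 /entry /= ?nth_nil; ring.
  + apply: (prim_ext I_itv (Hy (@Ordinal 4 2 isT))) => // j t It; rewrite HS.
    move: j => [|[|[|[|[|j]]]]]; rewrite /cre /dens5 /entry /z /= ?nth_nil /=; ring.
  + apply: (prim_ext I_itv (Hy (@Ordinal 4 3 isT))) => // j t It; rewrite HS.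
    move: j => [|[|[|[|[|j]]]]]; rewrite /cim /dens5 /entry /z /= ?nth_nil /=; ring.
- by apply: complex_eqP; rewrite /= ?/y0 ?/y1 y_al.
- by apply: complex_eqP; rewrite /= ?/y2 ?/y3 y_al.
Qed.

Context (I : set R).
Hypothesis I_itv : forall x y t, I x -> I y -> x <= t <= y -> I t.
Hypothesis nu_fin : forall j, loc_fin I (nu j).
Hypothesis nj : null_jumps I.

Let Iab (al : R) := I `&` [set t | al <= t].

Let Iab_itv al : forall x y t, Iab al x -> Iab al y -> x <= t <= y -> Iab al t.
Proof.
move=> x y t [Ix /= ax] [Iy _] xty; split; first exact: I_itv xty.
by move/andP: xty => [/(le_trans ax)].
Qed.

Let Iab_fin al j : loc_fin (Iab al) (nu j).
Proof. by move=> x y [Ix _] [Iy _]; exact: nu_fin. Qed.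

Let Iab_nj al : null_jumps (Iab al).
Proof. by move=> j x y j5 [Ix _] [Iy _]; exact: nj. Qed.

(** Continuation to the left of c. Two solutions started at [al] still have Wronskian 1 at c, so
    some combination of them takes any prescribed values there; [d1] and [d2] come from Cramer's
    rule. *)
Lemma ivp_above (al c : R) (z u0 p0 : R[i]) : I al -> I c -> al <= c ->
  exists u p, [/\ sys (Iab al) u p (fun t => z * u t), u c = u0 & p c = p0].
Proof.
move=> Ial Ic alc.
have Jal : Iab al al by split => //=.
have Jc : Iab al c by split.
have al_min t : Iab al t -> al <= t by case.
have [u1 [p1 [H1 u1E p1E]]] := ivp_forward z 1 0 (@Iab_itv al) (@Iab_fin al) Jal al_min.
have [u2 [p2 [H2 u2E p2E]]] := ivp_forward z 0 1 (@Iab_itv al) (@Iab_fin al) Jal al_min.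
have W : u1 c * p2 c - u2 c * p1 c = 1.
  rewrite (wronskian_const (@Iab_itv al) (@Iab_fin al) (@Iab_nj al) H1 H2 Jc Jal).
  by rewrite u1E u2E p1E p2E; ring.
pose d1 := u0 * p2 c - u2 c * p0; pose d2 := u1 c * p0 - u0 * p1 c.
exists (fun t => d1 * u1 t + d2 * u2 t), (fun t => d1 * p1 t + d2 * p2 t); split.
- apply: (sys_ext (@Iab_itv al) (sys_lin (@Iab_itv al) d1 d2 H1 H2)) => // t _; ring.
- by rewrite -[RHS]mulr1 -W /d1 /d2; ring.
- by rewrite -[RHS]mulr1 -W /d1 /d2; ring.
Qed.

(** The solutions with data (1, 0) and (0, 1) at c form a basis, in which the coefficients of any
    solution are read off from its values at c. *)
Lemma ivp_unique (al c : R) (z : R[i]) u p u' p' : I al -> I c -> al <= c ->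
  sys (Iab al) u p (fun t => z * u t) -> sys (Iab al) u' p' (fun t => z * u' t) ->
  u c = u' c -> p c = p' c -> forall t, Iab al t -> u t = u' t /\ p t = p' t.
Proof.
move=> Ial Ic alc H H' uE pE t Jt.
have [u1 [p1 [H1 u1E p1E]]] := ivp_above z 1 0 Ial Ic alc.
have [u2 [p2 [H2 u2E p2E]]] := ivp_above z 0 1 Ial Ic alc.
have W : u1 c * p2 c - u2 c * p1 c = 1 by rewrite u1E u2E p1E p2E; ring.
have Jc : Iab al c by split.
have [-> ->] := sys_span (@Iab_itv al) (@Iab_fin al) (@Iab_nj al) Jc H1 H2 W H Jt.
have [-> ->] := sys_span (@Iab_itv al) (@Iab_fin al) (@Iab_nj al) Jc H1 H2 W H' Jt.
by rewrite uE pE.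
Qed.

(* Solutions on the half-intervals [al, b) are glued as al decreases to a. *)
Lemma ivp (c : R) (z u0 p0 : R[i]) : I c ->
  exists u p, [/\ sys I u p (fun t => z * u t), u c = u0 & p c = p0].
Proof.
move=> Ic.
have /choice[U HU] : forall al : R, exists up : (R -> R[i]) * (R -> R[i]),
    I al -> al <= c -> [/\ sys (Iab al) up.1 up.2 (fun t => z * up.1 t), up.1 c = u0 & up.2 c = p0].
  move=> al; case: (pselect (I al /\ al <= c)) => [[Ial alc]|n]; last first.
    by exists (fun=> 0, fun=> 0) => Ial alc; exfalso; apply: n.
  by have [u [p ?]] := ivp_above z u0 p0 Ial Ic alc; exists (u, p).
have Imin x : I x -> I (Num.min x c) by move=> Ix; rewrite /Num.min; case: ifP.
have mc x : Num.min x c <= c by rewrite ge_min lexx orbT.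
(* The value at x is taken from the solution on the half-interval starting at min(x, c). By
   uniqueness every lower starting point gives the same value, which is the content of [upE]. *)
pose u x := (U (Num.min x c)).1 x; pose p x := (U (Num.min x c)).2 x.
have upE al t : I al -> al <= c -> Iab al t -> u t = (U al).1 t /\ p t = (U al).2 t.
  move=> Ial alc [It alt]; rewrite /= in alt.
  have [H uE pE] := HU al Ial alc.
  have [H' uE' pE'] := HU _ (Imin t It) (mc t).
  have sub : Iab (Num.min t c) `<=` Iab al.
    move=> s [Is /= ms]; split=> //=; apply: le_trans ms.
    by rewrite le_min alt alc.
  apply: (ivp_unique (Imin t It) Ic (mc t) H' (sys_sub sub H)); rewrite ?uE ?pE//.
  by split=> //=; rewrite ge_min lexx.
exists u, p; split; last 2 first.
- by have [_ <- _] := HU c Ic (lexx c); apply: (upE c c _ _ _).1 => //; split=> /=.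
- by have [_ _ <-] := HU c Ic (lexx c); apply: (upE c c _ _ _).2 => //; split=> /=.
apply: sys_local => x y Ix Iy.
pose al := Num.min (Num.min x y) c.
have Ial : I al by apply: Imin; rewrite /Num.min; case: ifP.
have [H _ _] := HU al Ial (mc _).
have mx : al <= x by rewrite /al !ge_min lexx.
have my : al <= y by rewrite /al !ge_min lexx orbT.
exists (Iab al), (U al).1, (U al).2; split; [by split|by split| |].
  move=> t /andP[xt ty]; apply: (upE al t Ial (mc _)); split.
    apply: (I_itv (x := Num.min x y) (y := Num.max x y)); last by rewrite xt.
      by rewrite /Num.min; case: ifP.
    by rewrite /Num.max; case: ifP.
  by apply: le_trans xt; rewrite /al ge_min lexx.
apply: (sys_ext (@Iab_itv al) H) => // t Jt.
by rewrite (upE al t Ial (mc _) Jt).1.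
Qed.

Lemma fundamental_system (z : R[i]) (c : R) : I c ->
  exists u1 p1 u2 p2, [/\ sys I u1 p1 (fun t => z * u1 t),
    sys I u2 p2 (fun t => z * u2 t) & forall t, I t -> u1 t * p2 t - u2 t * p1 t = 1].
Proof.
move=> Ic; have [u1 [p1 [H1 u1E p1E]]] := ivp z 1 0 Ic.
have [u2 [p2 [H2 u2E p2E]]] := ivp z 0 1 Ic.
exists u1, p1, u2, p2; split=> // t It.
rewrite (wronskian_const I_itv nu_fin nj H1 H2 It Ic) u1E u2E p1E p2E; ring.
Qed.

End initial_value_problem.

(** * The differential expression tau *)

Section translation.
Context {R : realType} (a b : \bar R).
Notation I := (Itv a b).
Implicit Types (mu : {measure set R -> \bar R}).

Lemma Itv_itv x y t : I x -> I y -> x <= t <= y -> I t.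
Proof.
move=> [ax _] [_ yb] /andP[xt ty]; split.
  by rewrite (lt_le_trans ax)// lee_fin.
by rewrite (le_lt_trans _ yb)// lee_fin.
Qed.

Lemma measurable_Itv : measurable I.
Proof. by apply: is_interval_measurable => x y Ix Iy t; exact: Itv_itv. Qed.

Lemma locfin_loc_fin mu : locfin a b mu -> loc_fin I mu.
Proof.
move=> H x y [ax _] [_ yb]; case: (leP x y) => xy; first exact: H.
rewrite (_ : mkset _ = set0) ?measure0//.
by apply/seteqP; split => // t /= /andP[xt /(le_trans xt)]; rewrite leNgt xy.
Qed.

Lemma locint_cloc_int mu h : locint a b mu h <-> cloc_int I mu h.
Proof.
split=> [H|[Hr Hi] x y ax xy yb].
  split => x y [ax _] [_ yb]; (case: (leP x y) => xy;
    [by have [] := H x y ax xy yb|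
     rewrite (_ : mkset _ = set0); [exact: integrable_set0|
     by apply/seteqP; split => // t /= /andP[xt /(le_trans xt)]; rewrite leNgt xy]]).
have Ix : I x by split => //; rewrite (le_lt_trans _ yb)// lee_fin.
have Iy : I y by split => //; rewrite (lt_le_trans ax)// lee_fin.
by split; [exact: Hr|exact: Hi].
Qed.

(** Mutual singularity excludes cancellation: according to whether t lies in [P], one of the two
    parts already vanishes at {t}, so the signed mass is plus or minus the mass of the other. *)
Lemma singular_atom mup mum t : signed_locfin a b mup mum -> I t ->
  spt mup mum t = 0 -> mup [set t] = 0%E /\ mum [set t] = 0%E.
Proof.
move=> [fp fm [P [mP [p0 m0]]]] It.
have mI := measurable_Itv.
have fin mu : locfin a b mu -> mu [set t] \is a fin_num.
  move=> /locfin_loc_fin/(_ t t It It); rewrite ge0_fin_numE//; apply: le_lt_trans.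
  apply: le_measure; rewrite ?inE//; first exact: measurable_cc.
  by move=> _ ->; rewrite /= lexx.
have sub0 mu (A : set R) : measurable A -> mu A = 0%E -> A t -> mu [set t] = 0%E.
  move=> mA A0 At; apply/eqP; rewrite eq_le measure_ge0 andbT -A0.
  by apply: le_measure; rewrite ?inE// => _ ->.
rewrite /spt => /eqP; case: (pselect (P t)) => Pt.
  have -> : mum [set t] = 0%E by apply: (sub0 _ (I `&` P)) => //; exact: measurableI.
  rewrite /= subr0 fine_eq0 ?fin// => /eqP ->//.
have -> : mup [set t] = 0%E.
  by apply: (sub0 _ (I `&` ~` P)) => //; apply: measurableI => //; exact: measurableC.
by rewrite /= sub0r oppr_eq0 fine_eq0 ?fin// => /eqP ->.
Qed.

(** The case x = c of [cfrom] needs no branch here: the integral over an empty interval is 0. *)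
Definition rfrom mu (c x : R) (h : R -> R) : R :=
  if c <= x then \int[mu]_(t in [set t | c <= t < x]) h t
  else - \int[mu]_(t in [set t | x <= t < c]) h t.

Lemma Rintegral_co_split mu h x y w : x <= y -> y <= w ->
  mu.-integrable [set t | x <= t < w] (EFin \o h) ->
  \int[mu]_(t in [set t | x <= t < w]) h t =
  \int[mu]_(t in [set t | x <= t < y]) h t + \int[mu]_(t in [set t | y <= t < w]) h t.
Proof.
move=> xy yw jh.
have E : [set t | x <= t < w] = [set t | x <= t < y] `|` [set t | y <= t < w].
  apply/seteqP; split => t /=.
    by move=> /andP[-> ->]; rewrite andbT; case: (ltP t y) => ?; [left|right].
  move=> [/andP[-> ty]|/andP[yt ->]]; first exact: lt_le_trans yw.
  by rewrite (le_trans xy).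
rewrite E Rintegral_setU//; [exact: measurable_co|exact: measurable_co|by rewrite -E|].
by apply/disj_set2P; apply/seteqP; split => // t [/= /andP[_ ty] /andP[]]; rewrite leNgt ty.
Qed.

Lemma rfrom_inc mu h c x y : loc_int I mu h -> I c -> I x -> I y -> x <= y ->
  rfrom mu c y h - rfrom mu c x h = \int[mu]_(t in [set t | x <= t < y]) h t.
Proof.
move=> jh Ic Ix Iy xy; rewrite /rfrom.
case: (leP c x) => cx.
  rewrite (le_trans cx xy) (Rintegral_co_split cx xy)//; last exact: (loc_int_co jh).
  by rewrite addrAC subrr add0r.
case: (leP c y) => cy.
  rewrite opprK (Rintegral_co_split (ltW cx) cy)//; last exact: (loc_int_co jh).
  by rewrite addrC.
rewrite opprK (Rintegral_co_split xy (ltW cy))//; last exact: (loc_int_co jh).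
by rewrite addrC -addrA subrr addr0.
Qed.

Lemma prim_rfrom N (nu : nat -> {measure set R -> \bar R}) (F : R -> R)
    (f : nat -> R -> R) (c : R) : I c -> (forall j, loc_int I (nu j) (f j)) ->
  prim I N nu F f <-> forall x, I x -> F x = F c + \sum_(j < N) rfrom (nu j) c x (f j).
Proof.
move=> Ic jf; split=> [[_ HF] x Ix|HF].
  have rcc (j : nat) : rfrom (nu j) c c (f j) = 0.
    rewrite /rfrom lexx (_ : mkset _ = set0) ?Rintegral_set0//.
    by apply/seteqP; split => // t /= /andP[a1 /lt_le_trans/(_ a1)]; rewrite ltxx.
  case: (leP c x) => [|/ltW] cx; apply/eqP; rewrite addrC -subr_eq; apply/eqP.
    rewrite HF//; apply: eq_bigr => j _.
    by rewrite -(rfrom_inc (jf j) Ic Ic Ix cx) rcc subr0.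
  apply: oppr_inj; rewrite opprB HF// -sumrN; apply: eq_bigr => j _.
  by rewrite -(rfrom_inc (jf j) Ic Ix Ic cx) rcc sub0r.
split=> // x y Ix Iy xy; rewrite (HF y Iy) (HF x Ix) opprD addrACA subrr add0r.
by rewrite -sumrB; apply: eq_bigr => j _; rewrite rfrom_inc.
Qed.

Lemma Re_cfrom mu c x h : complex.Re (cfrom mu c x h) = rfrom mu c x (cre h).
Proof.
rewrite /cfrom /rfrom; case: (ltgtP c x) => [//|_|->]; first by rewrite cReN.
rewrite (_ : mkset _ = set0) ?Rintegral_set0//.
by apply/seteqP; split => // t /= /andP[a1 /lt_le_trans/(_ a1)]; rewrite ltxx.
Qed.

Lemma Im_cfrom mu c x h : complex.Im (cfrom mu c x h) = rfrom mu c x (cim h).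
Proof.
rewrite /cfrom /rfrom; case: (ltgtP c x) => [//|_|->]; first by rewrite cImN.
rewrite (_ : mkset _ = set0) ?Rintegral_set0//.
by apply/seteqP; split => // t /= /andP[a1 /lt_le_trans/(_ a1)]; rewrite ltxx.
Qed.

(** [cprim] has no base point. Passing to it reconciles the independent base points that [is_tau]
    allows for f, for F and for the chi integral. *)
Lemma cprim_cfrom N (nu : nat -> {measure set R -> \bar R}) (F : R -> R[i])
    (f : nat -> R -> R[i]) (c : R) : I c -> (forall j, cloc_int I (nu j) (f j)) ->
  cprim I N nu F f <-> forall x, I x -> F x = F c + \sum_(j < N) cfrom (nu j) c x (f j).
Proof.
move=> Ic jf.
have Pr := prim_rfrom N (cre F) Ic (fun j => (jf j).1).
have Pi := prim_rfrom N (cim F) Ic (fun j => (jf j).2).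
split=> [[/Pr Hr /Pi Hi] x Ix|HF].
  apply: complex_eqP; rewrite ?cReD ?cImD.
    by rewrite Re_sum; under eq_bigr do rewrite Re_cfrom; exact: Hr.
  by rewrite Im_sum; under eq_bigr do rewrite Im_cfrom; exact: Hi.
split; [apply/Pr => x Ix|apply/Pi => x Ix].
  rewrite /cre HF// cReD Re_sum; congr (_ + _); apply: eq_bigr => j _; exact: Re_cfrom.
rewrite /cim HF// cImD Im_sum; congr (_ + _); apply: eq_bigr => j _; exact: Im_cfrom.
Qed.

Lemma cfromN mu c x h : cloc_int I mu h -> I c -> I x ->
  cfrom mu c x (fun t => - h t) = - cfrom mu c x h.
Proof.
move=> [jr ji] Ic Ix.
have RN (g : R -> R) : loc_int I mu g -> rfrom mu c x (fun t => - g t) = - rfrom mu c x g.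
  move=> jg; rewrite /rfrom.
  have E u v : I u -> I v -> \int[mu]_(t in [set t | u <= t < v]) (- g t) =
      - \int[mu]_(t in [set t | u <= t < v]) g t.
    move=> Iu Iv; under eq_Rintegral do rewrite -mulN1r.
    rewrite RintegralZl ?mulN1r//; [exact: measurable_co|exact: (loc_int_co jg)].
  by case: ifP => _; rewrite E.
apply: complex_eqP; rewrite ?cReN ?cImN ?Re_cfrom ?Im_cfrom -RN//; congr rfrom;
  by apply/funext => t; rewrite /cre /cim ?cReN ?cImN.
Qed.

Lemma cfromcc mu (c : R) h : cfrom mu c c h = 0.
Proof. by rewrite /cfrom ltxx eqxx. Qed.

Lemma cfrom0 mu c x : cfrom mu c x (fun=> 0) = 0.
Proof.
have E u v : \int[mu]_(t in [set t | u <= t < v]) (0 : R) = 0.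
  by rewrite Rintegral_cst ?mul0r//; exact: measurable_co.
by apply: complex_eqP; rewrite ?Re_cfrom ?Im_cfrom /rfrom /cre /cim /= !E oppr0; case: ifP.
Qed.

Context (rho sgp sgm chp chm : {measure set R -> \bar R}).
Notation nu := (nu5 rho sgp sgm chp chm).
Notation sys := (sys rho sgp sgm chp chm).
Notation is_tau := (is_tau a b rho sgp sgm chp chm).

Lemma cloc_int_dens5 d0 d1 d2 d3 d4 :
  cloc_int I sgp d0 -> cloc_int I sgm d1 -> cloc_int I chp d2 ->
  cloc_int I chm d3 -> cloc_int I rho d4 ->
  forall j, cloc_int I (nu j) (dens5 d0 d1 d2 d3 d4 j).
Proof.
move=> ? ? ? ? ? [|[|[|[|[|j]]]]]//=; rewrite /dens5 /= nth_nil; exact: cloc_int0.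
Qed.

Lemma cloc_intN mu h : cloc_int I mu h -> cloc_int I mu (fun t => - h t).
Proof.
move=> jh; apply: (cloc_int_ext Itv_itv (cloc_int_lin (-1) 0 jh jh)) => t _; ring.
Qed.

Hypothesis nu_fin : forall j, loc_fin I (nu j).

(** Put p = (integral of f dchi) - F. The defining relation of [is_tau] says that p equals the
    density h of f almost everywhere for both parts of sigma, so p may replace h; unlike h it is
    defined at every point and is itself a primitive. *)
Lemma is_tau_sys f g : is_tau f g ->
  exists p k, sys I f p k /\ ae_eqc rho I g k.
Proof.
move=> [c [h [F [k [Ic [/locint_cloc_int hp [/locint_cloc_int hm [c' Ic' fE]]]
  [/locint_cloc_int jk [c'' Ic'' FE]]
  [/locint_cloc_int fp /locint_cloc_int fm] [Ep Em gk]]]]]].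
pose p x := sfrom chp chm c x f - F x.
exists p, k; split=> //.
have jp := cloc_int_dens5 (cloc_int0 I _) (cloc_int0 I _) fp (cloc_intN fm) (cloc_intN jk).
have jh := cloc_int_dens5 hp (cloc_intN hm) (cloc_int0 I _) (cloc_int0 I _) (cloc_int0 I _).
have Hchi : cprim I 5 nu (fun x => sfrom chp chm c x f) (dens5 (fun=> 0) (fun=> 0) f (fun t => - f t) (fun=> 0)).
  have jf := cloc_int_dens5 (cloc_int0 I _) (cloc_int0 I _) fp (cloc_intN fm) (cloc_int0 I _).
  apply/(cprim_cfrom _ _ Ic jf) => x Ix.
  rewrite !big_ord_recl big_ord0 /dens5 /nu5 /= !cfrom0 (cfromN fm Ic Ix).
  by rewrite /sfrom !cfromcc; ring.
have HF : cprim I 5 nu F (dens5 (fun=> 0) (fun=> 0) (fun=> 0) (fun=> 0) k).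
  have jf := cloc_int_dens5 (cloc_int0 I _) (cloc_int0 I _) (cloc_int0 I _) (cloc_int0 I _) jk.
  apply/(cprim_cfrom _ _ Ic'' jf) => x Ix.
  by rewrite !big_ord_recl big_ord0 /dens5 /nu5 /= !cfrom0 FE//; ring.
have Hp : cprim I 5 nu p (dens5 (fun=> 0) (fun=> 0) f (fun t => - f t) (fun t => - k t)).
  apply: (cprim_ext Itv_itv (cprim_lin Itv_itv 1 (-1) Hchi HF)) => [t _|j t _].
    by rewrite /p; ring.
  by move: j => [|[|[|[|[|j]]]]]; rewrite /dens5 /= ?nth_nil; ring.
split=> //.
have Hf : cprim I 5 nu f (dens5 h (fun t => - h t) (fun=> 0) (fun=> 0) (fun=> 0)).
  apply/(cprim_cfrom _ _ Ic' jh) => x Ix.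
  rewrite !big_ord_recl big_ord0 /dens5 /nu5 /= !cfrom0 (cfromN hm Ic' Ix) fE// /sfrom; ring.
have jpp j := cloc_int_prim Itv_itv nu_fin j Hp.
apply: (cprim_ae Hf).
  exact: (cloc_int_dens5 (jpp 0) (cloc_intN (jpp 1)) (cloc_int0 I _) (cloc_int0 I _) (cloc_int0 I _)).
move=> j x y j5 Ix Iy.
have hpE t : F t = - h t + sfrom chp chm c t f -> h t = p t by rewrite /p => ->; ring.
case: j j5 => [|[|j]] j5.
- apply: negligibleS Ep => t [xty ne]; split; first exact: Itv_itv xty.
  by move=> E; apply: ne; rewrite /dens5 /= hpE.
- apply: negligibleS Em => t [xty ne]; split; first exact: Itv_itv xty.
  by move=> E; apply: ne; rewrite /dens5 /= hpE.
- apply: negligibleS (negligible_set0 _) => t /= [_]; apply.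
  by move: j {j5} => [|[|[|j]]]; rewrite /dens5.
Qed.

(** The converse choice: F = (integral of f dchi) - p with density h = p, so that the defining
    relation holds at every point. *)
Lemma sys_is_tau (c : R) f p k g : I c -> sys I f p k -> ae_eqc rho I g k -> is_tau f g.
Proof.
move=> Ic [Hf Hp] gk.
have jf j := cloc_int_prim Itv_itv nu_fin j Hf.
have jp j := cloc_int_prim Itv_itv nu_fin j Hp.
have jk : cloc_int I rho k.
  have jk : cloc_int I rho (fun t => - k t) by split; [exact: (Hp.1.1 4)|exact: (Hp.2.1 4)].
  by apply: (cloc_int_ext Itv_itv (cloc_intN jk)) => t _; rewrite opprK.
exists c, p, (fun x => sfrom chp chm c x f - p x), k; split => //.
- split; first by apply/locint_cloc_int; exact: (jp 0).
  split; first by apply/locint_cloc_int; exact: (jp 1).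
  exists c => // x Ix.
  have /(cprim_cfrom _ _ Ic) H := Hf.
  rewrite (H _ x Ix); last first.
    exact: (cloc_int_dens5 (jp 0) (cloc_intN (jp 1)) (cloc_int0 I _) (cloc_int0 I _) (cloc_int0 I _)).
  rewrite !big_ord_recl big_ord0 /dens5 /nu5 /= !cfrom0 (cfromN (jp 1) Ic Ix) /sfrom; ring.
- split; first exact/locint_cloc_int.
  exists c => // x Ix.
  have /(cprim_cfrom _ _ Ic) H := Hp.
  rewrite (H _ x Ix); last first.
    exact: (cloc_int_dens5 (cloc_int0 I _) (cloc_int0 I _) (jf 2) (cloc_intN (jf 3)) (cloc_intN jk)).
  rewrite !big_ord_recl big_ord0 /dens5 /nu5 /= !cfrom0 (cfromN (jf 3) Ic Ix) (cfromN jk Ic Ix).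
  have -> : sfrom chp chm c c f = 0 by rewrite /sfrom !cfromcc subrr.
  rewrite /sfrom; ring.
- by split; apply/locint_cloc_int; [exact: (jf 2)|exact: (jf 3)].
- have E (mu : {measure set R -> \bar R}) : ae_eqc mu I (fun x => sfrom chp chm c x f - p x)
      (fun x => - p x + sfrom chp chm c x f).
    apply: negligibleS (negligible_set0 _) => t [_] /=; apply; ring.
  by split=> //; exact: E.
Qed.

(** The system has real coefficients; for k = z u, conjugation passes from z to its conjugate. *)
Lemma sys_conj f p k : sys I f p k ->
  sys I (fun t => cconj (f t)) (fun t => cconj (p t)) (fun t => cconj (k t)).
Proof.
have cc F d d' : cprim I 5 nu F d -> (forall j t, d' j t = cconj (d j t)) ->
    cprim I 5 nu (fun t => cconj (F t)) d'.
  move=> [Hr Hi] E; split.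
    by apply: (prim_ext Itv_itv Hr) => // j t _; rewrite /cre E.
  apply: (prim_ext Itv_itv (prim_lin (-1) 0 Hi Hi)) => [t _|j t _]; rewrite /cim ?E /cconj /=; ring.
move=> [Hf Hp]; split.
  apply: (cc _ _ _ Hf) => -[|[|[|[|[|j]]]]] t; rewrite /dens5 /= ?nth_nil /cconj;
    by apply: complex_eqP; rewrite /= ?cReN ?cImN ?oppr0.
apply: (cc _ _ _ Hp) => -[|[|[|[|[|j]]]]] t; rewrite /dens5 /= ?nth_nil /cconj;
  by apply: complex_eqP; rewrite /= ?cReN ?cImN ?oppr0.
Qed.

End translation.

(** * Square integrable functions *)

Section square_integrable.
Context {R : realType} (a b : \bar R).
Notation I := (Itv a b).

Lemma Itv_rat_bounds (t : R) : I t -> exists q r : rat,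
  [/\ I (ratr q), I (ratr r) & (ratr q : R) <= t <= ratr r].
Proof.
move=> [at_ tb].
have [x [ax xt]] : exists x : R, (a <= x%:E)%E /\ x < t.
  case: a at_ => [r|//|_]; first by rewrite lte_fin => rt; exists r.
  by exists (t - 1); rewrite leNye; split=> //; rewrite gtrBl.
have [y [yb ty]] : exists y : R, (y%:E <= b)%E /\ t < y.
  case: b tb => [r|_|//]; first by rewrite lte_fin => rt; exists r.
  by exists (t + 1); rewrite leey; split=> //; rewrite ltrDl.
have [q] := rat_in_itvoo xt; rewrite in_itv /= => /andP[xq qt].
have [r] := rat_in_itvoo ty; rewrite in_itv /= => /andP[tr ry].
exists q, r; split.
- split; first by rewrite (le_lt_trans ax)// lte_fin.
  by rewrite (lt_trans _ tb)// lte_fin.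
- split; first by rewrite (lt_trans at_)// lte_fin.
  by rewrite (lt_le_trans _ yb)// lte_fin.
- by rewrite (ltW qt) (ltW tr).
Qed.

(** The interval is a countable union of compact subintervals with rational end points. *)
Lemma measurable_Itv_local (g : R -> R) :
  (forall x y, I x -> I y -> measurable_fun [set t | x <= t <= y] g) ->
  measurable_fun I g.
Proof.
move=> H.
(* The pairs of rationals are enumerated through [unpickle]; a code n that gives no admissible pair
   contributes the empty set. *)
pose P n (qr : rat * rat) := unpickle n = Some qr /\ (I (ratr qr.1) /\ I (ratr qr.2)).
pose E n : set R := [set t | exists2 qr, P n qr & (ratr qr.1 <= t <= ratr qr.2)%R].
have EI : I = \bigcup_n E n.
  apply/seteqP; split => [t /Itv_rat_bounds[q [r [Iq Ir qtr]]]|t [n _ [qr [_ [Iq Ir]]]]].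
    exists (pickle (q, r)); first by [].
    by exists (q, r); first by rewrite /P pickleK.
  exact: Itv_itv.
have Ecases n : E n = set0 \/ exists x y, [/\ I x, I y & E n = [set t | x <= t <= y]].
  case: (pselect (exists qr, P n qr)) => [[qr Pqr]|nP]; last first.
    by left; apply/seteqP; split => // t [qr Pqr _]; apply: nP; exists qr.
  right; exists (ratr qr.1), (ratr qr.2); split; [exact: Pqr.2.1|exact: Pqr.2.2|].
  apply/seteqP; split => t; last by move=> qt; exists qr.
  by move=> [qr' [e _]]; rewrite Pqr.1 in e; case: e => <-.
rewrite EI; apply/measurable_fun_bigcup => n; case: (Ecases n) => [->|[x [y [Ix Iy ->]]]].
- exact: measurable0.
- exact: measurable_cc.
- exact: measurable_fun_set0.
- exact: H.
Qed.

Lemma cloc_int_measurable (mu : {measure set R -> \bar R}) h : cloc_int I mu h ->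
  measurable_fun I (cre h) /\ measurable_fun I (cim h).
Proof.
move=> [jr ji]; split; apply: measurable_Itv_local => x y Ix Iy; apply/measurable_EFinP.
  exact: measurable_int (jr x y Ix Iy).
exact: measurable_int (ji x y Ix Iy).
Qed.

Section fixed_measure.
Context (rho : {measure set R -> \bar R}).
Notation L2 := (L2 a b rho).
Let mI : measurable I := measurable_Itv a b.

Lemma csq_ge0 (f : R -> R[i]) x : 0 <= csq f x.
Proof. by rewrite addr_ge0// sqr_ge0. Qed.

Lemma L2_integrable_csq f : L2 f -> rho.-integrable I (EFin \o csq f).
Proof.
move=> [mr [mi fo]]; apply/integrableP; split.
  by apply/measurable_EFinP; apply: measurable_funD; exact: measurable_funX.
rewrite (_ : (\int[rho]_(x in I) `|(EFin \o csq f) x|)%E = (\int[rho]_(x in I) (csq f x)%:E)%E)//.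
by apply: eq_integral => x _ /=; rewrite ger0_norm// csq_ge0.
Qed.

Lemma L2_dom f (h : R -> R) : measurable_fun I (cre f) -> measurable_fun I (cim f) ->
  rho.-integrable I (EFin \o h) -> (forall x, I x -> csq f x <= h x) -> L2 f.
Proof.
move=> mr mi jh fh; split=> //; split=> //.
apply: le_lt_trans (integrable_lty mI jh).
apply: ge0_le_integral => //.
- by move=> x _; rewrite lee_fin csq_ge0.
- by apply/measurable_EFinP; apply: measurable_funD; exact: measurable_funX.
- exact: measurable_int jh.
Qed.

Lemma L2_measurable_lin f g (c d : R[i]) : L2 f -> L2 g ->
  measurable_fun I (cre (fun t => c * f t + d * g t)) /\
  measurable_fun I (cim (fun t => c * f t + d * g t)).
Proof.
move=> [fr [fi _]] [gr [gi _]]; split.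
  rewrite (_ : cre _ = (fun t => (complex.Re c * cre f t - complex.Im c * cim f t) +
     (complex.Re d * cre g t - complex.Im d * cim g t))).
    by apply: measurable_funD; apply: measurable_funB; exact: measurable_funM.
  by apply/funext => t; rewrite /cre cReD !cReM.
rewrite (_ : cim _ = (fun t => (complex.Re c * cim f t + complex.Im c * cre f t) +
     (complex.Re d * cim g t + complex.Im d * cre g t))).
  by apply: measurable_funD; apply: measurable_funD; exact: measurable_funM.
by apply/funext => t; rewrite /cim cImD !cImM.
Qed.

Lemma csq_lin f g (c d : R[i]) t : csq (fun t : R => c * f t + d * g t) t <=
  2 * (complex.Re c ^+ 2 + complex.Im c ^+ 2) * csq f t +
  2 * (complex.Re d ^+ 2 + complex.Im d ^+ 2) * csq g t.
Proof.
rewrite /csq cReD cImD !cReM !cImM.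
move: (complex.Re c) (complex.Im c) (complex.Re d) (complex.Im d) (complex.Re (f t))
  (complex.Im (f t)) (complex.Re (g t)) (complex.Im (g t)) => x y z w p q r s.
(* Parallelogram identity: the gap is |c f - d g|^2, split into the squares of its real and
   imaginary parts. *)
rewrite -subr_ge0 (_ : _ - _ = ((x * p - y * q) - (z * r - w * s)) ^+ 2 +
  ((x * q + y * p) - (z * s + w * r)) ^+ 2); last by ring.
by rewrite addr_ge0// sqr_ge0.
Qed.

Lemma L2_lin f g (c d : R[i]) : L2 f -> L2 g -> L2 (fun t => c * f t + d * g t).
Proof.
move=> Lf Lg; have [mr mi] := L2_measurable_lin c d Lf Lg.
apply: (L2_dom mr mi _ (fun t _ => csq_lin f g c d t)).
by apply: integrableD_EFin => //; apply: integrableZ_EFin => //; exact: L2_integrable_csq.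
Qed.

Lemma L2_conj f : L2 f -> L2 (fun t => cconj (f t)).
Proof.
move=> Lf; have [fr [fi _]] := Lf.
apply: (L2_dom _ _ (L2_integrable_csq Lf)) => //.
- rewrite (_ : cim _ = (fun t => - cim f t))//; exact: measurable_funN.
- by move=> t _; rewrite /csq /cconj /= sqrrN.
Qed.

Lemma L2_0 : L2 (fun=> 0).
Proof.
split; [exact: measurable_cst|split; [exact: measurable_cst|]].
under eq_integral do rewrite /csq /= expr0n addr0.
by rewrite integral0.
Qed.

Lemma L2_integrable_of_bound (f g : R -> R[i]) (h : R -> R) : L2 f -> L2 g ->
  measurable_fun I h -> (forall t, I t -> `|h t| <= csq f t + csq g t) ->
  rho.-integrable I (EFin \o h).
Proof.
move=> Lf Lg mh hb.
apply: (le_integrable mI _ _ (integrableD_EFin mI (L2_integrable_csq Lf) (L2_integrable_csq Lg))).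
  exact/measurable_EFinP.
by move=> t It /=; rewrite lee_fin (le_trans (hb t It))// ler_norm.
Qed.

Lemma dot_le_sum_sqr (p q r s : R) : p * r + q * s <= p ^+ 2 + q ^+ 2 + (r ^+ 2 + s ^+ 2).
Proof.
rewrite -subr_ge0 (_ : _ - _ = 2^-1 * ((p - r) ^+ 2 + (q - s) ^+ 2 + (p ^+ 2 + q ^+ 2 + (r ^+ 2 + s ^+ 2)))).
  by rewrite mulr_ge0 ?invr_ge0// !addr_ge0// sqr_ge0.
by field.
Qed.

Lemma norm_dot_le_sum_sqr (p q r s : R) :
  `|p * r + q * s| <= p ^+ 2 + q ^+ 2 + (r ^+ 2 + s ^+ 2).
Proof.
rewrite ler_norml dot_le_sum_sqr andbT lerNl opprD -!mulNr.
by rewrite (le_trans (dot_le_sum_sqr _ _ _ _))// !sqrrN.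
Qed.

Lemma L2_prod f g : L2 f -> L2 g -> cintegrable rho I (fun t => f t * g t).
Proof.
move=> Lf Lg; have [fr [fi _]] := Lf; have [gr [gi _]] := Lg.
split; apply: (L2_integrable_of_bound Lf Lg).
- rewrite (_ : cre _ = (fun t => cre f t * cre g t - cim f t * cim g t)).
    by apply: measurable_funB; exact: measurable_funM.
  by apply/funext => t; rewrite /cre cReM.
- move=> t _; rewrite /cre cReM -mulrN.
  by rewrite (le_trans (norm_dot_le_sum_sqr _ _ _ _))// sqrrN.
- rewrite (_ : cim _ = (fun t => cre f t * cim g t + cim f t * cre g t)).
    by apply: measurable_funD; exact: measurable_funM.
  by apply/funext => t; rewrite /cim cImM.
- move=> t _; rewrite /cim cImM.
  by rewrite (le_trans (norm_dot_le_sum_sqr _ _ _ _))// [in leLHS](addrC (_ ^+ 2) (complex.Re (g t) ^+ 2)).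
Qed.

Lemma L2_bounded_mul u A (B : R) : L2 u ->
  measurable_fun I (cre A) -> measurable_fun I (cim A) ->
  (forall t, I t -> csq A t <= B) -> L2 (fun t => u t * A t).
Proof.
move=> Lu mr mi AB; have [ur [ui _]] := Lu.
apply: (L2_dom _ _ (integrableZ_EFin B mI (L2_integrable_csq Lu))).
- rewrite (_ : cre _ = (fun t => cre u t * cre A t - cim u t * cim A t)).
    by apply: measurable_funB; exact: measurable_funM.
  by apply/funext => t; rewrite /cre cReM.
- rewrite (_ : cim _ = (fun t => cre u t * cim A t + cim u t * cre A t)).
    by apply: measurable_funD; exact: measurable_funM.
  by apply/funext => t; rewrite /cim cImM.
move=> t It; rewrite (_ : csq (fun t : R => u t * A t) t = csq A t * csq u t); last first.
  by transitivity (complex.Re (u t * A t) ^+ 2 + complex.Im (u t * A t) ^+ 2) => //; rewrite cReM cImM /csq; ring.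
by rewrite ler_wpM2r ?csq_ge0// AB.
Qed.

Lemma L2_ae f f' : L2 f -> measurable_fun I (cre f') -> measurable_fun I (cim f') ->
  ae_eqc rho I f f' -> L2 f'.
Proof.
move=> [fr [fi fo]] mr mi E; split=> //; split=> //.
rewrite -(@ge0_ae_eq_integral _ _ _ rho I (EFin \o csq f))//.
- by apply/measurable_EFinP; apply: measurable_funD; exact: measurable_funX.
- by apply/measurable_EFinP; apply: measurable_funD; exact: measurable_funX.
- by move=> x _; rewrite lee_fin csq_ge0.
- by move=> x _; rewrite lee_fin csq_ge0.
apply: negligibleS E => t /= /not_implyP[It ne]; split=> //= ff; apply: ne.
by rewrite /csq ff.
Qed.

Lemma cInt_ae (f g : R -> R[i]) : cintegrable rho I f -> cintegrable rho I g ->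
  ae_eqc rho I f g -> cInt rho I f = cInt rho I g.
Proof.
move=> [fr fi] [gr gi] E; rewrite /cInt; congr Complex; congr fine; apply: ae_eq_integral => //.
- exact: measurable_int fr.
- exact: measurable_int gr.
- apply: negligibleS E => t /= /not_implyP[It ne]; split=> //= ff; apply: ne.
  by rewrite /cre ff.
- exact: measurable_int fi.
- exact: measurable_int gi.
- apply: negligibleS E => t /= /not_implyP[It ne]; split=> //= ff; apply: ne.
  by rewrite /cim ff.
Qed.

Lemma eq_cintegrable (f g : R -> R[i]) : (forall t, I t -> f t = g t) ->
  cintegrable rho I f -> cintegrable rho I g.
Proof.
move=> E [fr fi]; split.
  by apply: eq_integrable fr => // t /set_mem It /=; rewrite /cre E.
by apply: eq_integrable fi => // t /set_mem It /=; rewrite /cim E.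
Qed.

Lemma eq_cInt D (f g : R -> R[i]) : (forall t, D t -> f t = g t) ->
  cInt rho D f = cInt rho D g.
Proof.
by move=> E; rewrite /cInt; congr Complex; apply: eq_Rintegral => t /set_mem It; rewrite /cre /cim E.
Qed.

Lemma cintegrable_lin (f g : R -> R[i]) (c d : R[i]) :
  cintegrable rho I f -> cintegrable rho I g ->
  cintegrable rho I (fun t => c * f t + d * g t).
Proof.
move=> [fr fi] [gr gi]; split.
  have := integrableD_EFin mI
    (integrableD_EFin mI (integrableZ_EFin (complex.Re c) mI fr) (integrableZ_EFin (- complex.Im c) mI fi))
    (integrableD_EFin mI (integrableZ_EFin (complex.Re d) mI gr) (integrableZ_EFin (- complex.Im d) mI gi)).
  by apply: eq_integrable => // t _ /=; rewrite /cre /cim cReD !cReM; congr EFin; ring.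
have := integrableD_EFin mI
    (integrableD_EFin mI (integrableZ_EFin (complex.Im c) mI fr) (integrableZ_EFin (complex.Re c) mI fi))
    (integrableD_EFin mI (integrableZ_EFin (complex.Im d) mI gr) (integrableZ_EFin (complex.Re d) mI gi)).
by apply: eq_integrable => // t _ /=; rewrite /cre /cim cImD !cImM; congr EFin; ring.
Qed.

Lemma cInt_lin_on D (f g : R -> R[i]) (c d : R[i]) : measurable D ->
  cintegrable rho D f -> cintegrable rho D g ->
  cInt rho D (fun t => c * f t + d * g t) = c * cInt rho D f + d * cInt rho D g.
Proof.
move=> mD [fr fi] [gr gi].
have L (x y z w : R) : \int[rho]_(t in D) ((x * cre f t + y * cim f t) + (z * cre g t + w * cim g t)) =
   (x * \int[rho]_(t in D) cre f t + y * \int[rho]_(t in D) cim f t) +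
   (z * \int[rho]_(t in D) cre g t + w * \int[rho]_(t in D) cim g t).
  have jZ e (h : R -> R) := @integrableZ_EFin R rho D h e mD.
  rewrite RintegralD//; [|by apply: integrableD_EFin => //; exact: jZ..].
  by rewrite !RintegralD ?RintegralZl//; exact: jZ.
apply: complex_eqP; rewrite ?cReD ?cImD ?cReM ?cImM /=.
  transitivity (\int[rho]_(t in D) ((complex.Re c * cre f t + (- complex.Im c) * cim f t) + (complex.Re d * cre g t + (- complex.Im d) * cim g t))).
    by apply: eq_Rintegral => t _; rewrite /cre /cim cReD !cReM; ring.
  rewrite L; ring.
transitivity (\int[rho]_(t in D) ((complex.Im c * cre f t + complex.Re c * cim f t) + (complex.Im d * cre g t + complex.Re d * cim g t))).
  by apply: eq_Rintegral => t _; rewrite /cre /cim cImD !cImM; ring.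
rewrite L; ring.
Qed.

Lemma cInt_lin (f g : R -> R[i]) (c d : R[i]) :
  cintegrable rho I f -> cintegrable rho I g ->
  cInt rho I (fun t => c * f t + d * g t) = c * cInt rho I f + d * cInt rho I g.
Proof. exact: cInt_lin_on. Qed.

(** Both parts of f are dominated by 1 + |f|^2, and constants are locally integrable because [rho]
    is locally finite. *)
Lemma L2_cloc_int f : loc_fin I rho -> L2 f -> cloc_int I rho f.
Proof.
move=> fin Lf; have [fr [fi _]] := Lf.
have H (h : R -> R) : measurable_fun I h -> (forall t, `|h t| <= 1 + csq f t) -> loc_int I rho h.
  move=> mh hb x y Ix Iy; have mD := measurable_cc x y.
  have sub : [set t | x <= t <= y] `<=` I by move=> t; exact: Itv_itv.
  have j1 := @loc_int_cst _ I (fun=> rho) (fun=> fin) 0 1 x y Ix Iy.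
  have j2 := integrableS mI mD sub (L2_integrable_csq Lf).
  apply: (le_integrable mD _ _ (integrableD_EFin mD j1 j2)).
    by apply/measurable_EFinP; exact: measurable_funS mh.
  by move=> t _ /=; rewrite lee_fin (le_trans (hb t))// ler_norm.
split; apply: H => // t; rewrite /cre /cim /csq;
  move: (complex.Re (f t)) (complex.Im (f t)) => p q; rewrite ler_norml; apply/andP; split; nra.
Qed.

(** Based at the end point a rather than at an interior point, which makes sense for [phi]
    integrable on the whole interval; half-open at t in accordance with [prim]. *)
Definition cpart (phi : R -> R[i]) (t : R) := cInt rho (I `&` [set s | s < t]) phi.

Lemma cintegrableS (D E : set R) phi : measurable D -> measurable E -> D `<=` E ->
  cintegrable rho E phi -> cintegrable rho D phi.
Proof. by move=> mD mE DE [? ?]; split; exact: integrableS DE _. Qed.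

Lemma cpart_bound phi : cintegrable rho I phi ->
  exists B, forall t, csq (cpart phi) t <= B.
Proof.
move=> [pr pi]; exists ((\int[rho]_(t in I) `|cre phi t|) ^+ 2 + (\int[rho]_(t in I) `|cim phi t|) ^+ 2).
move=> t; have mA : measurable (I `&` [set s | s < t]).
  by apply: measurableI => //; exact: measurable_lt_set.
apply: lerD; rewrite -[leLHS]real_normK ?num_real//= lerXn2r ?nnegrE//.
- exact: Rintegral_ge0.
- exact: Rintegral_subset_bound.
- exact: Rintegral_ge0.
- exact: Rintegral_subset_bound.
Qed.

Lemma cpart_inc phi x y : cintegrable rho I phi -> I x -> I y -> x <= y ->
  cpart phi y - cpart phi x = cInt rho [set t | x <= t < y] phi.
Proof.
move=> [pr pi] Ix Iy xy.
have E : I `&` [set s | s < y] = (I `&` [set s | s < x]) `|` [set t | x <= t < y].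
  apply/seteqP; split => t /=.
    by move=> [It ty]; case: (ltP t x) => tx; [left|right; apply/andP].
  move=> [[It tx]|/andP[xt ty]]; first by split=> //; exact: lt_le_trans xy.
  by split=> //; apply: (Itv_itv Ix Iy); rewrite xt ltW.
have H (h : R -> R) : rho.-integrable I (EFin \o h) ->
    \int[rho]_(s in I `&` [set s | s < y]) h s - \int[rho]_(s in I `&` [set s | s < x]) h s =
    \int[rho]_(s in [set t | x <= t < y]) h s.
  move=> jh; rewrite E Rintegral_setU.
  - by rewrite addrAC subrr add0r.
  - by apply: measurableI => //; exact: measurable_lt_set.
  - exact: measurable_co.
  - rewrite -E; apply: integrableS jh => //.
    by apply: measurableI => //; exact: measurable_lt_set.
  - by apply/disj_set2P; apply/seteqP; split => // t [/= [_ tx] /andP[]]; rewrite leNgt tx.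
by apply: complex_eqP; rewrite ?cReD ?cImD ?cReN ?cImN /=; exact: H.
Qed.

Lemma cpart_cprim sgp sgm chp chm phi : cintegrable rho I phi ->
  cprim I 5 (nu5 rho sgp sgm chp chm) (cpart phi)
    (dens5 (fun=> 0) (fun=> 0) (fun=> 0) (fun=> 0) phi).
Proof.
move=> jphi; have [pr pi] := jphi.
have jl : cloc_int I rho phi.
  by split=> x y Ix Iy; [apply: integrableS pr|apply: integrableS pi] => //;
   [exact: measurable_cc|by move=> t; exact: Itv_itv|exact: measurable_cc|by move=> t; exact: Itv_itv].
have J := cloc_int_dens5 (cloc_int0 I sgp) (cloc_int0 I sgm) (cloc_int0 I chp) (cloc_int0 I chm) jl.
have I0 (mu : {measure set R -> \bar R}) x y : \int[mu]_(t in [set t | x <= t < y]) (0 : R) = 0.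
  by rewrite Rintegral_cst ?mul0r//; exact: measurable_co.
split; split; [by move=> j; exact: (J j).1| |by move=> j; exact: (J j).2|] => x y Ix Iy xy.
  rewrite !big_ord_recl big_ord0 /nu5 /dens5 /= {1 2 3 4}/cre /= !I0 !add0r addr0.
  by have /(congr1 (@complex.Re R)) := cpart_inc jphi Ix Iy xy; rewrite cReD cReN.
rewrite !big_ord_recl big_ord0 /nu5 /dens5 /= {1 2 3 4}/cim /= !I0 !add0r addr0.
by have /(congr1 (@complex.Im R)) := cpart_inc jphi Ix Iy xy; rewrite cImD cImN.
Qed.

End fixed_measure.
End square_integrable.

(** * The Green operator *)

Section green_operator.
Context {R : realType} (a b : \bar R) (rho : {sigma_finite_measure set R -> \bar R}).
Notation I := (Itv a b).
Notation L2 := (L2 a b rho).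
Notation cpart := (cpart a b rho).
Let mI : measurable I := measurable_Itv a b.

(** Exchanging the order of integration turns s < t into t <= s, so the closed counterpart of
    [cpart] appears; the two differ by the atom at t. *)
Definition cpart_le (phi : R -> R[i]) (t : R) := cInt rho (I `&` [set s | s <= t]) phi.

Let rlt (h : R -> R) (t : R) := \int[rho]_(s in I `&` [set s | s < t]) h s.
Let rle (h : R -> R) (t : R) := \int[rho]_(s in I `&` [set s | s <= t]) h s.

Let measurable_rlt h : rho.-integrable I (EFin \o h) -> measurable_fun I (rlt h).
Proof.
by move=> jh; exact: measurable_funTS (measurable_fun_Rintegral_section mI measurable_lt_rel jh).
Qed.

Let measurable_rle h : rho.-integrable I (EFin \o h) -> measurable_fun I (rle h).
Proof.
move=> jh; have mE : measurable [set p : R * R | p.2 <= p.1].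
  rewrite -[X in measurable X]setTI.
  exact: (@measurable_swap _ _ R R measurableT _ measurable_le_rel).
exact: measurable_funTS (measurable_fun_Rintegral_section mI mE jh).
Qed.

Let integrable_rlt f h : rho.-integrable I (EFin \o f) -> rho.-integrable I (EFin \o h) ->
  rho.-integrable I (EFin \o (fun t => f t * rlt h t)).
Proof.
move=> jf jh; apply: (integrableM_bounded mI jf (measurable_rlt jh)) => t _.
apply: (Rintegral_subset_bound mI _ _ jh); last exact: subIsetl.
by apply: measurableI => //; exact: measurable_lt_set.
Qed.

Let integrable_rle f h : rho.-integrable I (EFin \o f) -> rho.-integrable I (EFin \o h) ->
  rho.-integrable I (EFin \o (fun t => f t * rle h t)).
Proof.
move=> jf jh; apply: (integrableM_bounded mI jf (measurable_rle jh)) => t _.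
apply: (Rintegral_subset_bound mI _ _ jh); last exact: subIsetl.
by apply: measurableI => //; exact: measurable_le_set.
Qed.

Lemma cintegrable_cpart phi psi : cintegrable rho I phi -> cintegrable rho I psi ->
  cintegrable rho I (fun t => phi t * cpart psi t).
Proof.
move=> [fr fi] [gr gi]; split.
  have := integrableD_EFin mI (integrable_rlt fr gr) (integrableZ_EFin (-1) mI (integrable_rlt fi gi)).
  by apply: eq_integrable => // t _ /=; rewrite /cre cReM mulN1r.
have := integrableD_EFin mI (integrable_rlt fr gi) (integrable_rlt fi gr).
by apply: eq_integrable => // t _ /=; rewrite /cim cImM.
Qed.

Lemma cintegrable_cpart_le phi psi : cintegrable rho I phi -> cintegrable rho I psi ->
  cintegrable rho I (fun t => phi t * cpart_le psi t).
Proof.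
move=> [fr fi] [gr gi]; split.
  have := integrableD_EFin mI (integrable_rle fr gr) (integrableZ_EFin (-1) mI (integrable_rle fi gi)).
  by apply: eq_integrable => // t _ /=; rewrite /cre cReM mulN1r.
have := integrableD_EFin mI (integrable_rle fr gi) (integrable_rle fi gr).
by apply: eq_integrable => // t _ /=; rewrite /cim cImM.
Qed.

Lemma cInt_by_parts phi psi : cintegrable rho I phi -> cintegrable rho I psi ->
  cInt rho I (fun t => phi t * cpart psi t) + cInt rho I (fun t => psi t * cpart_le phi t) =
  cInt rho I phi * cInt rho I psi.
Proof.
move=> [fr fi] [gr gi].
have S f h : rho.-integrable I (EFin \o f) -> rho.-integrable I (EFin \o h) ->
    \int[rho]_(t in I) (f t * rlt h t) =
    \int[rho]_(t in I) f t * \int[rho]_(t in I) h t - \int[rho]_(t in I) (h t * rle f t).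
  by move=> jf jh; rewrite -(Rintegral_by_parts mI jf jh) addrK.
apply: complex_eqP; rewrite ?cReD ?cImD ?cReM ?cImM /=.
  rewrite (_ : Rintegral _ _ (cre (fun t => phi t * cpart psi t)) =
    \int[rho]_(t in I) (cre phi t * rlt (cre psi) t - cim phi t * rlt (cim psi) t)); last first.
    by apply: eq_Rintegral => t _; rewrite /cre cReM.
  rewrite (_ : Rintegral _ _ (cre (fun t => psi t * cpart_le phi t)) =
    \int[rho]_(t in I) (cre psi t * rle (cre phi) t - cim psi t * rle (cim phi) t)); last first.
    by apply: eq_Rintegral => t _; rewrite /cre cReM.
  rewrite !RintegralB//; [|exact: integrable_rle|exact: integrable_rle|exact: integrable_rlt|exact: integrable_rlt].
  rewrite !S//; ring.
rewrite (_ : Rintegral _ _ (cim (fun t => phi t * cpart psi t)) =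
  \int[rho]_(t in I) (cre phi t * rlt (cim psi) t + cim phi t * rlt (cre psi) t)); last first.
  by apply: eq_Rintegral => t _; rewrite /cim cImM.
rewrite (_ : Rintegral _ _ (cim (fun t => psi t * cpart_le phi t)) =
  \int[rho]_(t in I) (cre psi t * rle (cim phi) t + cim psi t * rle (cre phi) t)); last first.
  by apply: eq_Rintegral => t _; rewrite /cim cImM.
rewrite !RintegralD//; [|exact: integrable_rle|exact: integrable_rle|exact: integrable_rlt|exact: integrable_rlt].
rewrite !S//; ring.
Qed.

Lemma cpart_leE phi t : cintegrable rho I phi -> I t ->
  cpart_le phi t = cpart phi t + phi t * (fine (rho [set t]))%:C%C.
Proof.
move=> [fr fi] It.
have E : I `&` [set s | s <= t] = (I `&` [set s | s < t]) `|` [set t].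
  apply/seteqP; split => s /=.
    by move=> [Is]; rewrite le_eqVlt => /predU1P[->|st]; [right|left].
  by move=> [[Is /ltW]//|->].
have H (h : R -> R) : rho.-integrable I (EFin \o h) ->
    rle h t = rlt h t + h t * fine (rho [set t]).
  move=> jh; rewrite /rle E Rintegral_setU ?Rintegral_singleton//.
  - by apply: measurableI => //; exact: measurable_lt_set.
  - rewrite -E; apply: integrableS jh => //.
    by apply: measurableI => //; exact: measurable_le_set.
  - by apply/disj_set2P; apply/seteqP; split => // s [/= [_ st] se]; rewrite se ltxx in st.
apply: complex_eqP; rewrite ?cReD ?cImD ?cReM ?cImM /= ?mulr0 ?subr0 ?add0r; exact: H.
Qed.

Definition green (u1 u2 r : R -> R[i]) (t : R) : R[i] :=
  u1 t * cpart (fun s => u2 s * r s) t - u2 t * cpart (fun s => u1 s * r s) t.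

Lemma cpart_L2_mul u phi : L2 u -> cintegrable rho I phi -> L2 (fun t => u t * cpart phi t).
Proof.
move=> Lu jphi; have [fr fi] := jphi; have [B hB] := cpart_bound jphi.
by apply: (L2_bounded_mul Lu) => [||t _]; [exact: measurable_rlt|exact: measurable_rlt|exact: hB].
Qed.

Lemma L2_green u1 u2 r : L2 u1 -> L2 u2 -> L2 r -> L2 (green u1 u2 r).
Proof.
move=> L1 L2' Lr.
have := L2_lin 1 (-1) (cpart_L2_mul L1 (L2_prod L2' Lr)) (cpart_L2_mul L2' (L2_prod L1 Lr)).
rewrite (_ : (fun t => 1 * _ + _) = green u1 u2 r)//.
by apply/funext => t; rewrite /green mul1r mulN1r.
Qed.

(* The kernel u1(x) u2(y) - u2(x) u1(y) is antisymmetric, so exchanging the order of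
   integration over y < x only produces terms containing cInt (u_i g). *)
Lemma green_sym u1 u2 g r : L2 u1 -> L2 u2 -> L2 g -> L2 r ->
  cInt rho I (fun t => u1 t * g t) = 0 -> cInt rho I (fun t => u2 t * g t) = 0 ->
  cInt rho I (fun t => g t * green u1 u2 r t) = cInt rho I (fun t => r t * green u1 u2 g t).
Proof.
move=> L1 L2' Lg Lr z1 z2.
have j1 := L2_prod L1 Lg; have j2 := L2_prod L2' Lg.
have k1 := L2_prod L1 Lr; have k2 := L2_prod L2' Lr.
rewrite (@eq_cInt _ _ I _ (fun t => 1 * ((u1 t * g t) * cpart (fun s => u2 s * r s) t) +
    (-1) * ((u2 t * g t) * cpart (fun s => u1 s * r s) t))); last first.
  by move=> t _; rewrite /green; ring.
rewrite cInt_lin; [|exact: cintegrable_cpart|exact: cintegrable_cpart].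
have /eqP := cInt_by_parts j1 k2; rewrite z1 mul0r addr_eq0 => /eqP ->.
have /eqP := cInt_by_parts j2 k1; rewrite z2 mul0r addr_eq0 => /eqP ->.
rewrite -[RHS](@eq_cInt _ _ I (fun t => 1 * ((u1 t * r t) * cpart_le (fun s => u2 s * g s) t) +
    (-1) * ((u2 t * r t) * cpart_le (fun s => u1 s * g s) t))); last first.
  (* The two atom terms, u1 r u2 g and u2 r u1 g times the mass of {t}, cancel: the kernel vanishes
     on the diagonal. *)
  by move=> t It; rewrite !cpart_leE// /green; ring.
rewrite cInt_lin; [|exact: cintegrable_cpart_le|exact: cintegrable_cpart_le].
by rewrite !mul1r !mulN1r opprK addrC.
Qed.

Context (sgp sgm chp chm : {measure set R -> \bar R}).
Notation sys := (sys rho sgp sgm chp chm).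
Notation nu := (nu5 rho sgp sgm chp chm).
Notation is_tau := (is_tau a b rho sgp sgm chp chm).

(** By (H4) and mutual singularity, every point charged by sigma is null for [chp], [chm] and [rho].
    A union of null points is null only if countable, which [no_common_atoms] provides, applied
    separately to the atoms of [sgp] and of [sgm]. *)
Lemma null_jumps_Itv : locfin a b rho -> signed_locfin a b chp chm ->
  signed_locfin a b sgp sgm ->
  (forall x, Itv a b x ->
      spt sgp sgm x * spt chp chm x = 0 /\ spt sgp sgm x * fine (rho [set x]) = 0) ->
  null_jumps rho sgp sgm chp chm I.
Proof.
move=> frho fchi fsig H4 j x y /andP[j1 j5] Ix Iy.
have [fsp fsm _] := fsig.
have mD := measurable_cc x y.
have DI t : x <= t <= y -> I t by exact: Itv_itv.
have nuj0 t : I t -> spt sgp sgm t <> 0 -> nu j [set t] = 0%E.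
  move=> It /eqP st; have [c0 r0] := H4 t It.
  have [cp cm] := singular_atom fchi It ltac:(by move/eqP: c0; rewrite mulf_eq0 (negPf st) => /eqP).
  have fr : rho [set t] \is a fin_num.
    have := locfin_loc_fin frho It It; rewrite ge0_fin_numE//; apply: le_lt_trans.
    apply: le_measure; rewrite ?inE//; first exact: measurable_cc.
    by move=> _ ->; rewrite /= lexx.
  have rt : rho [set t] = 0%E.
    by move/eqP: r0; rewrite mulf_eq0 (negPf st) fine_eq0// => /eqP.
  by move: j j1 j5 => [|[|[|[|[|]]]]].
have key (mu : {measure set R -> \bar R}) : locfin a b mu ->
    (forall t, I t -> mu [set t] <> 0%E -> spt sgp sgm t <> 0) ->
    (nu j).-negligible ([set t | x <= t <= y] `&` [set t | mu [set t] <> 0%E]).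
  move=> fmu Hmu; apply: no_common_atoms => //.
    exact: (locfin_loc_fin fmu).
  move=> t xty; case: (pselect (mu [set t] = 0%E)) => m0; [by left|right].
  by apply: nuj0; [exact: DI|apply: Hmu => //; exact: DI].
have np := key sgp fsp (fun t It n s0 => n (singular_atom fsig It s0).1).
have nm := key sgm fsm (fun t It n s0 => n (singular_atom fsig It s0).2).
apply: negligibleS (negligibleU np nm) => t [xty st].
case: (pselect (sgp [set t] = 0%E)) => p0; last by left.
right; split=> // m0; apply: st; by rewrite /spt p0 m0 /= subrr.
Qed.

Hypothesis nu_fin : forall j, loc_fin I (nu j).
Hypothesis nj : null_jumps rho sgp sgm chp chm I.
Context (z : R[i]) (u1 p1 u2 p2 : R -> R[i]).
Hypothesis H1 : sys I u1 p1 (fun t => z * u1 t).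
Hypothesis H2 : sys I u2 p2 (fun t => z * u2 t).
Hypothesis W : forall t, I t -> u1 t * p2 t - u2 t * p1 t = 1.
Hypothesis L1 : L2 u1.
Hypothesis L2' : L2 u2.

Lemma green_sys r : L2 r -> exists p, sys I (green u1 u2 r) p (fun t => r t + z * green u1 u2 r t).
Proof.
move=> Lr; eexists; apply: (variation_of_constants (@Itv_itv R a b) nu_fin nj H1 H2 W).
- exact: cpart_cprim (L2_prod L1 Lr).
- exact: cpart_cprim (L2_prod L2' Lr).
- exact: (L2_cloc_int (nu_fin 4) Lr).
Qed.

(** The difference f - K r satisfies the homogeneous system, so it lies in the span of u1 and u2. *)
Lemma tau_green f g r : is_tau f g -> L2 r ->
  ae_eqc rho I (fun t => g t - z * f t) r -> (exists c, I c) ->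
  exists d1 d2, forall t, I t -> f t = green u1 u2 r t + (d1 * u1 t + d2 * u2 t).
Proof.
move=> /(is_tau_sys nu_fin)[p [k [[Hf Hp] gk]]] Lr fgr [c Ic].
have [q Hq] := green_sys Lr.
have jr := L2_cloc_int (nu_fin 4) Lr.
have jf := cloc_int_prim (@Itv_itv R a b) nu_fin 4 Hf.
have jp j := cloc_int_prim (@Itv_itv R a b) nu_fin j Hp.
have jff j := cloc_int_prim (@Itv_itv R a b) nu_fin j Hf.
(* The density k agrees with g, and g - z f with r, only almost everywhere; this suffices because a
   primitive does not see null sets of its measure. *)
have Hf' : sys I f p (fun t => r t + z * f t).
  split=> //; apply: (cprim_ae Hp).
    apply: (cloc_int_dens5 (cloc_int0 I _) (cloc_int0 I _) (jff 2) (cloc_intN (jff 3))).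
    apply: (cloc_int_ext (@Itv_itv R a b) (cloc_int_lin (-1) (- z) jr jf)) => t _; ring.
  move=> j x y j5 Ix Iy; case: (ltnP j 4) => j4.
    apply: negligibleS (negligible_set0 _) => t /= [_]; apply.
    by move: j j4 {j5} => [|[|[|[|//]]]].
  have -> : j = 4%N by apply/eqP; rewrite eqn_leq j4 -ltnS j5.
  apply: negligibleS (negligibleU fgr gk) => t [xty ne].
  have It : I t := Itv_itv Ix Iy xty.
  case: (pselect (g t = k t)) => [gkt|ngk]; last by right.
  left; split=> //= E; apply: ne; rewrite /dens5 /= -E gkt; ring.
have Hw : sys I (fun t => 1 * f t + (-1) * green u1 u2 r t) (fun t => 1 * p t + (-1) * q t)
    (fun t => z * (1 * f t + (-1) * green u1 u2 r t)).
  by apply: (sys_ext (@Itv_itv R a b) (sys_lin (@Itv_itv R a b) 1 (-1) Hf' Hq)) => // t _; ring.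
have span := sys_span (@Itv_itv R a b) nu_fin nj Ic H1 H2 (W Ic) Hw.
have [d1 [d2 Hd]] : exists d1 d2, forall t, I t ->
    1 * f t + (-1) * green u1 u2 r t = d1 * u1 t + d2 * u2 t.
  by eexists; eexists => t It; exact: (span t It).1.
exists d1, d2 => t It; rewrite -Hd//; ring.
Qed.

End green_operator.

(** * The resolvent *)

Section resolvent_section.
Context {R : realType} (a b : \bar R) (rho : {sigma_finite_measure set R -> \bar R}).
Notation I := (Itv a b).
Notation L2 := (L2 a b rho).
Notation ae := (ae_eqc rho I).
Notation inner := (inner a b rho).
Let mI : measurable I := measurable_Itv a b.

Lemma ae_refl (f : R -> R[i]) : ae f f.
Proof. by apply: negligibleS (negligible_set0 _) => t [_]; apply. Qed.

Lemma ae_pointwise (f g : R -> R[i]) : (forall t, I t -> f t = g t) -> ae f g.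
Proof. by move=> E; apply: negligibleS (negligible_set0 _) => t [It] /=; apply; exact: E. Qed.

Lemma ae_sym (f g : R -> R[i]) : ae f g -> ae g f.
Proof. by apply: negligibleS => t [It ne]; split=> //= E; apply: ne. Qed.

Lemma ae_map2 (F : R -> R[i] -> R[i] -> R[i]) (f f' g g' : R -> R[i]) : ae f f' -> ae g g' ->
  ae (fun t => F t (f t) (g t)) (fun t => F t (f' t) (g' t)).
Proof.
move=> h1 h2; apply: negligibleS (negligibleU h1 h2) => t [It ne].
case: (pselect (f t = f' t)) => e; last by left.
by right; split=> //= e'; apply: ne; rewrite /= e e'.
Qed.

Lemma ae_trans (f g h : R -> R[i]) : ae f g -> ae g h -> ae f h.
Proof.
move=> h1 h2; apply: negligibleS (negligibleU h1 h2) => t [It ne].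
case: (pselect (f t = g t)) => e; last by left.
by right; split=> //= e'; apply: ne; rewrite /= e e'.
Qed.

Lemma cintegrable_inner f g : L2 f -> L2 g -> cintegrable rho I (fun t => f t * cconj (g t)).
Proof. by move=> Lf Lg; exact: (L2_prod Lf (L2_conj Lg)). Qed.

Lemma inner_lin f g h (c d : R[i]) : L2 f -> L2 g -> L2 h ->
  inner (fun t => c * f t + d * g t) h = c * inner f h + d * inner g h.
Proof.
move=> Lf Lg Lh; rewrite /inner -cInt_lin; [|exact: cintegrable_inner|exact: cintegrable_inner].
by apply: eq_cInt => t _; ring.
Qed.

Lemma inner_ael f f' h : L2 f -> L2 f' -> L2 h -> ae f f' -> inner f h = inner f' h.
Proof.
move=> Lf Lf' Lh E; apply: cInt_ae; [exact: cintegrable_inner|exact: cintegrable_inner|].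
exact: (ae_map2 (fun t x _ => x * cconj (h t)) E E).
Qed.

Section self_adjoint.
Context (S : (R -> R[i]) -> (R -> R[i]) -> Prop).
Hypothesis HS : forall f g, S f g <-> adjoint a b rho S f g.

Lemma self_adjoint_L2 f g : S f g -> L2 f /\ L2 g.
Proof. by move=> /HS[]. Qed.

(** [S] relates representatives rather than classes. Membership in the adjoint is tested by
    integrals only, so S = S^* makes it stable under changes on null sets. *)
Lemma self_adjoint_ae f g f' g' : S f g -> L2 f' -> L2 g' -> ae f f' -> ae g g' -> S f' g'.
Proof.
move=> Sfg Lf' Lg' ff gg; apply/HS; split=> // h k Shk.
have [Lf Lg] := self_adjoint_L2 Sfg; have [Lh Lk] := self_adjoint_L2 Shk.
have [_ _ /(_ h k Shk)] := (HS f g).1 Sfg.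
by rewrite (inner_ael Lf Lf' Lk ff) (inner_ael Lg Lg' Lh gg).
Qed.

(** Linearity is not part of the definition of a relation here; [S] inherits it from being an
    adjoint. *)
Lemma self_adjoint_lin f1 g1 f2 g2 (c d : R[i]) : S f1 g1 -> S f2 g2 ->
  S (fun t => c * f1 t + d * f2 t) (fun t => c * g1 t + d * g2 t).
Proof.
move=> S1 S2; have [L1 M1] := self_adjoint_L2 S1; have [L2' M2] := self_adjoint_L2 S2.
apply/HS; split; [exact: L2_lin|exact: L2_lin|move=> h k Shk].
have [Lh Lk] := self_adjoint_L2 Shk.
have [_ _ /(_ h k Shk) E1] := (HS f1 g1).1 S1.
have [_ _ /(_ h k Shk) E2] := (HS f2 g2).1 S2.
by rewrite !inner_lin// E1 E2.
Qed.

End self_adjoint.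

Lemma cpart_lin (phi psi : R -> R[i]) (c d : R[i]) t :
  cintegrable rho I phi -> cintegrable rho I psi ->
  cpart a b rho (fun s => c * phi s + d * psi s) t = c * cpart a b rho phi t + d * cpart a b rho psi t.
Proof.
have mA : measurable (I `&` [set s | s < t]).
  by apply: measurableI => //; exact: measurable_lt_set.
move=> j1 j2; apply: cInt_lin_on => //; [apply: cintegrableS j1|apply: cintegrableS j2] => //;
  exact: subIsetl.
Qed.

Lemma green_lin u1 u2 f g (c d : R[i]) t : L2 u1 -> L2 u2 -> L2 f -> L2 g ->
  green a b rho u1 u2 (fun s => c * f s + d * g s) t =
  c * green a b rho u1 u2 f t + d * green a b rho u1 u2 g t.
Proof.
move=> L1 L2' Lf Lg; rewrite /green.
have E (u : R -> R[i]) : L2 u -> cpart a b rho (fun s => u s * (c * f s + d * g s)) t =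
    c * cpart a b rho (fun s => u s * f s) t + d * cpart a b rho (fun s => u s * g s) t.
  move=> Lu; rewrite -cpart_lin; [|exact: L2_prod|exact: L2_prod].
  by apply: eq_cInt => s _; ring.
rewrite !E//; ring.
Qed.

Context (sgp sgm chp chm : {measure set R -> \bar R}).
Notation sys := (sys rho sgp sgm chp chm).
Notation nu := (nu5 rho sgp sgm chp chm).
Notation is_tau := (is_tau a b rho sgp sgm chp chm).
Hypothesis nu_fin : forall j, loc_fin I (nu j).
Hypothesis nj : null_jumps rho sgp sgm chp chm I.
Context (c0 : R) (Ic0 : I c0).
Context (z : R[i]) (u1 p1 u2 p2 : R -> R[i]).
Hypothesis H1 : sys I u1 p1 (fun t => z * u1 t).
Hypothesis H2 : sys I u2 p2 (fun t => z * u2 t).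
Hypothesis W : forall t, I t -> u1 t * p2 t - u2 t * p1 t = 1.
Hypothesis L1 : L2 u1.
Hypothesis L2' : L2 u2.
Context (S : (R -> R[i]) -> (R -> R[i]) -> Prop).
Hypothesis HS : self_adjoint_restriction a b rho sgp sgm chp chm S.
Hypothesis hz : resolvent_set a b rho S z.
Notation K := (green a b rho u1 u2).

Lemma is_tau_measurable f g : is_tau f g -> measurable_fun I (cre f) /\ measurable_fun I (cim f).
Proof.
move=> /(is_tau_sys nu_fin)[p [k [[Hf _] _]]].
exact: (cloc_int_measurable (cloc_int_prim (@Itv_itv R a b) nu_fin 0 Hf)).
Qed.

Lemma is_tau_conj f g : is_tau f g -> is_tau (fun t => cconj (f t)) (fun t => cconj (g t)).
Proof.
move=> /(is_tau_sys nu_fin)[p [k [Hs gk]]].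
apply: (sys_is_tau nu_fin Ic0 (sys_conj Hs)).
exact: (ae_map2 (fun _ x _ => cconj x) gk gk).
Qed.

Let sol (d1 d2 : R[i]) (f : R -> R[i]) (t : R) : R[i] := K f t + (d1 * u1 t + d2 * u2 t).

(** Membership of (h, f + z h) in [S] means that h represents R_z f; thus R_z f = K f + d1 u1 + d2
    u2. *)
Let in_S f d1 d2 := S (sol d1 d2 f) (fun t => f t + z * sol d1 d2 f t).

Let L2_sol f d1 d2 : L2 f -> L2 (sol d1 d2 f).
Proof.
move=> Lf; have := L2_lin 1 1 (L2_green L1 L2' Lf) (L2_lin d1 d2 L1 L2').
by congr L2; apply/funext => t; rewrite !mul1r.
Qed.

Let L2_addZ f g : L2 f -> L2 g -> L2 (fun t => f t + z * g t).
Proof.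
move=> Lf Lg; have := L2_lin 1 z Lf Lg.
by congr L2; apply/funext => t; rewrite mul1r.
Qed.

(** For each f separately; how [d1] and [d2] depend on f is settled in [resolvent_coefficients]. *)
Lemma resolvent_sol f : L2 f -> exists d1 d2, in_S f d1 d2.
Proof.
move=> Lf; have [h [g [Shg E]]] := hz.1 f Lf.
have [Lh Lg [f' hf' tf']] := HS.1 h g Shg.
have E' : ae (fun t => g t - z * f' t) f.
  apply: ae_trans E; exact: (ae_map2 (fun t x y => x - z * y) (ae_refl g) (ae_sym hf')).
have [d1 [d2 Hd]] := tau_green nu_fin nj H1 H2 W L1 L2' tf' Lf E' (ex_intro _ c0 Ic0).
exists d1, d2; have hs : ae h (sol d1 d2 f) by apply: ae_trans hf' _; exact: ae_pointwise.
apply: (self_adjoint_ae HS.2 Shg) => //; first exact: L2_sol.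
- by apply: L2_addZ => //; exact: L2_sol.
- apply: (@ae_trans _ (fun t => (g t - z * h t) + z * h t)).
    by apply: ae_pointwise => t _; ring.
  exact: (ae_map2 (fun t x y => x + z * y) E hs).
Qed.

Lemma in_S_lin f d1 d2 g e1 e2 (c d : R[i]) : L2 f -> L2 g -> in_S f d1 d2 -> in_S g e1 e2 ->
  in_S (fun t => c * f t + d * g t) (c * d1 + d * e1) (c * d2 + d * e2).
Proof.
move=> Lf Lg Sf Sg.
have Lfg := L2_lin c d Lf Lg.
apply: (self_adjoint_ae HS.2 (self_adjoint_lin HS.2 c d Sf Sg)); first exact: L2_sol.
- by apply: L2_addZ => //; exact: L2_sol.
- apply: ae_pointwise => t _; rewrite /sol green_lin//; ring.
- apply: ae_pointwise => t _; rewrite /sol green_lin//; ring.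
Qed.

(* Such f are orthogonal to the solutions, so that (K f, f + z K f) lies in the
   adjoint of every restriction of Tmax. *)
Lemma in_S_orth f : L2 f -> cInt rho I (fun t => u1 t * f t) = 0 ->
  cInt rho I (fun t => u2 t * f t) = 0 -> in_S f 0 0.
Proof.
move=> Lf z1 z2; have LK := L2_green L1 L2' Lf.
have sol0 : sol 0 0 f = K f by apply/funext => t; rewrite /sol; ring.
rewrite /in_S sol0.
have LfK := L2_addZ Lf LK.
apply/HS.2; split=> // h k Shk.
have [Lh Lk [h' hh' th']] := HS.1 h k Shk.
have [mr mi] := is_tau_measurable th'.
have Lh' := L2_ae Lh mr mi hh'.
have Lch := L2_conj Lh'; have Lck := L2_conj Lk.
(* The conjugate of h' solves (tau - z) v = r, hence equals K r + d1 u1 + d2 u2. Inserting k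
   conjugate = r + z (h' conjugate), the adjoint identity reduces to: the integral of f times the
   conjugate of h' equals that of r K f. The solutions drop out by [z1] and [z2], and [green_sym]
   compares f K r with r K f. *)
pose r t := 1 * cconj (k t) + (- z) * cconj (h' t).
have Lr : L2 r := L2_lin 1 (- z) Lck Lch.
have E : ae (fun t => cconj (k t) - z * cconj (h' t)) r.
  by apply: ae_pointwise => t _; rewrite /r; ring.
have [d1 [d2 Hd]] := tau_green nu_fin nj H1 H2 W L1 L2' (is_tau_conj th') Lr E (ex_intro _ c0 Ic0).
have LKr := L2_green L1 L2' Lr.
transitivity (1 * cInt rho I (fun t => f t * cconj (h' t)) + z * cInt rho I (fun t => K f t * cconj (h' t))).
  rewrite -cInt_lin; [|exact: cintegrable_inner|exact: cintegrable_inner].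
  apply: cInt_ae; [exact: cintegrable_inner| |].
    by apply: cintegrable_lin; exact: cintegrable_inner.
  apply: (@ae_trans _ (fun t => (f t + z * K f t) * cconj (h' t))).
    exact: (ae_map2 (fun t x _ => (f t + z * K f t) * cconj x) hh' hh').
  by apply: ae_pointwise => t _; ring.
transitivity (1 * cInt rho I (fun t => r t * K f t) + z * cInt rho I (fun t => K f t * cconj (h' t))); last first.
  rewrite -cInt_lin; [|exact: L2_prod|exact: cintegrable_inner].
  by apply: eq_cInt => t _; rewrite /r; ring.
congr (_ * _ + _); rewrite -(green_sym L1 L2' Lf Lr z1 z2).
rewrite (@eq_cInt _ _ I _ (fun t => 1 * (f t * K r t) + 1 * (d1 * (u1 t * f t) + d2 * (u2 t * f t)))); last first.
  by move=> t It; rewrite Hd//; ring.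
rewrite !cInt_lin ?z1 ?z2; [ring|exact: L2_prod|exact: L2_prod|exact: L2_prod|].
by apply: cintegrable_lin; exact: L2_prod.
Qed.

(** The element [e] has Phi e = 1 when [Phi] is not identically 0 on [V], and is 0 otherwise; the
    equation in the conclusion covers both cases without a distinction later on. *)
Lemma normalize (V : (R -> R[i]) -> Prop) (Phi : (R -> R[i]) -> R[i]) :
  V (fun=> 0) -> (forall f, V f -> L2 f) ->
  (forall f (c : R[i]), V f -> V (fun t => c * f t) /\ Phi (fun t => c * f t) = c * Phi f) ->
  exists2 e, V e & forall f, V f -> Phi f = Phi f * Phi e.
Proof.
move=> V0 VL VZ; case: (pselect (exists2 f, V f & Phi f <> 0)) => [[f Vf nf]|n].
  have [Ve Pe] := VZ f (Phi f)^-1 Vf.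
  exists (fun t => (Phi f)^-1 * f t) => // g _.
  by rewrite Pe mulVf ?mulr1//; exact/eqP.
exists (fun=> 0) => // f Vf; rewrite (_ : Phi f = 0) ?mul0r//.
by apply: contrapT => nf; apply: n; exists f.
Qed.

(** Two-step elimination: f1 is dual to the functional of u1, and f2 is dual to that of u2 within
    the kernel of the first. Subtracting multiples of f1 and f2 from f leaves [g0] in both kernels,
    where R_z = K by [in_S_orth]. *)
Lemma resolvent_coefficients : exists m11 m12 m21 m22 : R[i], forall f, L2 f ->
  in_S f (m11 * cInt rho I (fun t => u1 t * f t) + m12 * cInt rho I (fun t => u2 t * f t))
         (m21 * cInt rho I (fun t => u1 t * f t) + m22 * cInt rho I (fun t => u2 t * f t)).
Proof.
pose Phi (u f : R -> R[i]) := cInt rho I (fun t => u t * f t).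
have PhiL u f g c d : L2 u -> L2 f -> L2 g ->
    Phi u (fun t => c * f t + d * g t) = c * Phi u f + d * Phi u g.
  move=> Lu Lf Lg; rewrite /Phi -cInt_lin; [|exact: L2_prod|exact: L2_prod].
  by apply: eq_cInt => t _; ring.
have L20 := L2_0 a b rho.
have PhiZ u f c : L2 u -> L2 f -> Phi u (fun t => c * f t) = c * Phi u f.
  move=> Lu Lf; have := PhiL u f f c 0 Lu Lf Lf; rewrite mul0r addr0 => <-.
  by congr Phi; apply/funext => t; rewrite mul0r addr0.
have LZ f (c : R[i]) : L2 f -> L2 (fun t => c * f t).
  move=> Lf; have := L2_lin c 0 Lf Lf; congr L2; apply/funext => t.
  by rewrite mul0r addr0.
have [f1 Lf1 P1] := @normalize L2 (Phi u1) L20 (fun _ x => x)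
  (fun f c Lf => conj (LZ f c Lf) (PhiZ u1 f c L1 Lf)).
have Phi0 u : L2 u -> Phi u (fun=> 0) = 0.
  move=> Lu; have E := PhiZ u _ 0 Lu L20; rewrite [RHS]mul0r in E; rewrite -[RHS]E.
  by congr Phi; apply/funext => t; rewrite mulr0.
have [f2 [Lf2 Q2] P2] := @normalize (fun f => L2 f /\ Phi u1 f = 0) (Phi u2)
  (conj L20 (Phi0 u1 L1)) (fun _ x => x.1)
  (fun f c Vf => conj (conj (LZ f c Vf.1) (etrans (PhiZ u1 f c L1 Vf.1)
      (etrans (congr1 ( *%R c) Vf.2) (mulr0 c)))) (PhiZ u2 f c L2' Vf.1)).
have [d11 [d12 S1]] := resolvent_sol Lf1.
have [d21 [d22 S2]] := resolvent_sol Lf2.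
(* From f = g0 + Phi1(f) f1 + Phi2(g) f2 with Phi2(g) = Phi2(f) - Phi1(f) Phi2(f1), the coefficient
   of u1 is Phi1(f) d11 + Phi2(g) d21 and that of u2 is Phi1(f) d12 + Phi2(g) d22; the witnesses are
   these sorted by Phi1(f) and Phi2(f). *)
exists (d11 - Phi u2 f1 * d21), d21, (d12 - Phi u2 f1 * d22), d22 => f Lf.
rewrite -!/(Phi _ _).
pose g t := 1 * f t + (- Phi u1 f) * f1 t.
have Lg : L2 g by exact: L2_lin.
have g1 : Phi u1 g = 0.
  by rewrite /g PhiL// mul1r mulNr -P1// subrr.
have g2 : Phi u2 g = Phi u2 f - Phi u1 f * Phi u2 f1.
  by rewrite /g PhiL// mul1r mulNr.
pose g0 t := 1 * g t + (- Phi u2 g) * f2 t.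
have Lg0 : L2 g0 by exact: L2_lin.
have S0 : in_S g0 0 0.
  apply: in_S_orth => //; rewrite -/(Phi _ _) /g0 PhiL//.
    by rewrite g1 Q2; ring.
  by rewrite mul1r mulNr -(P2 g (conj Lg g1)) subrr.
have := in_S_lin 1 1 Lg0 (L2_lin (Phi u1 f) (Phi u2 g) Lf1 Lf2) S0
  (in_S_lin (Phi u1 f) (Phi u2 g) Lf1 Lf2 S1 S2).
rewrite (_ : (fun t => 1 * g0 t + _) = f); last first.
  by apply/funext => t; rewrite /g0 /g; ring.
by rewrite g2; congr in_S; ring.
Qed.

(** The uniqueness half of [resolvent_set] identifies any h with the explicit function already known
    to lie in [S]. *)
Lemma resolvent_formula : exists m11 m12 m21 m22 : R[i], forall f h g, L2 f -> S h g ->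
  ae (fun t => g t - z * h t) f ->
  ae h (fun t => K f t +
    ((m11 * cInt rho I (fun s => u1 s * f s) + m12 * cInt rho I (fun s => u2 s * f s)) * u1 t +
     (m21 * cInt rho I (fun s => u1 s * f s) + m22 * cInt rho I (fun s => u2 s * f s)) * u2 t)).
Proof.
have [m11 [m12 [m21 [m22 Hm]]]] := resolvent_coefficients.
exists m11, m12, m21, m22 => f h g Lf Shg E.
apply: (hz.2 _ _ _ _ Shg (Hm f Lf)); apply: ae_trans E _.
by apply: ae_pointwise => t _; rewrite /sol; ring.
Qed.

End resolvent_section.

(** * The kernel *)

Section green_kernel.
Context {R : realType}.

Definition nsq (w : R[i]) : R := complex.Re w ^+ 2 + complex.Im w ^+ 2.

Lemma nsq_ge0 w : 0 <= nsq w.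
Proof. by rewrite addr_ge0// sqr_ge0. Qed.

Lemma nsqM x y : nsq (x * y) = nsq x * nsq y.
Proof. by rewrite /nsq cReM cImM; ring. Qed.

Lemma nsqD_le x y : nsq (x + y) <= 2 * (nsq x + nsq y).
Proof.
rewrite -subr_ge0 (_ : _ - _ = nsq (x - y)) ?nsq_ge0//.
by rewrite /nsq !cReD !cImD !cReN !cImN; ring.
Qed.

Definition bil (al be ga de p q r s : R[i]) : R[i] :=
  (al * (p * r) + be * (p * s)) + (ga * (q * r) + de * (q * s)).

(** The 4 comes from applying |x + y|^2 <= 2 (|x|^2 + |y|^2) twice; the remaining gap is a sum of
    products of nonnegative terms. *)
Lemma nsq_bil_le al be ga de p q r s : nsq (bil al be ga de p q r s) <=
  4 * (nsq al + nsq be + nsq ga + nsq de) * ((nsq p + nsq q) * (nsq r + nsq s)).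
Proof.
rewrite /bil (le_trans (nsqD_le _ _))//.
apply: (@le_trans _ _ (2 * (2 * (nsq (al * (p * r)) + nsq (be * (p * s))) +
   2 * (nsq (ga * (q * r)) + nsq (de * (q * s)))))).
  by rewrite ler_pM2l// lerD// nsqD_le.
rewrite !nsqM -subr_ge0.
move: (nsq_ge0 al) (nsq_ge0 be) (nsq_ge0 ga) (nsq_ge0 de)
  (nsq_ge0 p) (nsq_ge0 q) (nsq_ge0 r) (nsq_ge0 s).
move: (nsq al) (nsq be) (nsq ga) (nsq de) (nsq p) (nsq q) (nsq r) (nsq s)
  => A B C D P Q U V A0 B0 C0 D0 P0 Q0 U0 V0.
rewrite (_ : _ - _ = 4 * (A * (P * V + Q * U + Q * V) + B * (P * U + Q * U + Q * V) +
   C * (P * U + P * V + Q * V) + D * (P * U + P * V + Q * U))); last by ring.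
by rewrite !(mulr_ge0, addr_ge0).
Qed.

(** The congruence C^T M C of matrices: the new entries are the values of the form on the columns of
    the matrix of the c_ij. *)
Lemma bil_change al be ga de (c11 c12 c21 c22 p q r s : R[i]) :
  bil al be ga de (c11 * p + c12 * q) (c21 * p + c22 * q) (c11 * r + c12 * s) (c21 * r + c22 * s) =
  bil (bil al be ga de c11 c21 c11 c21) (bil al be ga de c11 c21 c12 c22)
      (bil al be ga de c12 c22 c11 c21) (bil al be ga de c12 c22 c12 c22) p q r s.
Proof. by rewrite /bil; ring. Qed.

Definition coef4 (al be ga de : R[i]) (i j : 'I_2) : R[i] :=
  if val i == 0%N then (if val j == 0%N then al else be)
  else (if val j == 0%N then ga else de).

Lemma sum_coef4 al be ga de (u : 'I_2 -> R -> R[i]) v1 v2 x y :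
  u = (fun i : 'I_2 => if val i == 0%N then v1 else v2) ->
  \sum_(i < 2) \sum_(j < 2) coef4 al be ga de i j * u i x * u j y =
  bil al be ga de (v1 x) (v2 x) (v1 y) (v2 y).
Proof.
move=> ->; rewrite !big_ord_recl !big_ord0 /coef4 /= /bil; ring.
Qed.

Context (a b : \bar R) (rho : {sigma_finite_measure set R -> \bar R}).
Notation I := (Itv a b).
Notation L2 := (L2 a b rho).
Let mI : measurable I := measurable_Itv a b.

(** Measurability is required on the whole space, not only on (a, b), so that it composes with the
    projections of R x R. *)
Definition cmeas d (T : measurableType d) (f : T -> R[i]) :=
  measurable_fun setT (cre f) /\ measurable_fun setT (cim f).

Lemma cmeasD d (T : measurableType d) (f g : T -> R[i]) :
  cmeas f -> cmeas g -> cmeas (fun t => f t + g t).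
Proof.
move=> [fr fi] [gr gi]; split.
  rewrite (_ : cre _ = cre f \+ cre g); first exact: measurable_funD.
  by apply/funext => t; rewrite /cre cReD.
rewrite (_ : cim _ = cim f \+ cim g); first exact: measurable_funD.
by apply/funext => t; rewrite /cim cImD.
Qed.

Lemma cmeasM d (T : measurableType d) (f g : T -> R[i]) :
  cmeas f -> cmeas g -> cmeas (fun t => f t * g t).
Proof.
move=> [fr fi] [gr gi]; split.
  rewrite (_ : cre _ = (cre f \* cre g) \- (cim f \* cim g)).
    by apply: measurable_funB; exact: measurable_funM.
  by apply/funext => t; rewrite /cre cReM.
rewrite (_ : cim _ = (cre f \* cim g) \+ (cim f \* cre g)).
  by apply: measurable_funD; exact: measurable_funM.
by apply/funext => t; rewrite /cim cImM.
Qed.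

Lemma cmeas_cst d (T : measurableType d) (c : R[i]) : cmeas (fun _ : T => c).
Proof. by split; exact: measurable_cst. Qed.

Lemma cmeas_if d (T : measurableType d) (B : T -> bool) (f g : T -> R[i]) :
  measurable_fun setT B -> cmeas f -> cmeas g -> cmeas (fun t => if B t then f t else g t).
Proof.
move=> mB [fr fi] [gr gi]; split.
  rewrite (_ : cre _ = (fun t => if B t then cre f t else cre g t)); last first.
    by apply/funext => t; rewrite /cre; case: ifP.
  by apply: measurable_fun_ifT.
rewrite (_ : cim _ = (fun t => if B t then cim f t else cim g t)); last first.
  by apply/funext => t; rewrite /cim; case: ifP.
by apply: measurable_fun_ifT.
Qed.

Lemma cmeas_comp d d' (T : measurableType d) (T' : measurableType d') (f : T -> R[i]) (h : T' -> T) :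
  measurable_fun setT h -> cmeas f -> cmeas (f \o h).
Proof. by move=> mh [fr fi]; split; [exact: (measurableT_comp fr)|exact: (measurableT_comp fi)]. Qed.

Definition bil_kernel (m n : R[i] * R[i] * R[i] * R[i]) (u1 u2 : R -> R[i]) (x y : R) : R[i] :=
  if y < x then bil m.1.1.1 m.1.1.2 m.1.2 m.2 (u1 x) (u2 x) (u1 y) (u2 y)
  else bil n.1.1.1 n.1.1.2 n.1.2 n.2 (u1 x) (u2 x) (u1 y) (u2 y).

Lemma cmeas_bil_kernel m n u1 u2 : cmeas u1 -> cmeas u2 ->
  cmeas (fun p : R * R => bil_kernel m n u1 u2 p.1 p.2).
Proof.
move=> m1 m2; apply: cmeas_if.
  exact: (measurable_fun_ltr measurable_snd measurable_fst).
all: have [f1 f2] := (cmeas_comp (measurable_fst : measurable_fun setT (@fst R R)) m1, cmeas_comp (measurable_fst : measurable_fun setT (@fst R R)) m2).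
all: have [s1 s2] := (cmeas_comp (measurable_snd : measurable_fun setT (@snd R R)) m1, cmeas_comp (measurable_snd : measurable_fun setT (@snd R R)) m2).
all: apply: cmeasD; apply: cmeasD; apply: cmeasM; by [exact: cmeas_cst|exact: cmeasM].
Qed.

(** With Q = |u1|^2 + |u2|^2 the kernel satisfies |G(x, y)|^2 <= C Q(x) Q(y), and Q is integrable.
    [C] adds the constants of both sides of the diagonal. *)
Lemma sqint2_bil_kernel m n u1 u2 : cmeas u1 -> cmeas u2 -> L2 u1 -> L2 u2 ->
  sqint2 a b rho (bil_kernel m n u1 u2).
Proof.
move=> m1 m2 Lu1 Lu2.
pose Q t := csq u1 t + csq u2 t.
have jQ : rho.-integrable I (EFin \o Q).
  by apply: integrableD_EFin => //; exact: L2_integrable_csq.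
pose C := 4 * (nsq m.1.1.1 + nsq m.1.1.2 + nsq m.1.2 + nsq m.2) +
  4 * (nsq n.1.1.1 + nsq n.1.1.2 + nsq n.1.2 + nsq n.2).
have jC := integrableZ_EFin C mI jQ.
have [mr mi] := cmeas_bil_kernel m n m1 m2.
have mII : measurable (I `*` I) by exact: measurableX.
split; first exact: measurable_funTS mr.
split; first exact: measurable_funTS mi.
have jP := integrable_prod_section (E := setT) mI measurableT jC jQ.
have mcsq : measurable_fun (I `*` I) (EFin \o csq (fun p : R * R => bil_kernel m n u1 u2 p.1 p.2)).
  apply/measurable_EFinP; apply: measurable_funTS.
  by apply: measurable_funD; exact: measurable_funX.
have Q0 t : 0 <= Q t by rewrite addr_ge0// csq_ge0.
have four_ge0 (v : R[i] * R[i] * R[i] * R[i]) :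
    0 <= 4 * (nsq v.1.1.1 + nsq v.1.1.2 + nsq v.1.2 + nsq v.2).
  by apply: mulr_ge0 => //; apply: addr_ge0; [apply: addr_ge0; [apply: addr_ge0|]|]; exact: nsq_ge0.
have C0 : 0 <= C := addr_ge0 (four_ge0 m) (four_ge0 n).
apply: le_lt_trans (integrable_lty measurableT jP).
apply: (@le_trans _ _ (\int[(rho \x rho)%E]_(p in I `*` I)
   (((fun t => C * Q t) \_ I) p.1 * ((Q \_ I) p.2 * \1_setT p))%:E)%E).
  apply: ge0_le_integral => //.
  - by move=> p _; rewrite lee_fin addr_ge0// sqr_ge0.
  - by apply: measurable_funTS; exact: measurable_int jP.
  - move=> p [Ix Iy]; rewrite lee_fin !patchE !mem_set// indicT mulr1.
    rewrite -mulrA.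
    change (nsq (bil_kernel m n u1 u2 p.1 p.2) <= C * (Q p.1 * Q p.2)).
    rewrite /bil_kernel; case: ifP => _; apply: (le_trans (nsq_bil_le _ _ _ _ _ _ _ _));
      (apply: ler_wpM2r; first exact: mulr_ge0 (Q0 _) (Q0 _)).
      by rewrite lerDl.
    by rewrite lerDr.
apply: ge0_subset_integral => //; first exact: measurable_int jP.
move=> p _; rewrite lee_fin !mulr_ge0// patchE; case: ifP => // _.
by rewrite mulr_ge0.
Qed.

Lemma cInt_if (phi : R -> R[i]) (x : R) : cintegrable rho I phi ->
  cintegrable rho I (fun y => if y < x then phi y else 0) /\
  cInt rho I (fun y => if y < x then phi y else 0) = cpart a b rho phi x.
Proof.
move=> [fr fi].
have E (h : R -> R) : (fun y => if y < x then h y else 0) = h \_ [set y | y < x].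
  apply/funext => y; rewrite patchE; case: ifPn => yx; case: ifPn => //.
    by move=> /negP[]; exact/mem_set.
  by move=> /set_mem /= yx'; rewrite yx' in yx.
have Er : cre (fun y => if y < x then phi y else 0) = cre phi \_ [set y | y < x].
  by rewrite -E; apply/funext => y; rewrite /cre; case: ifP.
have Ei : cim (fun y => if y < x then phi y else 0) = cim phi \_ [set y | y < x].
  by rewrite -E; apply/funext => y; rewrite /cim; case: ifP.
have J h : rho.-integrable I (EFin \o h) -> rho.-integrable I (EFin \o (h \_ [set y | y < x])).
  move=> jh; rewrite -restrict_EFin; apply/(integrable_restrict rho (measurable_lt_set x) mI).
  apply: integrableS jh => //.
  by apply: measurableI => //; exact: measurable_lt_set.
split; first by split; rewrite ?Er ?Ei; exact: J.
by rewrite /cInt Er Ei /cpart /cInt -!Rintegral_mkcondr.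
Qed.

(** The shifts +1 and -1 below the diagonal are the kernel u1(x) u2(y) - u2(x) u1(y) of K on y < x;
    the part with the m_ij is the same on both sides. *)
Lemma cInt_green_kernel m11 m12 m21 m22 u1 u2 f x : L2 u1 -> L2 u2 -> L2 f ->
  let G := bil_kernel (m11, m12 + 1, m21 - 1, m22) (m11, m12, m21, m22) u1 u2 in
  cintegrable rho I (fun y => G x y * f y) /\
  cInt rho I (fun y => G x y * f y) = green a b rho u1 u2 f x +
    ((m11 * cInt rho I (fun s => u1 s * f s) + m12 * cInt rho I (fun s => u2 s * f s)) * u1 x +
     (m21 * cInt rho I (fun s => u1 s * f s) + m22 * cInt rho I (fun s => u2 s * f s)) * u2 x).
Proof.
move=> Lu1 Lu2 Lf G.
have j1 := L2_prod Lu1 Lf; have j2 := L2_prod Lu2 Lf.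
have [k1 e1] := cInt_if x j1; have [k2 e2] := cInt_if x j2.
have GE y : 1 * (u1 x * (if y < x then u2 y * f y else 0) + (- u2 x) * (if y < x then u1 y * f y else 0)) +
    1 * ((m11 * u1 x + m21 * u2 x) * (u1 y * f y) + (m12 * u1 x + m22 * u2 x) * (u2 y * f y)) = G x y * f y.
  by rewrite /G /bil_kernel; case: ifP => _; rewrite /bil /=; ring.
have J := cintegrable_lin 1 1 (cintegrable_lin (u1 x) (- u2 x) k2 k1)
  (cintegrable_lin (m11 * u1 x + m21 * u2 x) (m12 * u1 x + m22 * u2 x) j1 j2).
split; first by apply: eq_cintegrable J => y _; exact: GE.
rewrite -(@eq_cInt _ _ I _ _ (fun y _ => GE y)) cInt_lin; [|exact: cintegrable_lin|exact: cintegrable_lin].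
rewrite !cInt_lin// e1 e2 /green; ring.
Qed.

End green_kernel.

(** * Square integrability of solutions and changes of basis *)

Section solutions.
Context {R : realType} (a b : \bar R) (rho : {sigma_finite_measure set R -> \bar R})
  (sgp sgm chp chm : {measure set R -> \bar R}).
Notation I := (Itv a b).
Notation L2 := (L2 a b rho).
Notation nu := (nu5 rho sgp sgm chp chm).
Notation sys := (sys rho sgp sgm chp chm).
Notation is_solution := (is_solution a b rho sgp sgm chp chm).
Let mI : measurable I := measurable_Itv a b.
Hypothesis nu_fin : forall j, loc_fin I (nu j).

Lemma loc_int_csq u p k : sys I u p k -> loc_int I rho (csq u).
Proof.
move=> [[Hr Hi] _] x y Ix Iy.
have jr := prim_loc_intM (@Itv_itv R a b) nu_fin Hr (prim_loc_int (@Itv_itv R a b) nu_fin 4 Hr) Ix Iy.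
have ji := prim_loc_intM (@Itv_itv R a b) nu_fin Hi (prim_loc_int (@Itv_itv R a b) nu_fin 4 Hi) Ix Iy.
exact: (integrableD_EFin (measurable_cc x y) jr ji).
Qed.

Lemma limit_circle_L2 (z : R[i]) u : lc_left a b rho sgp sgm chp chm ->
  lc_right a b rho sgp sgm chp chm -> is_solution z u -> L2 u.
Proof.
move=> lcl lcr su.
have [p [k [Hs _]]] := is_tau_sys nu_fin su.
have jc := loc_int_csq Hs.
have [mr mi] := cloc_int_measurable (cloc_int_prim (@Itv_itv R a b) nu_fin 4 Hs.1).
have [c [ac cb] [_ [_ fl]]] := lcl z u su.
have [c' [ac' c'b] [_ [_ fr]]] := lcr z u su.
(* Nothing orders c and c'. With m in place of c' the interval splits into a piece near a, a compact
   piece [c, m], and a piece inside (c', b). *)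
pose m := Num.max c c'.
have Ic : I c by []; have Ic' : I c' by [].
have Im : I m by rewrite /m /Num.max; case: ifP.
have mcsq : measurable_fun I (EFin \o csq u).
  by apply/measurable_EFinP; apply: measurable_funD; exact: measurable_funX.
split=> //; split=> //.
pose A := Itv a c%:E; pose C := [set t | c <= t <= m]; pose B := I `&` [set t | m < t].
have -> : I = A `|` (C `|` B).
  apply/seteqP; split => t.
    move=> [at_ tb]; case: (ltP t c) => tc; first by left; split=> //; rewrite lte_fin.
    by right; case: (leP t m) => tm; [left; rewrite /C /= tc|right].
  move=> [[at_ tc]|[/= /andP[ct tm]|[]//]].
    by split=> //; exact: lt_trans tc cb.
  by apply: (Itv_itv Ic Im); rewrite ct.
have mA : measurable A := measurable_Itv a c%:E.
have mC : measurable C := measurable_cc c m.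
have mB : measurable B by apply: measurableI => //; exact: measurable_gt_set.
have AI : A `<=` I by move=> t [at_ tc]; split=> //; exact: lt_trans tc cb.
have CI : C `<=` I by move=> t; exact: (Itv_itv Ic Im).
have BI : B `<=` I by exact: subIsetl.
have f0 (D : set R) : forall x, D x -> (0 <= (csq u x)%:E)%E by move=> x _; rewrite lee_fin csq_ge0.
have ms (D : set R) : D `<=` I -> measurable_fun D (EFin \o csq u).
  by move=> DI; exact: measurable_funS mcsq.
have CBI : C `|` B `<=` I by move=> t [/CI|/BI].
have mCB : measurable (C `|` B) by exact: measurableU.
rewrite ge0_integral_setU//; last 3 first.
- by apply: ms => t [/AI|/CBI].
- exact: f0.
- apply/disj_set2P; apply/seteqP; split => // t [[_]]; rewrite lte_fin => tc [/= /andP[]|[_ /=]].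
    by rewrite leNgt tc.
  by rewrite gt_max ltNge (ltW tc).
rewrite ge0_integral_setU//; last 3 first.
- exact: ms.
- exact: f0.
- by apply/disj_set2P; apply/seteqP; split => // t [/= /andP[_ tm] [_ /=]]; rewrite ltNge tm.
apply: lte_add_pinfty => //; apply: lte_add_pinfty.
  exact: integrable_lty (jc c m Ic Im).
apply: le_lt_trans fr; apply: ge0_subset_integral => //; first exact: measurable_Itv.
- by apply: ms => t [c't tb]; split=> //; exact: lt_trans ac' c't.
- exact: f0.
- move=> t [[at_ tb] /= mt]; split=> //; rewrite lte_fin; apply: le_lt_trans mt.
  by rewrite /m le_max lexx orbT.
Qed.

(** The case r = 0 of [tau_green], where K r vanishes. *)
Lemma solution_span (z : R[i]) (c : R) u1 p1 u2 p2 u :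
  I c -> null_jumps rho sgp sgm chp chm I ->
  sys I u1 p1 (fun t => z * u1 t) -> sys I u2 p2 (fun t => z * u2 t) ->
  (forall t, I t -> u1 t * p2 t - u2 t * p1 t = 1) -> L2 u1 -> L2 u2 ->
  is_solution z u -> exists d1 d2, forall t, I t -> u t = d1 * u1 t + d2 * u2 t.
Proof.
move=> Ic nj H1 H2 W L1 L2' su.
have E : ae_eqc rho I (fun t => z * u t - z * u t) (fun=> 0).
  by apply: ae_pointwise => t _; rewrite subrr.
have [d1 [d2 Hd]] := tau_green nu_fin nj H1 H2 W L1 L2' su (L2_0 a b rho) E (ex_intro _ c Ic).
exists d1, d2 => t It; rewrite Hd// (_ : green _ _ _ _ _ _ _ = 0) ?add0r//.
rewrite /green.
have E0 (v : R -> R[i]) : cpart a b rho (fun s => v s * 0) t = 0.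
  have mD : measurable (I `&` [set s | s < t]).
    by apply: measurableI => //; exact: measurable_lt_set.
  rewrite /cpart (@eq_cInt _ _ _ _ (fun=> 0)); last by move=> s _; rewrite mulr0.
  by apply: complex_eqP; rewrite /= /cre /cim Rintegral_cst// mul0r.
by rewrite !E0 !mulr0 subrr.
Qed.

Lemma change_of_basis (u1 u2 v1 v2 : R -> R[i]) (al be ga de : R[i]) :
  (forall t, I t -> v1 t = al * u1 t + be * u2 t) ->
  (forall t, I t -> v2 t = ga * u1 t + de * u2 t) -> lin_indep2 a b v1 v2 ->
  exists c11 c12 c21 c22, forall t, I t ->
    u1 t = c11 * v1 t + c12 * v2 t /\ u2 t = c21 * v1 t + c22 * v2 t.
Proof.
move=> E1 E2 LI; pose D := al * de - be * ga.
have D0 : D != 0.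
  (* If the determinant vanished, de v1 - be v2 = D u1 and ga v1 - al v2 = - D u2 would be zero;
     independence then makes all four coefficients 0, so v1 = 0, against independence once more. *)
  apply/eqP => D0.
  have [de0 be0] : de = 0 /\ - be = 0.
    apply: LI => t It; rewrite E1// E2//.
    by transitivity (D * u1 t); [rewrite /D; ring|rewrite D0 mul0r].
  have [ga0 al0] : ga = 0 /\ - al = 0.
    apply: LI => t It; rewrite E1// E2//.
    by transitivity (- D * u2 t); [rewrite /D; ring|rewrite D0 oppr0 mul0r].
  have [/eqP] : (1 : R[i]) = 0 /\ (0 : R[i]) = 0; last by rewrite oner_eq0.
  apply: LI => t It; rewrite E1//; move/eqP: be0; rewrite oppr_eq0 => /eqP ->.
  by move/eqP: al0; rewrite oppr_eq0 => /eqP ->; ring.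
exists (de / D), (- be / D), (- ga / D), (al / D) => t It; rewrite E1// E2//.
have DD : D / D = 1 by rewrite mulfV.
split.
  by rewrite -[LHS]mulr1 -DD {1}/D; ring.
by rewrite -[LHS]mulr1 -DD {1}/D; ring.
Qed.

End solutions.

(** * Assembling the kernel of the resolvent *)

Theorem theorem8p1 (R : realType) (a b : \bar R)
  (rho : {sigma_finite_measure set R -> \bar R})
  (sgp sgm chp chm : {measure set R -> \bar R})
  (hab : (a < b)%E)
  (H1 : locfin a b rho)
  (H2 : signed_locfin a b chp chm)
  (H3 : signed_locfin a b sgp sgm /\ (forall x, Itv a b x -> ssupp a b sgp sgm x))
  (H4 : forall x, Itv a b x ->
          spt sgp sgm x * spt chp chm x = 0 /\ spt sgp sgm x * fine (rho [set x]) = 0)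
  (H5 : gap_condition a b rho sgp sgm chp chm)
  (H6 : exists x y, x <> y /\ supp a b rho x /\ supp a b rho y)
  (lca : lc_left a b rho sgp sgm chp chm)
  (lcb : lc_right a b rho sgp sgm chp chm)
  (S : (R -> R[i]) -> (R -> R[i]) -> Prop)
  (HS : self_adjoint_restriction a b rho sgp sgm chp chm S)
  (z : R[i]) (hz : resolvent_set a b rho S z) :
  exists G : R -> R -> R[i],
    [/\ sqint2 a b rho G,
        (forall f : R -> R[i], L2 a b rho f ->
         forall h g : R -> R[i], S h g ->
           ae_eqc rho (Itv a b) (fun x => g x - z * h x) f ->
           rho.-negligible (Itv a b `&` [set x |
             ~ (cintegrable rho (Itv a b) (fun y => G x y * f y) /\
                h x = cInt rho (Itv a b) (fun y => G x y * f y))]))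
      & (forall u1 u2 : R -> R[i],
           is_solution a b rho sgp sgm chp chm z u1 ->
           is_solution a b rho sgp sgm chp chm z u2 ->
           lin_indep2 a b u1 u2 ->
           let u := fun i : 'I_2 => if val i == 0%N then u1 else u2 in
           exists mplus mminus : 'I_2 -> 'I_2 -> R[i],
             forall x y : R, Itv a b x -> Itv a b y ->
               G x y = if y < x
                       then \sum_(i < 2) \sum_(j < 2) mplus i j * u i x * u j y
                       else \sum_(i < 2) \sum_(j < 2) mminus i j * u i x * u j y)].
Proof.
have nu_fin j : loc_fin (Itv a b) (nu5 rho sgp sgm chp chm j).
  have [c1 c2 _] := H2; have [s1 s2 _] := H3.1.
  by move: j => [|[|[|[|[|j]]]]]; rewrite /nu5 /= ?nth_nil; apply: locfin_loc_fin.
have nj := null_jumps_Itv H1 H2 H3.1 H4.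
have [c Ic] : exists c, Itv a b c by have [x [y [_ [[Ix _] _]]]] := H6; exists x.
have [w1 [p1 [w2 [p2 [S1' S2' W']]]]] := fundamental_system (@Itv_itv R a b) nu_fin nj z Ic.
(* Nothing is known about w1 and w2 outside (a, b), where they need not be measurable. *)
pose pat (w : R -> R[i]) t := if t \in Itv a b then w t else 0.
have patE w t : Itv a b t -> pat w t = w t by move=> It; rewrite /pat mem_set.
pose u1 := pat w1; pose u2 := pat w2.
have S1 : sys rho sgp sgm chp chm (Itv a b) u1 p1 (fun t => z * u1 t).
  by apply: (sys_ext (@Itv_itv R a b) S1') => // t It; rewrite /u1 patE.
have S2 : sys rho sgp sgm chp chm (Itv a b) u2 p2 (fun t => z * u2 t).
  by apply: (sys_ext (@Itv_itv R a b) S2') => // t It; rewrite /u2 patE.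
have W t : Itv a b t -> u1 t * p2 t - u2 t * p1 t = 1.
  by move=> It; rewrite /u1 /u2 !patE// W'.
have solL2 u : is_solution a b rho sgp sgm chp chm z u -> L2 a b rho u.
  exact: limit_circle_L2.
have L1 : L2 a b rho u1 by apply: solL2; exact: (sys_is_tau nu_fin Ic S1 (ae_refl _ _ _ _)).
have L2' : L2 a b rho u2 by apply: solL2; exact: (sys_is_tau nu_fin Ic S2 (ae_refl _ _ _ _)).
have cm w p k : sys rho sgp sgm chp chm (Itv a b) w p k -> cmeas (pat w).
  move=> Hs; have [mr mi] := cloc_int_measurable (cloc_int_prim (@Itv_itv R a b) nu_fin 4 Hs.1).
  have mI := measurable_Itv a b.
  split.
    rewrite (_ : cre _ = (cre w) \_ (Itv a b)); first by apply/(measurable_restrictT _ mI).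
    by apply/funext => t; rewrite patchE /pat /cre; case: ifP.
  rewrite (_ : cim _ = (cim w) \_ (Itv a b)); first by apply/(measurable_restrictT _ mI).
  by apply/funext => t; rewrite patchE /pat /cim; case: ifP.
have m1 : cmeas u1 := cm _ _ _ S1'.
have m2 : cmeas u2 := cm _ _ _ S2'.
have [m11 [m12 [m21 [m22 Hm]]]] := resolvent_formula nu_fin nj Ic S1 S2 W L1 L2' HS hz.
pose mp := (m11, m12 + 1, m21 - 1, m22); pose mm := (m11, m12, m21, m22).
exists (bil_kernel mp mm u1 u2); split.
- exact: sqint2_bil_kernel.
(* The integral formula for the right-hand side holds at every x; the exceptional null set comes
   only from h being a representative of R_z f. *)
- move=> f Lf h g Shg E; apply: negligibleS (Hm f h g Lf Shg E) => x [Ix nx]; split=> //= e.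
  have [J cE] := cInt_green_kernel m11 m12 m21 m22 x L1 L2' Lf.
  by apply: nx; split=> //; rewrite cE.
- move=> v1 v2 sv1 sv2 LI u.
  have [al [be E1]] := solution_span nu_fin Ic nj S1 S2 W L1 L2' sv1.
  have [ga [de E2]] := solution_span nu_fin Ic nj S1 S2 W L1 L2' sv2.
  have [c11 [c12 [c21 [c22 E]]]] := change_of_basis E1 E2 LI.
  (* The coefficients for v1, v2 are the congruence transforms of [mp] and [mm] under the change of
     basis. *)
  pose co (m : R[i] * R[i] * R[i] * R[i]) := let B := bil m.1.1.1 m.1.1.2 m.1.2 m.2 in
    coef4 (B c11 c21 c11 c21) (B c11 c21 c12 c22) (B c12 c22 c11 c21) (B c12 c22 c12 c22).
  exists (co mp), (co mm) => x y Ix Iy.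
  rewrite !(@sum_coef4 _ _ _ _ _ u v1 v2)// /bil_kernel.
  have [-> ->] := E x Ix; have [-> ->] := E y Iy.
  by rewrite !bil_change.
Qed.
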